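(* For each $\lambda\in(0,\infty)$, let $\Phi_\lambda=\sum_{n=1}^\infty\delta_{X_n}$ be a homogeneous Poisson point process on $\mathbb{R}^d$ with intensity $\lambda$, and let $I_\lambda(z)=\sum_{n=1}^\infty P_n\,\ell(z-X_n)$, $z\in\mathbb{R}^d$, be the associated shot-noise field with i.i.d. amplitudes $P_n$ and response function $\ell$ as in the context. Suppose that $\mathbb{E}[P_1^2]<\infty$, and set $$\widetilde{I_\lambda}(z)=\frac{I_\lambda(z)-\mathbb{E}[I_\lambda(z)]}{\lambda^{1/2}},\qquad z\in\mathbb{R}^d.$$ Then, as $\lambda\to\infty$, $\{\widetilde{I_\lambda}(z)\}_{z\in\mathbb{R}^d}$ converges in finite dimensional distributions to a zero-mean Gaussian random field $\{N(z)\}_{z\in\mathbb{R}^d}$ with covariance function $$\mathrm{Cov}[N(z_1),N(z_2)]=\mathbb{E}[P_1^2]\int_{\mathbb{R}^d}\ell(z_1-x)\,\ell(z_2-x)\,\mathrm{d}x,\qquad z_1,z_2\in\mathbb{R}^d.$$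
   Context: Here $d\in\mathbb{N}=\{1,2,\ldots\}$. The amplitudes $P_n$, $n\in\mathbb{N}$, are i.i.d. nonnegative random variables, independent of $\Phi_\lambda$, whose common distribution function $F_P$ does not depend on $\lambda$ and has finite mean $p=\int_0^\infty t\,\mathrm{d}F_P(t)<\infty$. The response function $\ell:\mathbb{R}^d\to[0,\infty)$ does not depend on $\lambda$, is bounded, and satisfies $\int_{\mathbb{R}^d}\ell(x)\,\mathrm{d}x<\infty$. Under these conditions $\mathbb{E}[I_\lambda(z)]=\lambda p\int_{\mathbb{R}^d}\ell(x)\,\mathrm{d}x<\infty$ for every $z\in\mathbb{R}^d$. Convergence in finite dimensional distributions means that for every $m\in\mathbb{N}$ and $z_1,\ldots,z_m\in\mathbb{R}^d$, the random vector of values of the field at $z_1,\ldots,z_m$ converges in distribution. *)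

(* Defs.v *)
From HB Require Import structures.
From mathcomp Require Import all_boot all_order all_algebra.
From mathcomp Require Import all_classical all_reals all_analysis measurable_realfun.

Set Implicit Arguments.
Unset Strict Implicit.
Unset Printing Implicit Defensive.

Import Order.TTheory GRing.Theory Num.Theory.
Import numFieldNormedType.Exports.

Local Open Scope classical_set_scope.
Local Open Scope ring_scope.

(* ['rV[R]_n] is the library's topological vector space R^n.  The library puts
   a sigma-algebra on tuples but not on row vectors; as for tuples, we take the
   one generated by the coordinates, which on R^n is the Borel one. *)
Section rV_measurable.
Context {d : measure_display} {T : measurableType d} (n : nat).

Let coord (i : 'I_n) (x : 'rV[T]_n) : T := x ord0 i.

Let rV_set0 : g_sigma_preimage coord set0.
Proof. exact: sigma_algebra0. Qed.

Let rV_setC A : g_sigma_preimage coord A -> g_sigma_preimage coord (~` A).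
Proof. exact: sigma_algebraC. Qed.

Let rV_bigcup (F : _^nat) : (forall i, g_sigma_preimage coord (F i)) ->
  g_sigma_preimage coord (\bigcup_i (F i)).
Proof. exact: sigma_algebra_bigcup. Qed.

HB.instance Definition _ := @isMeasurable.Build (measure_tuple_display d)
  'rV[T]_n (g_sigma_preimage coord) rV_set0 rV_setC rV_bigcup.

End rV_measurable.

Lemma measurable_coord (d : measure_display) (T : measurableType d) (n : nat)
  (i : 'I_n) : measurable_fun [set: 'rV[T]_n] (fun x : 'rV[T]_n => x ord0 i).
Proof.
move=> _ Y mY; rewrite setTI; apply: sub_sigma_algebra => /=.
rewrite -bigcup_seq/=; exists i => /=; first by rewrite mem_index_enum.
by exists Y => //; rewrite setTI.
Qed.

Lemma measurable_fun_coordP (d d' : measure_display) (S : measurableType d)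
    (T : measurableType d') (n : nat) (f : S -> 'rV[T]_n) :
  (forall i, measurable_fun setT (fun s => f s ord0 i)) ->
  measurable_fun setT f.
Proof.
move=> mf.
apply: (@measurability _ _ _ _ _ _
  (\big[setU/set0]_(i < n) preimage_set_system setT
     (fun x : 'rV[T]_n => x ord0 i) measurable)) => //.
move=> _ [A + <-]; rewrite -bigcup_seq/= => -[i _ [B mB <-]].
by rewrite !setTI; have := mf i measurableT B mB; rewrite setTI.
Qed.
(* Lebesgue measure on R^n, as the n-fold product of Lebesgue measure on R. *)
Section lebesgue_rV.
Context {R : realType}.

Definition rV_cons (n : nat) (p : 'rV[R]_n * R) : 'rV[R]_n.+1 :=
  row_mx p.2%:M p.1 : 'rV[R]_(1 + n).

Lemma measurable_rV_cons (n : nat) : measurable_fun setT (@rV_cons n).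
Proof.
apply: measurable_fun_coordP => i.
rewrite /rV_cons /=; under eq_fun do rewrite mxE.
case: (@fintype.split 1 n i) => j.
  by under eq_fun do rewrite mxE (ord1 j) eqxx mulr1n; exact: measurable_snd.
exact: (measurableT_comp (measurable_coord j) measurable_fst).
Qed.

Section step.
Variables (n : nat) (mu : {measure set 'rV[R]_n -> \bar R}).

Definition lebesgue_rVS : set 'rV[R]_n.+1 -> \bar R :=
  pushforward (mu \x lebesgue_measure)%E (@rV_cons n).

Let lebesgue_rVS0 : lebesgue_rVS set0 = 0%E.
Proof. by rewrite /lebesgue_rVS /pushforward preimage_set0 measure0. Qed.

Let lebesgue_rVS_ge0 A : (0 <= lebesgue_rVS A)%E.
Proof. exact: (measure_ge0 (mu \x lebesgue_measure)%E). Qed.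

Let lebesgue_rVS_sigma_additive : semi_sigma_additive lebesgue_rVS.
Proof.
have mf := @measurable_rV_cons n.
pose nu : {measure set 'rV[R]_n.+1 -> \bar R} :=
  measure_function_pushforward__canonical__measure_function_Measure
    (mu \x lebesgue_measure)%E mf.
move=> F mF tF mUF; exact: (@measure_semi_sigma_additive _ _ _ nu).
Qed.

HB.instance Definition _ := isMeasure.Build _ _ _ lebesgue_rVS
  lebesgue_rVS0 lebesgue_rVS_ge0 lebesgue_rVS_sigma_additive.

End step.

Fixpoint lebesgue_rV (n : nat) : {measure set 'rV[R]_n -> \bar R} :=
  if n is m.+1 then lebesgue_rVS (lebesgue_rV m) else \d_(0 : 'rV[R]_0).

End lebesgue_rV.
Arguments lebesgue_rV {R} n.

Section independence.
Context {d : measure_display} {T : measurableType d} {R : realType}.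
Variable P : probability T R.

Definition mutually_independent (I : eqType) (G : I -> set (set T)) :=
  forall (s : seq I) (E : I -> set T), uniq s ->
    (forall i, i \in s -> G i (E i)) ->
    P (\bigcap_(i in [set` s]) E i) = (\prod_(i <- s) P (E i))%E.

Definition independent_RVs (I : eqType) (d' : measure_display)
    (T' : measurableType d') (X : I -> T -> T') :=
  mutually_independent (fun i => g_sigma_algebra_preimage (X i)).

Definition sigma_seq (d' : measure_display) (T' : measurableType d')
    (X : nat -> T -> T') : set (set T) :=
  <<s \bigcup_n g_sigma_algebra_preimage (X n) >>.

Definition independent_seqs (d1 d2 : measure_display)
    (T1 : measurableType d1) (T2 : measurableType d2)
    (X : nat -> T -> T1) (Y : nat -> T -> T2) :=
  forall E F, sigma_seq X E -> sigma_seq Y F ->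
    P (E `&` F) = (P E * P F)%E.

End independence.

(* A measure is only meaningful on measurable sets, hence the restriction. *)
Definition has_law {d d' : measure_display} {T : measurableType d}
    {T' : measurableType d'} {R : realType} (P : probability T R)
    (X : T -> T') (mu : set T' -> \bar R) :=
  forall B, measurable B -> P (X @^-1` B) = mu B.

(* With standard deviation 0 the library's [normal_prob] is not a Dirac mass,
   so degenerate Gaussian laws are listed separately. *)
Definition is_gaussian {d : measure_display} {T : measurableType d}
    {R : realType} (P : probability T R) (Y : T -> R) :=
  (exists m s : R, s != 0 /\ has_law P Y (normal_prob m s)) \/
  (exists m : R, has_law P Y \d_m).

Definition gaussian_field {d : measure_display} {T : measurableType d}
    {R : realType} (P : probability T R) (I : Type) (N : I -> T -> R) :=
  forall (m : nat) (z : 'I_m -> I) (a : 'I_m -> R),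
    is_gaussian P (fun w => \sum_(i < m) a i * N (z i) w).

(* The random vectors indexed by lambda may live on different probability
   spaces. *)
Definition cvg_in_distribution {R : realType} (m : nat)
    (dT : R -> measure_display) (T : forall lam, measurableType (dT lam))
    (P : forall lam, probability (T lam) R) (V : forall lam, T lam -> 'rV[R]_m)
    (dS : measure_display) (S : measurableType dS) (Q : probability S R)
    (W : S -> 'rV[R]_m) :=
  forall f : 'rV[R]_m -> R, continuous f ->
    (exists M : R, forall x, `|f x| <= M) ->
    ('E_(P lam)[f \o V lam] @[lam --> +oo%R] --> 'E_Q[f \o W])%E.

Definition cvg_fdd {R : realType} (I : Type)
    (dT : R -> measure_display) (T : forall lam, measurableType (dT lam))
    (P : forall lam, probability (T lam) R) (Y : forall lam, I -> T lam -> R)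
    (dS : measure_display) (S : measurableType dS) (Q : probability S R)
    (N : I -> S -> R) :=
  forall (m : nat) (z : 'I_m -> I),
    cvg_in_distribution P (fun lam w => \row_i Y lam (z i) w)
                        Q (fun w => \row_i N (z i) w).

Section shot_noise.
Context {d : measure_display} {T : measurableType d} {R : realType} {n : nat}.
Variable P : probability T R.

(* The random measure \sum_k \delta_(X k) evaluated at B. *)
Definition point_process (X : nat -> T -> 'rV[R]_n) (B : set 'rV[R]_n) (w : T)
  : \bar R := (\sum_(0 <= k <oo) \d_(X k w) B)%E.

(* The second argument of the library's [poisson_prob] is a dummy. *)
Definition poisson_process (lam : R) (X : nat -> T -> 'rV[R]_n) :=
  (forall (B : set 'rV[R]_n) (k : nat),
     measurable B -> (lebesgue_rV n B < +oo)%E ->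
     P [set w | point_process X B w = k%:R%:E] =
     poisson_prob (lam * fine (lebesgue_rV n B)) 0 [set k]) /\
  (forall (m : nat) (B : 'I_m -> set 'rV[R]_n),
     (forall i, measurable (B i) /\ (lebesgue_rV n (B i) < +oo)%E) ->
     trivIset setT B ->
     independent_RVs P (fun i => point_process X (B i))).

Definition shot_noise (A : nat -> T -> R) (X : nat -> T -> 'rV[R]_n)
    (ell : 'rV[R]_n -> R) (z : 'rV[R]_n) (w : T) : \bar R :=
  (\sum_(0 <= k <oo) (A k w * ell (z - X k w))%:E)%E.

(* For nonnegative [A] and [ell] the shot noise is a well-defined element of
   [0, +oo]; [fine] is harmless whenever its expectation is finite. *)
Definition normalized_shot_noise (lam : R) (A : nat -> T -> R)
    (X : nat -> T -> 'rV[R]_n) (ell : 'rV[R]_n -> R) (z : 'rV[R]_n) (w : T)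
  : R :=
  (fine (shot_noise A X ell z w) - fine (\int[P]_v shot_noise A X ell z v)%E)
    / Num.sqrt lam.

End shot_noise.

(* Main.v *)
(* The characteristic function of a marked Poisson sum is explicit: for
   integrable [f], with [C] the characteristic function of the amplitude law,
     E exp(i sum_k A_k f(X_k)) = exp(lam int (C(f(x)) - 1) dx).
   For simple [f] this follows from the independence of the amplitudes and of
   the Poisson counts of the level sets; Campbell's formula extends it to all
   integrable [f] by approximation in L^1.  Taking for [f] the combination
   lam^(-1/2) sum_i t_i ell(z_i - .), a second order expansion of [C] and
   dominated convergence give the Gaussian limit
   exp(- E[A^2] int (sum_i t_i ell(z_i - x))^2 dx / 2).  The exact formula also
   bounds the second moments uniformly in lam, hence tightness; on a cube,
   bounded continuous functions are uniform limits of trigonometric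
   polynomials, so tightness and convergence of characteristic functions imply
   weak convergence.

   The limit field, indexed by all of R^d, is built without Kolmogorov's
   extension theorem, as the ultralimit of the fields for lam = 1, 2, 3, ...
   on a Loeb space; tightness makes this ultralimit finite almost surely.

   Characteristic functions are handled over the reals: knowing E exp(i Y)
   amounts to knowing E cos(a + Y) for every phase [a]. *)
From HB Require Import structures.
Require Import Defs.
From mathcomp Require Import all_boot all_order all_algebra.
From mathcomp Require Import all_classical all_reals all_analysis measurable_realfun.
From mathcomp Require Import ring lra.

Set Implicit Arguments.
Unset Strict Implicit.
Unset Printing Implicit Defensive.

Import Order.TTheory GRing.Theory Num.Theory.
Import numFieldNormedType.Exports.

Local Open Scope classical_set_scope.
Local Open Scope ring_scope.

(** * Independence and expectations of products *)

(** The law of a single point X_k is unknown: a Poisson process only provides the counts of sets, so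
    every computation has to end in counts. The amplitudes are integrated out first, on events of
    the sigma-algebra of the positions; each point then contributes a factor C(f(X_k)) that, for
    simple f, depends only on its level set. Regrouping gives the product, over the nonzero levels
    v, of C(v) to the power of the count of that level. The level 0, in general of infinite measure,
    drops out because C(0) = 1. All this is done for the first N points with approximation errors
    uniform in N, so the limit in N carries over from simple to integrable f.

    In real form a complex factor is a modulus and an argument: independent factors are multiplied
    by adding arguments inside one cosine, and an imaginary part is a cosine with phase shifted by
    pi / 2.

    The second moments behind tightness are limits of 2 N^2 (1 - E cos(Y / N)), which takes the
    place of a second order Campbell formula. *)

Section bounded_expectation.
Context d (T : measurableType d) (R : realType) (P : probability T R).
Implicit Types f g : T -> R.

(** No measure occurs here: a member is integrable against every probability, so linearity and
    monotonicity of expectations need no separate integrability proofs. *)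
Definition bounded_measurable f :=
  measurable_fun setT f /\ exists M : R, forall x, `|f x| <= M.

Lemma bounded_measurable_integrable f : bounded_measurable f ->
  P.-integrable setT (EFin \o f).
Proof.
move=> [mf [M fM]]; apply: measurable_bounded_integrable => //.
  exact: (le_lt_trans (probability_le1 P measurableT) (ltry _)).
exists M; split; first exact: num_real.
by move=> r Mr x _; exact: (le_trans (fM x) (ltW Mr)).
Qed.

Lemma bounded_measurable_cst r : bounded_measurable (cst r).
Proof. by split; [exact: measurable_cst|exists `|r|]. Qed.

Lemma bounded_measurableM f g : bounded_measurable f -> bounded_measurable g ->
  bounded_measurable (fun x => f x * g x).
Proof.
move=> [mf [M fM]] [mg [N gN]]; split; first exact: measurable_funM.
by exists (M * N) => x; rewrite normrM ler_pM.
Qed.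

Lemma bounded_measurableD f g : bounded_measurable f -> bounded_measurable g ->
  bounded_measurable (fun x => f x + g x).
Proof.
move=> [mf [M fM]] [mg [N gN]]; split; first exact: measurable_funD.
by exists (M + N) => x; rewrite (le_trans (ler_normD _ _))// lerD.
Qed.

Lemma bounded_measurableB f g : bounded_measurable f -> bounded_measurable g ->
  bounded_measurable (fun x => f x - g x).
Proof.
move=> [mf [M fM]] [mg [N gN]]; split; first exact: measurable_funB.
by exists (M + N) => x; rewrite (le_trans (ler_normB _ _))// lerD.
Qed.

Lemma bounded_measurableZ r f : bounded_measurable f ->
  bounded_measurable (fun x => r * f x).
Proof. exact: (bounded_measurableM (bounded_measurable_cst r)). Qed.

Lemma bounded_measurable_norm f : bounded_measurable f ->
  bounded_measurable (fun x => `|f x|).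
Proof.
move=> [mf [M fM]]; split; first exact: measurableT_comp.
by exists M => x; rewrite normr_id.
Qed.

Lemma bounded_measurable_sum (I : Type) (s : seq I) (F : I -> T -> R) :
  (forall i, bounded_measurable (F i)) ->
  bounded_measurable (fun x => \sum_(i <- s) F i x).
Proof.
move=> mF; elim: s => [|i s IH].
  by under eq_fun do rewrite big_nil; exact: bounded_measurable_cst.
by under eq_fun do rewrite big_cons; exact: bounded_measurableD.
Qed.

Lemma bounded_measurable_prod (I : eqType) (s : seq I) (F : I -> T -> R) :
  (forall i, i \in s -> bounded_measurable (F i)) ->
  bounded_measurable (fun x => \prod_(i <- s) F i x).
Proof.
elim: s => [|i s IH] mF.
  by under eq_fun do rewrite big_nil; exact: bounded_measurable_cst.
under eq_fun do rewrite big_cons; apply: bounded_measurableM.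
  by apply: mF; rewrite mem_head.
by apply: IH => j js; apply: mF; rewrite inE js orbT.
Qed.

Lemma bounded_measurable_indic A : measurable A -> bounded_measurable \1_A.
Proof.
move=> mA; split; first exact: measurable_indic.
by exists 1 => x; rewrite indicE; case: (_ \in _); rewrite ?normr0 ?normr1.
Qed.

Lemma bounded_measurable_cos f : measurable_fun setT f ->
  bounded_measurable (fun x => cos (f x)).
Proof.
move=> mf; split; last by exists 1 => x; exact: cos_max.
apply: measurableT_comp mf.
exact: (continuous_measurable_fun (@continuous_cos R)).
Qed.

Lemma bounded_measurable_sin f : measurable_fun setT f ->
  bounded_measurable (fun x => sin (f x)).
Proof.
move=> mf; split; last by exists 1 => x; exact: sin_max.
apply: measurableT_comp mf.
exact: (continuous_measurable_fun (@continuous_sin R)).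
Qed.

Lemma Rintegral_probability_cst r : \int[P]_x (cst r x) = r.
Proof. by rewrite Rintegral_cst//= probability_setT mulr1. Qed.

Lemma Rintegral_indic A : measurable A -> \int[P]_x (\1_A x) = fine (P A).
Proof. by move=> mA; rewrite /Rintegral integral_indic// setIT. Qed.

Lemma le_bounded_Rintegral f g : bounded_measurable f -> bounded_measurable g ->
  (forall x, f x <= g x) -> \int[P]_x (f x) <= \int[P]_x (g x).
Proof.
by move=> bf bg fg; apply: le_Rintegral => //;
  exact: bounded_measurable_integrable.
Qed.

Lemma bounded_RintegralD f g : bounded_measurable f -> bounded_measurable g ->
  \int[P]_x (f x + g x) = \int[P]_x (f x) + \int[P]_x (g x).
Proof.
by move=> bf bg; apply: RintegralD => //; exact: bounded_measurable_integrable.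
Qed.

Lemma bounded_RintegralB f g : bounded_measurable f -> bounded_measurable g ->
  \int[P]_x (f x - g x) = \int[P]_x (f x) - \int[P]_x (g x).
Proof.
by move=> bf bg; apply: RintegralB => //; exact: bounded_measurable_integrable.
Qed.

Lemma bounded_RintegralZ r f : bounded_measurable f ->
  \int[P]_x (r * f x) = r * \int[P]_x (f x).
Proof.
by move=> bf; apply: RintegralZl => //; exact: bounded_measurable_integrable.
Qed.

Lemma bounded_Rintegral_sum (I : Type) (s : seq I) (F : I -> T -> R) :
  (forall i, bounded_measurable (F i)) ->
  \int[P]_x (\sum_(i <- s) F i x) = \sum_(i <- s) \int[P]_x (F i x).
Proof.
move=> mF; elim: s => [|i s IH].
  by under eq_Rintegral do rewrite big_nil; rewrite big_nil Rintegral_probability_cst.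
under eq_Rintegral do rewrite big_cons.
by rewrite bounded_RintegralD ?IH ?big_cons//; exact: bounded_measurable_sum.
Qed.

Lemma ler_bounded_dist_Rintegral f g :
  bounded_measurable f -> bounded_measurable g ->
  `|\int[P]_x (f x) - \int[P]_x (g x)| <= \int[P]_x `|f x - g x|.
Proof.
move=> bf bg; rewrite -bounded_RintegralB//; apply: le_normr_Rintegral => //.
exact/bounded_measurable_integrable/bounded_measurableB.
Qed.

Lemma ler_dist_Rintegral_cst f g e :
  bounded_measurable f -> bounded_measurable g ->
  (forall x, `|f x - g x| <= e) ->
  `|\int[P]_x (f x) - \int[P]_x (g x)| <= e.
Proof.
move=> bf bg fge; rewrite (le_trans (ler_bounded_dist_Rintegral bf bg))//.
rewrite -[leRHS]Rintegral_probability_cst; apply: le_bounded_Rintegral => //.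
  exact/bounded_measurable_norm/bounded_measurableB.
exact: bounded_measurable_cst.
Qed.

Lemma normr_Rintegral_le f M : bounded_measurable f ->
  (forall x, `|f x| <= M) -> `|\int[P]_x (f x)| <= M.
Proof.
move=> bf fM; have := @ler_dist_Rintegral_cst f (cst 0) M bf.
rewrite Rintegral_probability_cst subr0; apply; first exact: bounded_measurable_cst.
by move=> x; rewrite subr0.
Qed.

Lemma EFin_bounded_Rintegral f : bounded_measurable f ->
  (\int[P]_x (f x)%:E)%E = (\int[P]_x (f x))%:E.
Proof.
move=> bf; rewrite /Rintegral fineK//.
by apply: integrable_fin_num => //; exact: bounded_measurable_integrable.
Qed.

End bounded_expectation.

(** * Uniform approximation by indicators of superlevel sets *)

Section layer_cake.
Context {R : realType}.

(** The sum counts the integers from 1 to n that are at most x; since x <= n, this is the integer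
    part of x. *)
Lemma layer_cake_nat n (x : R) : 0 <= x <= n%:R ->
  x - 1 <= \sum_(k < n) (k.+1%:R <= x)%R%:R <= x.
Proof.
elim: n x => [|n IH] x /andP[x0 xn].
  by rewrite big_ord0 x0 andbT subr_le0 (le_trans xn)// ler01.
rewrite big_ord_recr/=; have [nx|xn1] := leP n.+1%:R x.
  rewrite (eq_bigr (fun=> 1)) => [|k _]; last first.
    by rewrite (le_trans _ nx)// ler_nat ltnS ltnW.
  rewrite sumr_const card_ord; have -> : x = n.+1%:R.
    by apply/le_anti; rewrite nx xn.
  by rewrite -natr1 lexx andbT gerBl ler01.
rewrite addr0; have [xn'|nx] := leP x n%:R; first by apply: IH; rewrite x0 xn'.
rewrite (eq_bigr (fun=> 1)) => [|k _]; last first.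
  by rewrite (le_trans _ (ltW nx))// ler_nat.
rewrite sumr_const card_ord (ltW nx) andbT lerBlDr natr1; exact: ltW.
Qed.

(** The affine map taking [-M, M] onto [0, n] reduces this to the integer part. A bounded function
    is thus within 2 M / n of a combination of n superlevel indicators, which is how statements
    about events pass to bounded functions. *)
Lemma layer_cake n (M x : R) : (0 < n)%N -> 0 < M -> `|x| <= M ->
  `|x - (- M + 2 * M / n%:R *
     \sum_(k < n) (- M + 2 * M / n%:R * k.+1%:R <= x)%R%:R)| <= 2 * M / n%:R.
Proof.
move=> n0 M0 xM; set c := 2 * M / n%:R.
have n0' : 0 < n%:R :> R by rewrite ltr0n.
have c0 : 0 < c by rewrite divr_gt0// mulr_gt0.
have cn : c * n%:R = 2 * M by rewrite divfK// gt_eqF.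
pose y := (x + M) / c.
have y0n : 0 <= y <= n%:R.
  move: xM; rewrite ler_norml => /andP[Mx xM].
  rewrite divr_ge0 ?(ltW c0)//=; last lra.
  rewrite ler_pdivrMr// mulrC cn; lra.
have /andP[] := layer_cake_nat y0n.
rewrite (eq_bigr (fun k : 'I_n => (- M + c * k.+1%:R <= x)%R%:R : R)); last first.
  move=> k _; congr (nat_of_bool _)%:R.
  by rewrite /y ler_pdivlMr// mulrC [in RHS]addrC lerBlDr.
set S := \sum_(k < n) _ => h1 h2.
have -> : x = y * c - M by rewrite /y divfK ?addrK// gt_eqF.
have -> : y * c - M - (- M + c * S) = c * (y - S) by ring.
rewrite normrM (gtr0_norm c0) -[leRHS]mulr1 ler_pM2l// ger0_norm; lra.
Qed.

End layer_cake.

Section product_rule.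
Context d (T : measurableType d) (R : realType) (P : probability T R).

(** Replacing [u] by its layer-cake step function [v] makes the identity linear in superlevel
    indicators. [Y] stays untouched, so a long product can be treated one factor at a time. *)
Lemma expectation_mul_of_level (u Y : T -> R) :
  bounded_measurable u -> bounded_measurable Y ->
  (forall r, \int[P]_x (\1_[set w | r <= u w] x * Y x) =
             fine (P [set w | r <= u w]) * \int[P]_x (Y x)) ->
  \int[P]_x (u x * Y x) = \int[P]_x (u x) * \int[P]_x (Y x).
Proof.
move=> bu bY uY; have [mu [M0 uM0]] := bu; have [_ [N0 YN0]] := bY.
pose M : R := `|M0| + 1; pose N : R := `|N0| + 1.
have Mgt0 : 0 < M by rewrite ltr_wpDl.
have Ngt0 : 0 < N by rewrite ltr_wpDl.
have uM x : `|u x| <= M.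
  by rewrite (le_trans (uM0 x))// (le_trans (ler_norm _))// lerDl.
have YN x : `|Y x| <= N.
  by rewrite (le_trans (YN0 x))// (le_trans (ler_norm _))// lerDl.
suff H (e : R) : 0 < e ->
    `|\int[P]_x (u x * Y x) - \int[P]_x (u x) * \int[P]_x (Y x)| <= e.
  apply/eqP; rewrite -subr_eq0 -normr_le0; apply/ler_addgt0Pr => e e0.
  by rewrite add0r H.
move=> e0.
(* Two errors of size c N occur, one from u Y - v Y and one from the difference of the means of [u]
   and [v] times the mean of [Y]; [n] makes their sum at most e. *)
pose n := (Num.truncn (2 * M * N * 2 / e)).+1.
pose c : R := 2 * M / n%:R.
have cN : c * N * 2 <= e.
  have : 2 * M * N * 2 / e <= n%:R by exact/ltW/Num.Theory.truncnS_gt.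
  rewrite ler_pdivrMr// => h.
  rewrite (_ : c * N * 2 = 2 * M * N * 2 / n%:R); last by rewrite /c; ring.
  by rewrite ler_pdivrMr ?ltr0n// [leRHS]mulrC.
pose L r := [set w | r <= u w].
have mL r : measurable (L r).
  rewrite /L (_ : [set w | _] = u @^-1` `[r, +oo[); first by rewrite -[X in measurable X]setTI; exact: mu.
  by apply/seteqP; split => w /=; rewrite in_itv/= andbT.
pose v x : R := - M + c * \sum_(k < n) \1_(L (- M + c * k.+1%:R)) x.
have bS : bounded_measurable (fun x => \sum_(k < n) \1_(L (- M + c * k.+1%:R)) x : R).
  by apply: bounded_measurable_sum => k; exact: bounded_measurable_indic.
have bv : bounded_measurable v.
  apply: bounded_measurableD; first exact: bounded_measurable_cst.
  exact: bounded_measurableZ.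
have uv x : `|u x - v x| <= c.
  have := @layer_cake _ n M (u x) isT Mgt0 (uM x).
  rewrite -/c /v; under [in X in _ -> X]eq_bigr do rewrite indicE.
  rewrite (_ : \sum_(k < n) _ = \sum_(k < n) (u x \in [set y : R | - M + c * k.+1%:R <= y])%:R :> R); last first.
    by apply: eq_bigr => k _; congr (nat_of_bool _)%:R; apply/idP/idP; rewrite !inE.
  by rewrite (eq_bigr (fun k : 'I_n => (- M + c * k.+1%:R <= u x)%R%:R : R)) => [//|k _];
    congr (nat_of_bool _)%:R; apply/idP/idP; rewrite inE.
have vY : \int[P]_x (v x * Y x) = \int[P]_x (v x) * \int[P]_x (Y x).
  have -> : (fun x => v x * Y x) = (fun x => - M * Y x +
      c * \sum_(k < n) (\1_(L (- M + c * k.+1%:R)) x * Y x)).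
    by apply/funext => x; rewrite /v mulrDl -mulrA mulr_suml.
  have b1 (k : 'I_n) : bounded_measurable (fun x => \1_(L (- M + c * k.+1%:R)) x * Y x).
    by apply: bounded_measurableM => //; exact: bounded_measurable_indic.
  have b2 := @bounded_measurable_sum _ _ _ _ (index_enum 'I_n) _ b1.
  rewrite bounded_RintegralD; [|exact: bounded_measurableZ..].
  rewrite !bounded_RintegralZ// bounded_Rintegral_sum//.
  rewrite /v bounded_RintegralD; [|exact: bounded_measurable_cst|exact: bounded_measurableZ].
  rewrite Rintegral_probability_cst bounded_RintegralZ//.
  rewrite bounded_Rintegral_sum; last by move=> k; exact: bounded_measurable_indic.
  rewrite mulrDl -(mulrA c) mulr_suml; congr (_ + c * _).
  by apply: eq_bigr => k _; rewrite uY Rintegral_indic.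
have := @ler_dist_Rintegral_cst _ _ _ P (fun x => u x * Y x) (fun x => v x * Y x) (c * N).
move=> /(_ (bounded_measurableM bu bY) (bounded_measurableM bv bY)).
have h x : `|u x * Y x - v x * Y x| <= c * N.
  by rewrite -mulrBl normrM ler_pM.
move=> /(_ h); rewrite vY => h1.
have := ler_dist_Rintegral_cst P bv bu (fun x => ltac:(rewrite distrC; exact: uv)).
move=> h2.
have h3 : `|\int[P]_x (Y x)| <= N by exact: normr_Rintegral_le.
have h4 : `|(\int[P]_x (v x) - \int[P]_x (u x)) * \int[P]_x (Y x)| <= c * N.
  by rewrite normrM ler_pM.
rewrite (le_trans _ cN)// mulr_natr mulr2n.
rewrite (_ : _ - _ = (\int[P]_x (u x * Y x) - \int[P]_x (v x) * \int[P]_x (Y x)) +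
  (\int[P]_x (v x) - \int[P]_x (u x)) * \int[P]_x (Y x)); last by ring.
by rewrite (le_trans (ler_normD _ _))// lerD.
Qed.

Lemma mutually_independent_expectation_prod (I : eqType)
    (G : I -> set (set T)) (u : I -> T -> R) (s : seq I) :
  mutually_independent P G -> (forall i A, G i A -> measurable A) ->
  uniq s ->
  (forall i, i \in s -> bounded_measurable (u i)) ->
  (forall i, i \in s -> forall r, G i [set w | r <= u i w]) ->
  \int[P]_x (\prod_(i <- s) u i x) = \prod_(i <- s) \int[P]_x (u i x).
Proof.
move=> indG mG us bu Gu.
(* Mixed products: functions on [s], events on [s2]. With [s] empty this is the definition of
   independence; the induction moves one index of [s] from the functions to the events. *)
suff H (s2 : seq I) (E : I -> set T) : uniq (s ++ s2) ->
    (forall i, i \in s2 -> G i (E i)) ->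
    \int[P]_x (\prod_(i <- s) u i x * \prod_(i <- s2) \1_(E i) x) =
    \prod_(i <- s) \int[P]_x (u i x) * \prod_(i <- s2) fine (P (E i)).
  have := H [::] (fun=> set0); rewrite cats0 big_nil mulr1 => <-//.
  by under [in RHS]eq_Rintegral do rewrite big_nil mulr1.
elim: s us bu Gu s2 E => [|i s IH] us bu Gu s2 E.
  rewrite /= big_nil mul1r => us2 GE.
  under eq_Rintegral do rewrite big_nil mul1r.
  have -> : (fun x => \prod_(i <- s2) \1_(E i) x) =
      (\1_(\bigcap_(i in [set` s2]) E i) : T -> R).
    apply/funext => x; rewrite indicE.
    rewrite (_ : x \in _ = all (fun i => x \in E i) s2); last first.
      apply/idP/allP => [/set_mem xE i /= /xE/mem_set//|xE].
      by apply/mem_set => i /= /xE /set_mem.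
    elim: s2 {us2 GE} => [|j s2 IHs]; first by rewrite !big_nil.
    by rewrite !big_cons IHs /= indicE; case: (x \in E j); rewrite ?mul1r ?mul0r.
  rewrite Rintegral_indic.
    rewrite indG// [in LHS]big_seq [RHS]big_seq.
    rewrite (eq_bigr (fun i => (fine (P (E i)))%:E)) ?prodEFin// => i is2.
    by rewrite fineK// fin_num_measure//; exact/mG/GE.
  elim: s2 {us2} GE => [_|j s2 IHs GE].
    by rewrite (_ : \bigcap_(i in _) _ = setT)//; apply/seteqP; split.
  rewrite (_ : \bigcap_(i in _) _ = E j `&` \bigcap_(i in [set` s2]) E i).
    apply: measurableI; first by apply/mG/GE; rewrite mem_head.
    by apply: IHs => i is2; apply: GE; rewrite inE is2 orbT.
  apply/seteqP; split => [x xE|x [xj xE] i /=].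
    split; first by apply: xE => /=; rewrite mem_head.
    by move=> i /= is2; apply: xE => /=; rewrite inE is2 orbT.
  by rewrite inE => /orP[/eqP ->//|/xE].
rewrite /= => /andP[iss2 uss2] GE.
have is2 : i \notin s2 by move: iss2; rewrite mem_cat negb_or => /andP[].
have bu' j : j \in s -> bounded_measurable (u j).
  by move=> js; apply: bu; rewrite inE js orbT.
have Gu' j : j \in s -> forall r, G j [set w | r <= u j w].
  by move=> js; apply: Gu; rewrite inE js orbT.
have us' : uniq s by move: us => /andP[].
have bI j : j \in s2 -> bounded_measurable (\1_(E j) : T -> R).
  by move=> js2; apply/bounded_measurable_indic/mG/GE.
pose Y x := \prod_(j <- s) u j x * \prod_(j <- s2) \1_(E j) x.
have bY : bounded_measurable Y.
  by apply: bounded_measurableM; exact: bounded_measurable_prod.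
transitivity (\int[P]_x (u i x * Y x)).
  by apply: eq_Rintegral => x _; rewrite big_cons mulrA.
rewrite expectation_mul_of_level//.
- by rewrite big_cons -mulrA /Y IH.
- by apply: bu; rewrite mem_head.
(* The superlevel set of [u i] becomes the event of index [i], a free slot because [i] is not in
   [s2]; the induction hypothesis then applies to [i :: s2]. *)
- move=> r; pose E' j := if j == i then [set w | r <= u i w] else E j.
  have EE' (F : set T -> R) : \prod_(j <- s2) F (E' j) = \prod_(j <- s2) F (E j).
    rewrite [LHS]big_seq [RHS]big_seq; apply: eq_bigr => j js2; rewrite /E'.
    by case: eqP js2 => // -> ; rewrite (negbTE is2).
  have := IH us' bu' Gu' (i :: s2) E'.
  have -> : uniq (s ++ i :: s2).
    rewrite cat_uniq /= is2; move: uss2; rewrite cat_uniq => /and3P[-> s2s ->].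
    rewrite !andbT /= negb_or s2s andbT.
    by move: iss2; rewrite mem_cat negb_or => /andP[].
  have GE' j : j \in i :: s2 -> G j (E' j).
    rewrite inE /E'; case: eqP => [-> _|_ /= js2]; last exact: GE.
    by apply: Gu; rewrite mem_head.
  have E'i : E' i = [set w | r <= u i w] by rewrite /E' eqxx.
  move=> /(_ isT GE'); rewrite big_cons E'i.
  rewrite (EE' (fun A => fine (P A))) mulrCA.
  rewrite -(IH us' bu' Gu' s2 E uss2 GE) => <-.
  apply: eq_Rintegral => x _; rewrite big_cons (EE' (fun A => \1_A x)).
  by rewrite E'i mulrCA.
Qed.

End product_rule.

(** * Weak convergence from characteristic functions *)

Section trigonometric_approximation.
Context {R : realType} {m : nat}.
Notation V := ('rV[R]_m).
Implicit Types (f g : V -> R) (x y : V).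

Definition dot (t : 'I_m -> R) x := \sum_(i < m) t i * x ord0 i.

Lemma measurable_dot t : measurable_fun setT (dot t).
Proof.
apply: measurable_sum => i; apply: measurable_funM => //.
exact: measurable_coord.
Qed.

(** With an arbitrary phase [a], sines are included and the product formula for cosines keeps the
    class closed under multiplication. An inductive predicate lets convergence of integrals be
    proved by induction from the single cosines. *)
Inductive trig_poly : (V -> R) -> Prop :=
| trig_cos a t : trig_poly (fun x => cos (a + dot t x))
| trig_add f g : trig_poly f -> trig_poly g -> trig_poly (fun x => f x + g x)
| trig_scale r f : trig_poly f -> trig_poly (fun x => r * f x).

Lemma trig_cst r : trig_poly (cst r).
Proof.
rewrite (_ : cst r = fun x => r * cos (0 + dot (fun=> 0) x)).
  exact/trig_scale/trig_cos.
apply/funext => x; rewrite /dot big1 ?addr0 ?cos0 ?mulr1// => i _.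
by rewrite mul0r.
Qed.

Lemma trig_mul f g : trig_poly f -> trig_poly g -> trig_poly (fun x => f x * g x).
Proof.
move=> tf tg; elim: tf => [a t|f1 f2 _ h1 _ h2|r f1 _ h1].
- elim: tg => [b s|g1 g2 _ h1 _ h2|r g1 _ h1].
  + rewrite (_ : (fun _ => _) = fun x =>
        2^-1 * cos ((a + b) + dot (fun i => t i + s i) x) +
        2^-1 * cos ((a - b) + dot (fun i => t i - s i) x)).
      by apply: trig_add; apply: trig_scale; exact: trig_cos.
    apply/funext => x.
    have -> : a + b + dot (fun i => t i + s i) x = (a + dot t x) + (b + dot s x).
      rewrite addrACA; congr (_ + _); rewrite /dot -big_split; apply: eq_bigr => i _.
      by rewrite mulrDl.
    have -> : a - b + dot (fun i => t i - s i) x = (a + dot t x) - (b + dot s x).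
      rewrite opprD addrACA; congr (_ + _); rewrite /dot -sumrB.
      by apply: eq_bigr => i _; rewrite mulrBl.
    by move: (a + dot t x) (b + dot s x) => A B; rewrite cosD cosB; field.
  + by under eq_fun do rewrite mulrDr; exact: trig_add.
  + by under eq_fun do rewrite mulrCA; exact: trig_scale.
- by under eq_fun do rewrite mulrDl; exact: trig_add.
- by under eq_fun do rewrite -mulrA; exact: trig_scale.
Qed.

Lemma trig_bounded_measurable f : trig_poly f -> bounded_measurable f.
Proof.
elim => [a t|f1 g1 _ ? _ ?|r f1 _ ?].
- apply: bounded_measurable_cos; apply: measurable_funD => //.
  exact: measurable_dot.
- exact: bounded_measurableD.
- exact: bounded_measurableZ.
Qed.

(** The uniform closure over the whole space, not over compact sets: the error is then the same
    under every probability. These are almost periodic functions, closed under products and, by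
    [trig_closure_norm], absolute values, hence a lattice. *)
Definition trig_closure f :=
  forall e : R, 0 < e -> exists2 g, trig_poly g & forall x, `|f x - g x| <= e.

Lemma trig_closure_trig f : trig_poly f -> trig_closure f.
Proof. by move=> tf e e0; exists f => // x; rewrite subrr normr0 ltW. Qed.

Lemma trig_closure_bounded_measurable f : trig_closure f -> bounded_measurable f.
Proof.
move=> tf; split; last first.
  have [g tg fg] := tf _ ltr01; have [_ [M gM]] := trig_bounded_measurable tg.
  exists (1 + M) => x; rewrite -[f x](subrK (g x)).
  by rewrite (le_trans (ler_normD _ _))// lerD.
have tf' (n : nat) : exists g, trig_poly g /\ forall x, `|f x - g x| <= n.+1%:R^-1.
  by have [|g tg fg] := tf n.+1%:R^-1; [rewrite invr_gt0|exists g].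
have [h hP] := choice tf'.
apply: (@measurable_fun_cvg _ _ _ _ h) => [n|x _].
  by have [] := trig_bounded_measurable (hP n).1.
apply/cvgrPdist_le => e e0; near=> n.
apply: (le_trans ((hP n).2 x)); rewrite ltW//.
near: n; exact: near_infty_natSinv_lt (PosNum e0).
Unshelve. all: by end_near. Qed.

Lemma trig_closureD f g : trig_closure f -> trig_closure g ->
  trig_closure (fun x => f x + g x).
Proof.
move=> tf tg e e0; have e2 : 0 < e / 2 by rewrite divr_gt0.
have [f' tf' ff'] := tf _ e2; have [g' tg' gg'] := tg _ e2.
exists (fun x => f' x + g' x); first exact: trig_add.
move=> x; rewrite opprD addrACA (le_trans (ler_normD _ _))// [leRHS]splitr.
exact: lerD.
Qed.

Lemma trig_closureM f g : trig_closure f -> trig_closure g ->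
  trig_closure (fun x => f x * g x).
Proof.
move=> tf tg e e0.
have [_ [M0 fM]] := trig_closure_bounded_measurable tf.
have [_ [N0 gN]] := trig_closure_bounded_measurable tg.
pose M : R := `|M0| + 1; pose N : R := `|N0| + 2.
have M0' : 0 < M by rewrite ltr_wpDl.
have N0' : 0 < N by rewrite ltr_wpDl.
pose d := Num.min 1 (e / (M + N)).
have d0 : 0 < d by rewrite lt_min ltr01 divr_gt0// (addr_gt0 M0' N0').
have [f' tf' ff'] := tf _ d0; have [g' tg' gg'] := tg _ d0.
exists (fun x => f' x * g' x); first exact: trig_mul.
move=> x; have -> : f x * g x - f' x * g' x = f x * (g x - g' x) + (f x - f' x) * g' x.
  by ring.
have g'N : `|g' x| <= N.
  rewrite -[g' x](subrK (g x)) (le_trans (ler_normD _ _))// addrC lerD//.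
    by rewrite (le_trans (gN x))// ler_norm.
  by rewrite distrC (le_trans (gg' x))// /d ge_min ler1n.
have fM' : `|f x| <= M.
  by rewrite (le_trans (fM x))// (le_trans (ler_norm _))// lerDl.
rewrite (le_trans (ler_normD _ _))// !normrM.
apply: (@le_trans _ _ (M * d + d * N)); first by rewrite lerD// ler_pM.
rewrite (mulrC M) -mulrDr -ler_pdivlMr ?(addr_gt0 M0' N0')// /d.
by rewrite ge_min lexx orbT.
Qed.

Lemma trig_closure_cst r : trig_closure (cst r).
Proof. exact/trig_closure_trig/trig_cst. Qed.

Lemma trig_closureZ r f : trig_closure f -> trig_closure (fun x => r * f x).
Proof. exact: (trig_closureM (trig_closure_cst r)). Qed.

(** The iteration p -> p + (u^2 - p^2) / 2 of the Stone-Weierstrass theorem: polynomials in u that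
    increase to |u| on [-1, 1]. *)
Fixpoint norm_poly (u : R) (k : nat) : R :=
  if k is k'.+1 then norm_poly u k' + 2^-1 * (u * u - norm_poly u k' * norm_poly u k')
  else 0.

(** Each step multiplies the error e = |u| - p by 1 - (|u| + p) / 2, which is at most 1 - e / 2
    since p >= 0; this recursion forces e <= 2 / (k + 2), uniformly in u. *)
Lemma norm_poly_bound (u : R) k : `|u| <= 1 ->
  [/\ 0 <= norm_poly u k, norm_poly u k <= `|u| &
      (`|u| - norm_poly u k) * k.+2%:R <= 2].
Proof.
move=> u1; have u0 := normr_ge0 u.
elim: k => [|k [p0 pu IH]] /=; first by rewrite subr0 lexx; split => //; lra.
have -> : u * u = `|u| * `|u| by rewrite -normrM ger0_norm// -expr2 sqr_ge0.
move: p0 pu IH u1 u0; move: (norm_poly u k) => p; move: `|u| => a.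
have -> : k.+3%:R = k.+2%:R + 1 :> R by rewrite natr1.
have : 2 <= k.+2%:R :> R by rewrite ler_nat.
move: (k.+2%:R : R) => s s2 p0 pa IH a1 a0.
have ap : 0 <= (a - p) * (a + p) by apply: mulr_ge0; lra.
split; [nra|nra|].
have e0 : 0 <= a - p by lra.
have -> : a - (p + 2^-1 * (a * a - p * p)) = (a - p) * (1 - (a + p) / 2) by field.
have : (a - p) * (1 - (a + p) / 2) <= (a - p) * (1 - (a - p) / 2) by nra.
move/(ler_wpM2r (_ : 0 <= s + 1)) => h; apply: (le_trans (h _)); first lra.
set e := a - p in e0 IH *.
have e1 : e <= 1 by rewrite /e; lra.
nra.
Qed.

Lemma trig_closure_norm f : trig_closure f -> trig_closure (fun x => `|f x|).
Proof.
move=> tf; have [_ [M0 fM0]] := trig_closure_bounded_measurable tf.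
pose M : R := `|M0| + 1; have M0' : 0 < M by rewrite ltr_wpDl.
have fM x : `|f x| <= M.
  by rewrite (le_trans (fM0 x))// (le_trans (ler_norm _))// lerDl.
pose u x := M^-1 * f x.
have u1 x : `|u x| <= 1.
  by rewrite normrM normfV (gtr0_norm M0') mulrC ler_pdivrMr// mul1r.
have tu k : trig_closure (fun x => norm_poly (u x) k).
  elim: k => [|k IH] /=; first exact: trig_closure_cst.
  apply: trig_closureD => //; apply: trig_closureZ.
  under eq_fun do rewrite -mulN1r.
  apply: trig_closureD; first by apply: trig_closureM; exact: trig_closureZ.
  by apply: trig_closureZ; exact: trig_closureM.
(* Half of e pays for the iteration, whose error is at most 2 M / (k + 2), the other half for
   approximating the polynomial in [f]. *)
move=> e e0; pose k := Num.truncn (4 * M / e).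
have [g tg ug] := trig_closureZ M (tu k) (divr_gt0 e0 (ltr0Sn _ 1)).
exists g => // x; rewrite -[`|f x|](subrK (M * norm_poly (u x) k)) -addrA.
rewrite (le_trans (ler_normD _ _))// [leRHS]splitr lerD//.
have [p0 pu pk] := norm_poly_bound k (u1 x).
have -> : `|f x| = M * `|u x|.
  by rewrite normrM normfV (gtr0_norm M0') mulrA divff ?gt_eqF// mul1r.
rewrite -mulrBr normrM (gtr0_norm M0') ger0_norm ?subr_ge0//.
have : 4 * M / e <= k.+2%:R.
  by rewrite ltW// (lt_trans (truncnS_gt _))// ltr_nat.
rewrite ler_pdivrMr// => h.
rewrite ler_pdivlMr// -(ler_pM2r (_ : 0 < k.+2%:R))//.
rewrite mulrC in h *; move: pk h; set s := k.+2%:R; set a := _ - _; nra.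
Qed.

Lemma trig_closure_max f g : trig_closure f -> trig_closure g ->
  trig_closure (fun x => Num.max (f x) (g x)).
Proof.
move=> tf tg; rewrite (_ : (fun _ => _) =
    fun x => 2^-1 * ((f x + g x) + `|f x + (-1) * g x|)); last first.
  by apply/funext => x; rewrite maxr_absE mulN1r mulrC.
apply: trig_closureZ; apply: trig_closureD; first exact: trig_closureD.
by apply: trig_closure_norm; apply: trig_closureD => //; exact: trig_closureZ.
Qed.

Definition cube (K : R) : set V := [set x | forall i, `|x ord0 i| <= K].

Lemma measurable_cube K : measurable (cube K).
Proof.
rewrite (_ : cube K = \big[setI/setT]_(i < m)
    ((fun x : V => x ord0 i) @^-1` `[- K, K])).
  apply: bigsetI_measurable => i _; rewrite -[X in measurable X]setTI.
  exact: measurable_coord.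
apply/seteqP; split => [x xK|x].
  rewrite -bigcap_seq => i _ /=; rewrite in_itv/= -ler_norml; exact: xK.
rewrite -bigcap_seq => xK i; have := xK i; rewrite /= in_itv/= -ler_norml.
by apply; rewrite mem_index_enum.
Qed.

Lemma compact_cube K : compact (cube K).
Proof.
rewrite (_ : cube K = [set v : V | forall i, (`[- K, K]%classic : set R) (v ord0 i)]).
  exact: (@rV_compact _ _ (fun=> `[- K, K]%classic) (fun=> @segment_compact R (- K) K)).
by apply/seteqP; split => x xK i; have := xK i; rewrite /= in_itv/= ler_norml.
Qed.

Section peak.
Variable K : R.
Hypothesis K0 : 0 < K.

(* [peak y] vanishes on the cube only at [y], because [|x i - y i| / K] stays
   below [2 < 2 * pi] there. *)
Definition peak y x : R := \sum_(i < m) (1 - cos ((x ord0 i - y ord0 i) / K)).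

Lemma peak_ge0 y x : 0 <= peak y x.
Proof. by apply: sumr_ge0 => i _; rewrite subr_ge0 cos_le1. Qed.

Lemma peakxx y : peak y y = 0.
Proof. by apply: big1 => i _; rewrite subrr mul0r cos0 subrr. Qed.

Lemma trig_closure_peak y : trig_closure (peak y).
Proof.
rewrite /peak; elim: (index_enum 'I_m) => [|i s IH].
  by under eq_fun do rewrite big_nil; exact: trig_closure_cst.
under eq_fun do rewrite big_cons -mulN1r; apply: trig_closureD => //.
apply: trig_closureD; first exact: trig_closure_cst.
apply: trig_closureZ; apply: trig_closure_trig.
rewrite (_ : (fun _ => _) = fun x => cos (- (y ord0 i / K) +
    dot (fun j => (j == i)%:R / K) x)); first exact: trig_cos.
apply/funext => x; congr cos; rewrite mulrBl addrC; congr (_ + _).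
rewrite /dot (bigD1 i)//= eqxx mul1r mulrC big1 ?addr0// => j /negbTE ->.
by rewrite !mul0r.
Qed.

Lemma continuous_peak y : continuous (peak y).
Proof.
suff H s (x : V) : \sum_(i <- s) (1 - cos ((x' ord0 i - y ord0 i) / K)) @[x' --> x]
    --> \sum_(i <- s) (1 - cos ((x ord0 i - y ord0 i) / K)).
  by move=> x; exact: H.
elim: s => [|i s IH].
  by under eq_fun do rewrite big_nil; rewrite big_nil; exact: cvg_cst.
under eq_fun do rewrite big_cons; rewrite big_cons.
apply: cvgD IH; apply: cvgB; first exact: cvg_cst.
apply: continuous_cvg; first exact: continuous_cos.
apply: cvgM; last exact: cvg_cst.
by apply: cvgB; [exact: coord_continuous|exact: cvg_cst].
Qed.

(** One coordinate is enough, all summands being nonnegative. On the cube the ratio |x i - y i| / K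
    is at most 2 <= pi, where the cosine is still decreasing. *)
Lemma peak_sep y (d : R) : 0 < d -> d <= K -> cube K y ->
  exists2 c, 0 < c & forall x, cube K x ->
    (exists i, d <= `|x ord0 i - y ord0 i|) -> c <= peak y x.
Proof.
move=> d0 dK yK; exists (1 - cos (d / K)).
  rewrite subr_gt0 -[ltRHS]cos0 ltr_cos ?divr_gt0// in_itv/= ?lexx ?pi_ge0//.
  apply/andP; split; first exact/divr_ge0/ltW/K0/ltW.
  apply: (le_trans _ (pi_ge2 _)); rewrite ler_pdivrMr//.
  by rewrite (le_trans dK)// ler_peMl ?ltW// ltr1n.
move=> x xK [i di]; rewrite /peak (bigD1 i)//= ler_wpDr//.
  by apply: sumr_ge0 => j _; rewrite subr_ge0 cos_le1.
rewrite lerD2l lerN2 -[X in cos X <= _]/(_ / _) -cos_norm normrM normfV (gtr0_norm K0).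
have xy2 : `|x ord0 i - y ord0 i| / K <= 2.
  rewrite ler_pdivrMr// (le_trans (ler_normB _ _))//.
  by rewrite mulr_natl mulr2n lerD.
have dK2 : d / K <= `|x ord0 i - y ord0 i| / K by rewrite ler_pM2r ?invr_gt0.
rewrite leNgt ltr_cos ?in_itv/=.
- by rewrite -leNgt.
- by rewrite (divr_ge0 (normr_ge0 _) (ltW K0)) (le_trans xy2)// pi_ge2.
- by rewrite (divr_ge0 (ltW d0) (ltW K0)) (le_trans dK2)// (le_trans xy2)// pi_ge2.
Qed.

End peak.

(** The lattice form of Stone-Weierstrass, with minorants only: near y the function f y - e / 2 - C
    * peak K y stays below f, elsewhere on the cube the peak pushes it below f, and by compactness
    the maximum of finitely many of these is within e of f. The bound by [M] on the whole space
    controls what happens off the cube. *)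
Lemma trig_closure_dense_cube f (M K e : R) : continuous f ->
  (forall x, `|f x| <= M) -> 0 < K -> 0 < e ->
  exists g, [/\ trig_closure g, forall x, `|g x| <= M &
                forall x, cube K x -> `|f x - g x| <= e].
Proof.
move=> cf fM K0 e0.
have H y : exists C : R, cube K y -> 0 <= C /\
    forall x, cube K x -> f y - e / 2 - C * peak K y x <= f x.
  have [yK|yK] := pselect (cube K y); last by exists 0.
  have e2 : 0 < e / 2 by rewrite divr_gt0.
  have /cvgrPdist_lt/(_ _ e2)/nbhs_ballP[d /= d0 dP] := cf y.
  have dK0 : 0 < Num.min d K by rewrite lt_min d0.
  have dKK : Num.min d K <= K by rewrite ge_min lexx orbT.
  have [c c0 cP] := peak_sep K0 dK0 dKK yK.
  have M0 : 0 <= M by rewrite (le_trans _ (fM y)).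
  have C0 : 0 <= 2 * M / c by rewrite divr_ge0 ?mulr_ge0// ltW.
  (* Away from y the peak is at least c, so the minorant has dropped by 2 M, which bounds the
     oscillation of f. *)
  exists (2 * M / c) => _; split => // x xK.
  have [h|/existsNP[i /negP]] :=
      pselect (forall i, `|x ord0 i - y ord0 i| < Num.min d K); last first.
    rewrite -leNgt => di.
    have := cP x xK (ex_intro _ i di) => cx.
    have : 2 * M <= 2 * M / c * peak K y x.
      by rewrite mulrAC ler_pdivlMr// ler_wpM2l// mulr_ge0.
    move: (fM x) (fM y); rewrite !ler_norml => /andP[] + _ /andP[_].
    lra.
  have : `|f y - f x| < e / 2.
    apply: dP; rewrite -ball_normE /ball_/= -[Num.norm (y - x)]/(mx_norm (y - x)) mx_normrE; apply/bigmax_ltP; split => // -[i j] _.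
    by rewrite !mxE/= (ord1 i) distrC; have := h j; rewrite lt_min => /andP[].
  rewrite ltr_distl => /andP[h1 h2].
  have := mulr_ge0 C0 (peak_ge0 K y x); lra.
have [C CP] := choice H.
pose h y x := f y - e / 2 - C y * peak K y x.
have th y : trig_closure (h y).
  rewrite /h (_ : (fun x => _) = fun x => (f y - e / 2) + (- C y) * peak K y x).
    apply: trig_closureD; first exact: trig_closure_cst.
    by apply: trig_closureZ; exact: trig_closure_peak.
  by apply/funext => x; rewrite mulNr.
(* Since the peak vanishes at y, [h y y] is f y - e / 2, above f y - e; hence these open sets cover
   the cube. *)
have := @compact_cube K; rewrite compact_cover.
move=> /(_ V (cube K) (fun y => [set x | f x - e < h y x])) [].
- move=> y yK.
  rewrite (_ : [set x | _] = (fun x => f x - e - h y x) @^-1` [set r | r < 0]).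
    apply: open_comp; last exact: open_lt.
    suff cfh (x : V) : f x' - e - h y x' @[x' --> x] --> f x - e - h y x.
      by move=> x _; exact: cfh.
    have c1 : f x' @[x' --> x] --> f x by exact: cf.
    have c2 : peak K y x' @[x' --> x] --> peak K y x by exact: continuous_peak.
    have c3 : C y * peak K y x' @[x' --> x] --> C y * peak K y x.
      exact: (cvgM (cvg_cst _) c2).
    rewrite /h; apply: (cvgB (cvgB c1 (cvg_cst _)) (cvgB (cvg_cst _) c3)).
  by apply/seteqP; split => x /=; rewrite subr_lt0.
- by move=> y yK; exists y => //=; rewrite /h peakxx mulr0 subr0; lra.
move=> D DK KD.
(* Starting the maximum at - M bounds [g] from below on the whole space. *)
pose g (s : seq V) x := foldr (fun y r => Num.max (h y x) r) (- M) s.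
exists (g (finmap.enum_fset D)).
have DK' y : y \in finmap.enum_fset D -> cube K y by move=> /DK/set_mem.
split.
- elim: (finmap.enum_fset D) => [|y s IH] /=; first exact: trig_closure_cst.
  exact: trig_closure_max.
- move=> x; rewrite ler_norml; elim: (finmap.enum_fset D) DK' => [|y s IH] DK' /=.
    rewrite lexx/= -subr_ge0 opprK addr_ge0//; exact: le_trans (fM x).
  have /andP[g1 g2] : - M <= g s x <= M.
    by apply: IH => z zs; apply: DK'; rewrite inE zs orbT.
  rewrite le_max g1 orbT/= ge_max g2 andbT.
  have yK : cube K y by apply: DK'; rewrite mem_head.
  have := mulr_ge0 (CP y yK).1 (peak_ge0 K y x).
  have := fM y; rewrite ler_norml => /andP[_]; rewrite /h; lra.
- move=> x xK; rewrite ler_distlC; apply/andP; split.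
    have [y /= yD hy] := KD x xK; apply: (le_trans (ltW hy)).
    have : y \in finmap.enum_fset D by exact: yD.
    elim: (finmap.enum_fset D) => //= z s IH; rewrite inE => /orP[/eqP <-|/IH zs].
      by rewrite le_max lexx.
    by rewrite le_max zs orbT.
  suff : g (finmap.enum_fset D) x <= f x by lra.
  elim: (finmap.enum_fset D) DK' => [|y s IH] DK' /=.
    by have := fM x; rewrite ler_norml => /andP[].
  rewrite ge_max; apply/andP; split.
    have yK : cube K y by apply: DK'; rewrite mem_head.
    exact: (CP y yK).2.
  by apply: IH => z zs; apply: DK'; rewrite inE zs orbT.
Qed.

(** The sigma-algebra is generated by the coordinates, so measurability is obtained from a pointwise
    limit: trigonometric functions within 1 / (n + 1) of [f] on the cube of half-side n + 1. *)
Lemma continuous_bounded_measurable f (M : R) : continuous f ->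
  (forall x, `|f x| <= M) -> bounded_measurable f.
Proof.
move=> cf fM; split; last by exists M.
have H (n : nat) : exists g, trig_closure g /\
    forall x, cube n.+1%:R x -> `|f x - g x| <= n.+1%:R^-1.
  have n0 : 0 < n.+1%:R^-1 :> R by rewrite invr_gt0.
  have [g [tg _ fg]] := trig_closure_dense_cube cf fM (ltr0Sn _ n) n0.
  by exists g.
have [g gP] := choice H.
apply: (@measurable_fun_cvg _ _ _ _ g) => [n|x _].
  by have [] := trig_closure_bounded_measurable (gP n).1.
apply/cvgrPdist_le => e e0; near=> n.
apply: (@le_trans _ _ n.+1%:R^-1); last first.
  rewrite ltW//; near: n; exact: near_infty_natSinv_lt (PosNum e0).
apply: (gP n).2 => i; apply: (@le_trans _ _ (\sum_(j < m) `|x ord0 j|)).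
  by rewrite (bigD1 i)//= lerDl sumr_ge0.
rewrite (@le_trans _ _ n%:R) ?ler_nat//; near: n; exact: nbhs_infty_ger.
Unshelve. all: by end_near. Qed.

(** The filter is arbitrary: a constant family yields the uniqueness of laws, a sequence of
    intensities the limit theorem. *)
Lemma cvg_of_characteristic (L : Type) (F : set_system L) {FF : ProperFilter F}
    (nu : L -> probability V R) (nu0 : probability V R) :
  (forall a t, \int[nu l]_x (cos (a + dot t x)) @[l --> F] -->
               \int[nu0]_x (cos (a + dot t x))) ->
  (forall e : R, 0 < e -> exists2 K : R, 0 < K &
     (\forall l \near F, (nu l (~` cube K) <= e%:E)%E) /\
     (nu0 (~` cube K) <= e%:E)%E) ->
  forall f, continuous f -> (exists M : R, forall x, `|f x| <= M) ->
  \int[nu l]_x (f x) @[l --> F] --> \int[nu0]_x (f x).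
Proof.
move=> ccos tight f cf [M0 fM0].
pose M : R := `|M0| + 1; have Mgt0 : 0 < M by rewrite ltr_wpDl.
have fM x : `|f x| <= M.
  by rewrite (le_trans (fM0 x))// (le_trans (ler_norm _))// lerDl.
have bf := continuous_bounded_measurable cf fM.
have ctrig g : trig_poly g ->
    \int[nu l]_x (g x) @[l --> F] --> \int[nu0]_x (g x).
  elim => [a t|f1 f2 t1 h1 t2 h2|r f1 t1 h1]; first exact: ccos.
    have b1 := trig_bounded_measurable t1; have b2 := trig_bounded_measurable t2.
    rewrite bounded_RintegralD//.
    under eq_fun do rewrite (bounded_RintegralD _ b1 b2).
    exact: cvgD.
  have b1 := trig_bounded_measurable t1; rewrite bounded_RintegralZ//.
  under eq_fun do rewrite (bounded_RintegralZ _ _ b1).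
  by apply: cvgM => //; exact: cvg_cst.
apply/cvgrPdist_le => e e0.
(* The comparisons cost twice d + 2 M d + d and once d, together 5 d + 4 M d, which is at most e. *)
pose d := e / (8 + 4 * M).
have dM : d * (8 + 4 * M) = e by rewrite divfK// gt_eqF// addr_gt0// mulr_gt0.
have d0 : 0 < d by rewrite divr_gt0// addr_gt0// mulr_gt0.
have [K K0 [tK tK0]] := tight _ d0.
have [g [tg gM fg]] := trig_closure_dense_cube cf fM K0 d0.
have [p tp gp] := tg _ d0.
have bg := trig_closure_bounded_measurable tg.
have bp := trig_bounded_measurable tp.
have mK : measurable (~` cube K) by apply: measurableC; exact: measurable_cube.
(* From [f] to [g] the cost is d on the cube and 2 M times the mass off it; from [g] to the
   trigonometric polynomial [p] it is d everywhere. *)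
have key (mu : probability V R) : (mu (~` cube K) <= d%:E)%E ->
    `|\int[mu]_x (f x) - \int[mu]_x (p x)| <= d + 2 * M * d + d.
  move=> muK.
  have -> : \int[mu]_x (f x) - \int[mu]_x (p x) =
    (\int[mu]_x (f x) - \int[mu]_x (g x)) + (\int[mu]_x (g x) - \int[mu]_x (p x)).
    by ring.
  rewrite (le_trans (ler_normD _ _))// lerD//; last exact: ler_dist_Rintegral_cst.
  rewrite (le_trans (ler_bounded_dist_Rintegral _ bf bg))//.
  have bI : bounded_measurable (\1_(~` cube K) : V -> R) by exact: bounded_measurable_indic.
  apply: (@le_trans _ _ (\int[mu]_x (d + 2 * M * \1_(~` cube K) x))).
    apply: le_bounded_Rintegral.
    - by apply: bounded_measurable_norm; exact: bounded_measurableB.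
    - apply: bounded_measurableD; first exact: bounded_measurable_cst.
      exact: bounded_measurableZ.
    - move=> x; rewrite indicE; have [xK|xK] := pselect (cube K x).
        rewrite memNset ?mulr0 ?addr0; last by move=> /(_ xK).
        exact: fg.
      rewrite mem_set// mulr1 (le_trans (ler_normB _ _))// ler_wpDl ?(ltW d0)//.
      by rewrite mulr_natl mulr2n lerD.
  rewrite bounded_RintegralD; [|exact: bounded_measurable_cst|exact: bounded_measurableZ].
  rewrite bounded_RintegralZ// Rintegral_probability_cst Rintegral_indic// lerD2l.
  by rewrite ler_wpM2l ?mulr_ge0 ?(ltW Mgt0)// -lee_fin fineK// fin_num_measure.
have /cvgrPdist_le/(_ _ d0) hp := ctrig _ tp.
near=> l.
have h1 : `|\int[nu0]_x (p x) - \int[nu l]_x (p x)| <= d by near: l.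
have h2 := key nu0 tK0.
have h3 : `|\int[nu l]_x (f x) - \int[nu l]_x (p x)| <= d + 2 * M * d + d.
  by apply: key; near: l.
have -> : \int[nu0]_x (f x) - \int[nu l]_x (f x) =
  (\int[nu0]_x (f x) - \int[nu0]_x (p x)) + ((\int[nu0]_x (p x) - \int[nu l]_x (p x)) +
  (\int[nu l]_x (p x) - \int[nu l]_x (f x))) by ring.
rewrite (le_trans (ler_normD _ _))//.
apply: (@le_trans _ _ ((d + 2 * M * d + d) + (d + (d + 2 * M * d + d)))).
  apply: lerD => //; rewrite (le_trans (ler_normD _ _))// lerD//.
  by rewrite distrC.
rewrite -dM; nra.
Unshelve. all: by end_near. Qed.

End trigonometric_approximation.

(** * Loeb spaces and ultralimits of random fields *)

Lemma cvg_sum {R : realType} {T : Type} {I : Type} (F : set_system T) {FF : Filter F}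
    (s : seq I) (f : I -> T -> R) (l : I -> R) :
  (forall i, f i x @[x --> F] --> l i) ->
  \sum_(i <- s) f i x @[x --> F] --> \sum_(i <- s) l i.
Proof.
move=> fl; elim: s => [|i s IH].
  by under eq_fun do rewrite big_nil; rewrite big_nil; exact: cvg_cst.
by under eq_fun do rewrite big_cons; rewrite big_cons; exact: cvgD.
Qed.

Section ultralimit.
Context {R : realType} {L : Type} (U : set_system L) {UU : UltraFilter U}.

(** Compactness of [-M, M] yields a cluster point, and along an ultrafilter a cluster point is a
    limit. *)
Lemma ultra_cvg_bounded (x : L -> R) (M : R) :
  (\forall l \near U, `|x l| <= M) -> x l @[l --> U] --> lim (x l @[l --> U]).
Proof.
move=> xM; have := @segment_compact R (- M) M => /(_ (x @ U)) [].
  by apply: filterS xM => l; rewrite /= in_itv/= -ler_norml.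
move=> p [_ clp]; suff xp : x @ U --> p by rewrite (cvg_lim _ xp).
move=> B nB; have [//|UB] := in_ultra_setVsetC (x @^-1` B) UU.
by have [r []] := clp (~` B) B UB nB.
Qed.

End ultralimit.

(* The Loeb space of a sequence of probability spaces along an ultrafilter:
   quotienting the product by [U] is not needed, since the sets [internal C]
   are already invariant under modification of a point off [U]. *)
Definition loeb_space (T : nat -> Type) (U : set_system nat) := forall n, T n.

Section loeb_measure.
Context {R : realType} {dT : nat -> measure_display}.
Variable T : forall n, measurableType (dT n).
Variable U : set_system nat.
Variable P : forall n, probability (T n) R.
Hypothesis UU : UltraFilter U.
Hypothesis U_infty : \oo `<=` U.
Local Notation S := (loeb_space T U).

HB.instance Definition _ := gen_eqMixin S.
HB.instance Definition _ := gen_choiceMixin S.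
HB.instance Definition _ := isPointed.Build S (fun n => point).

Definition internal (C : forall n, set (T n)) : set S :=
  [set s | \forall n \near U, C n (s n)].

Definition internal_set : set_system S :=
  [set A | exists C, (forall n, measurable (C n)) /\ A = internal C].

(** Negation commutes with [\near U] because an ultrafilter contains a set or its complement. *)
Lemma internalC C : internal (fun n => ~` C n) = ~` internal C.
Proof.
apply/seteqP; split => s /= sC.
  by move=> sC'; have [n []] := filter_ex (filterI sC sC').
by have [//|] := in_ultra_setVsetC [set n | C n (s n)] UU.
Qed.

Lemma internalI C D :
  internal (fun n => C n `&` D n) = internal C `&` internal D.
Proof.
apply/seteqP; split => s /=.
  by move=> CD; split; apply: filterS CD => n [].
by move=> [sC sD]; exact: filterI.
Qed.

Lemma internalU C D :
  internal (fun n => C n `|` D n) = internal C `|` internal D.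
Proof.
apply: setC_inj; rewrite -internalC setCU -!internalC -internalI.
by congr internal; apply: functional_extensionality_dep => n; rewrite setCU.
Qed.

Lemma internal0 : internal (fun=> set0) = set0.
Proof. by apply/seteqP; split => // s /filter_ex[]. Qed.

Lemma internalD C D :
  internal (fun n => C n `\` D n) = internal C `\` internal D.
Proof. by rewrite setDE -internalC -internalI. Qed.

Lemma internal_set0 : internal_set set0.
Proof. by exists (fun=> set0); split => //; rewrite internal0. Qed.

Lemma internal_setU : setU_closed internal_set.
Proof.
move=> _ _ [C [mC ->]] [D [mD ->]]; exists (fun n => C n `|` D n).
by split; [move=> n; exact: measurableU|rewrite internalU].
Qed.

Lemma internal_setC : setC_closed internal_set.
Proof.
move=> _ [C [mC ->]]; exists (fun n => ~` C n).
by split; [move=> n; exact: measurableC|rewrite internalC].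
Qed.

Definition loeb_display : measure_display. Proof. exact. Qed.

HB.instance Definition _ := @isAlgebraOfSets.Build loeb_display S internal_set
  internal_set0 internal_setU internal_setC.

(** Otherwise points of C n outside D n, chosen for U-almost every n, would form a member of
    [internal C] outside [internal D]. Hence an internal set determines its sections up to U. *)
Lemma internal_subset C D : internal C `<=` internal D ->
  \forall n \near U, C n `<=` D n.
Proof.
move=> CD; have [//|h] := in_ultra_setVsetC [set n | C n `<=` D n] UU.
have H n : exists x : T n, ~ (C n `<=` D n) -> C n x /\ ~ D n x.
  have [CDn|/existsNP[x /not_implyP[Cx Dx]]] := pselect (C n `<=` D n).
    by exists point.
  by exists x.
pose s n := sval (cid (H n)).
have sP n : ~ (C n `<=` D n) -> C n (s n) /\ ~ D n (s n) := svalP (cid (H n)).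
have sC : internal C s by apply: filterS h => n /sP[].
have [n [/sP[_ nD] Dn]] := filter_ex (filterI h (CD _ sC)).
by [].
Qed.

(* Countable saturation. *)
Lemma internal_cover (E : forall n, set (T n)) (C : nat -> forall n, set (T n)) :
  internal E `<=` \bigcup_k internal (C k) ->
  exists N, internal E `<=` \big[setU/set0]_(k < N) internal (C k).
Proof.
move=> EC; apply: contrapT => /forallNP nE.
pose G N n := E n `\` \big[setU/set0]_(k < N) C k n.
have Gle N N' n : (N <= N')%N -> G N' n `<=` G N n.
  move=> NN' x [Ex nx]; split => // xN; apply: nx.
  by move: xN; rewrite -!(bigcup_mkord _ (fun k => C k n)) => -[k /= kN xk];
    exists k => //=; exact: leq_trans NN'.
have internal_big N : internal (fun n => \big[setU/set0]_(k < N) C k n) =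
    \big[setU/set0]_(k < N) internal (C k).
  elim: N => [|N IH].
    rewrite big_ord0 -internal0; congr internal.
    by apply: functional_extensionality_dep => n; rewrite big_ord0.
  rewrite big_ord_recr/= -IH -internalU; congr internal.
  by apply: functional_extensionality_dep => n; rewrite big_ord_recr.
have GN N : \forall n \near U, G N n !=set0.
  have [//|h] := in_ultra_setVsetC [set n | G N n !=set0] UU.
  exfalso; apply: (nE N); rewrite -internal_big => s sE.
  apply: contrapT => sC.
  have : internal (G N) s by rewrite internalD.
  by move=> sG; have [n [Gn nG]] := filter_ex (filterI sG h); apply: nG; exists (s n).
(* The [G N n] decrease in N, so a point of the last nonempty one with N <= b lies in all the
   nonempty ones up to b. *)
have H n b : exists x : T n, forall N, (N <= b)%N -> G N n !=set0 -> G N n x.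
  elim: b => [|b [x xP]].
    have [[x Gx]|G0] := pselect (G 0%N n !=set0).
      by exists x => N; rewrite leqn0 => /eqP ->.
    by exists point => N; rewrite leqn0 => /eqP -> /G0.
  have [[y Gy]|G0] := pselect (G b.+1 n !=set0).
    by exists y => N Nb _; exact: Gle Gy.
  exists x => N; rewrite leq_eqVlt => /predU1P[-> /G0//|]; rewrite ltnS.
  exact: xP.
(* Diagonal choice: level n takes care of all N <= n. As U refines [\oo], each fixed N is reached
   for U-almost every n, so [s] lies in every [internal (G N)]. *)
pose s n := sval (cid (H n n)).
have sP n : forall N, (N <= n)%N -> G N n !=set0 -> G N n (s n) := svalP (cid (H n n)).
have sG N : internal (G N) s.
  have : \forall n \near U, (N <= n)%N by apply: U_infty; exact: nbhs_infty_ge.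
  by move=> /(filterI (GN N)); apply: filterS => n [G0 Nn]; exact: sP.
have sE : internal E s by apply: filterS (sG 0%N) => n [].
have [k _ sk] := EC s sE.
have [n [[_ nC] Cn]] := filter_ex (filterI (sG k.+1) sk).
by apply: nC; rewrite big_ord_recr/=; right.
Qed.

(** Any two representatives agree U-almost everywhere. The default of empty sections gives content 0
    to the sets that are not internal, so the content is nonnegative on all sets. *)
Definition internal_rep (A : set S) : forall n, set (T n) :=
  xget (fun=> set0) [set C | (forall n, measurable (C n)) /\ A = internal C].

Arguments internal_rep : clear implicits.

Lemma internal_repP A : internal_set A ->
  (forall n, measurable (internal_rep A n)) /\ A = internal (internal_rep A).
Proof. by move=> [C CP]; rewrite /internal_rep; case: xgetP => [D _ //|/(_ C)]. Qed.

Definition ulim (x : nat -> R) : R := lim (x n @[n --> U]).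

Definition loeb_content (A : set S) : \bar R :=
  (ulim (fun n => fine (P n (internal_rep A n))))%:E.

Lemma fine_probability_bound n (A : set (T n)) : measurable A ->
  0 <= fine (P n A) <= 1.
Proof.
move=> mA; rewrite fine_ge0//= -lee_fin fineK ?fin_num_measure//.
exact: probability_le1.
Qed.

Lemma cvg_fine_probability C : (forall n, measurable (C n)) ->
  fine (P n (C n)) @[n --> U] --> ulim (fun n => fine (P n (C n))).
Proof.
move=> mC; apply: (@ultra_cvg_bounded _ _ U UU _ 1); apply: nearW => n.
by have /andP[? ?] := fine_probability_bound (mC n); rewrite ger0_norm.
Qed.

Lemma ulim_eq (x y : nat -> R) (a : R) : (\forall n \near U, x n = y n) ->
  y n @[n --> U] --> a -> ulim x = a.
Proof.
move=> xy ya; apply/cvg_lim => //; apply: cvg_trans ya; apply: near_eq_cvg.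
by near do symmetry.
Unshelve. all: by end_near. Qed.

Lemma loeb_contentE C : (forall n, measurable (C n)) ->
  loeb_content (internal C) = (ulim (fun n => fine (P n (C n))))%:E.
Proof.
move=> mC; have CP : internal_set (internal C) by exists C.
have [mD CD] := internal_repP CP; congr EFin.
apply: (ulim_eq _ (cvg_fine_probability mC)).
have h1 : internal C `<=` internal (internal_rep (internal C)) by rewrite -CD.
have h2 : internal (internal_rep (internal C)) `<=` internal C by rewrite -CD.
apply: filterS2 (internal_subset h1) (internal_subset h2) => n ? ?; congr (fine (P n _)); exact/seteqP.
Qed.

Lemma loeb_content0 : loeb_content set0 = 0%E.
Proof.
rewrite -internal0 loeb_contentE//; congr EFin.
by apply: (ulim_eq _ (cvg_cst _)); apply: nearW => n; rewrite measure0.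
Qed.

Lemma loeb_content_ge0 A : (0 <= loeb_content A)%E.
Proof.
rewrite lee_fin.
have [/internal_repP[mC _]|nA] := pselect (internal_set A).
  apply: (cvgr_to_ge (cvg_fine_probability mC)); apply: nearW => n.
  by have /andP[] := fine_probability_bound (mC n).
rewrite (ulim_eq _ (cvg_cst 0))//; apply: nearW => n.
rewrite /internal_rep xgetPN ?measure0// => C CP; apply: nA; by exists C.
Qed.

Lemma loeb_contentU A B : internal_set A -> internal_set B ->
  A `&` B = set0 -> loeb_content (A `|` B) = (loeb_content A + loeb_content B)%E.
Proof.
move=> [C [mC ->]] [D [mD ->]] CD0.
have DE : internal D = internal (fun n => D n `\` C n).
  by rewrite internalD setDE; apply/esym/setIidPl; rewrite -disjoints_subset setIC.
have mDC n : measurable (D n `\` C n) by exact: measurableD.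
rewrite DE -internalU !loeb_contentE//; last by move=> n; exact: measurableU.
congr EFin; apply: (ulim_eq _ (cvgD (cvg_fine_probability mC) (cvg_fine_probability mDC))).
apply: nearW => n; rewrite measureU//; last by rewrite setDE setICA setICr setI0.
by rewrite fineD// fin_num_measure.
Qed.

Lemma loeb_content_bigU (F : nat -> set S) N : (forall k, internal_set (F k)) ->
  trivIset setT F ->
  loeb_content (\big[setU/set0]_(k < N) F k) =
  (\sum_(0 <= k < N) loeb_content (F k))%E.
Proof.
move=> mF tF; elim: N => [|N IH].
  by rewrite big_ord0 big_geq// loeb_content0.
rewrite big_ord_recr big_nat_recr//= -IH; apply: loeb_contentU => //.
  apply: big_ind => [|A B|k _]; [exact: internal_set0|exact: internal_setU|exact: mF].
rewrite setIC; apply/seteqP; split => // s [sN].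
rewrite -bigcup_mkord => -[k /= kN sk].
have := tF N k I I (ex_intro _ s (conj sN sk)) => NK.
by rewrite NK ltnn in kN.
Qed.

(** By saturation, an internal set that is a countable disjoint union of internal sets has only
    finitely many nonempty terms, so this reduces to finite additivity. *)
Lemma loeb_content_sigma_additive :
  semi_sigma_additive (loeb_content : set S -> \bar R).
Proof.
move=> F mF tF mUF.
have [C CP] := choice mF.
have [E [mE UFE]] := mUF.
have [|N EN] := @internal_cover E C.
  by rewrite -UFE; apply: subset_bigcup => k _; rewrite -(CP k).2.
have UFN : \bigcup_k F k = \big[setU/set0]_(k < N) F k.
  apply/seteqP; split; last by rewrite -bigcup_mkord => s [k _ sk]; exists k.
  rewrite UFE; apply: (subset_trans EN).
  suff -> : \big[setU/set0]_(k < N) internal (C k) = \big[setU/set0]_(k < N) F k by [].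
  by apply: eq_bigr => k _; rewrite (CP k).2.
have F0 k : (N <= k)%N -> F k = set0.
  move=> Nk; apply/seteqP; split => // s sk.
  have : (\bigcup_k F k) s by exists k.
  rewrite UFN -bigcup_mkord => -[j /= jN sj].
  have := tF k j I I (ex_intro _ s (conj sk sj)) => kj.
  by move: jN; rewrite -kj ltnNge Nk.
rewrite UFN loeb_content_bigU//; apply: cvg_near_cst.
near=> n; have Nn : (N <= n)%N by near: n; exact: nbhs_infty_ge.
rewrite (big_cat_nat (n := N))//= [X in (_ + X)%E]big1_seq ?adde0// => k.
by rewrite andTb mem_index_iota => /andP[Nk _]; rewrite (F0 k Nk); exact: loeb_content0.
Unshelve. all: by end_near. Qed.

HB.instance Definition _ := isMeasure.Build _ S R loeb_content
  loeb_content0 loeb_content_ge0 loeb_content_sigma_additive.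

Definition loeb_measurable : measurableType _ :=
  g_sigma_algebraType (@measurable _ S).

Definition loeb_measure : set loeb_measurable -> \bar R :=
  measure_extension (loeb_content : {measure set S -> \bar R}).

HB.instance Definition _ := Measure.on loeb_measure.

Lemma loeb_measureE C : (forall n, measurable (C n)) ->
  loeb_measure (internal C) = (ulim (fun n => fine (P n (C n))))%:E.
Proof.
move=> mC; rewrite -loeb_contentE// /loeb_measure /measure_extension/=.
by rewrite measurable_mu_extE//; exists C.
Qed.

Lemma loeb_measureT : loeb_measure setT = 1%E.
Proof.
have -> : setT = internal (fun=> setT).
  by apply/seteqP; split => // s _; apply: nearW.
rewrite loeb_measureE//; congr EFin; apply: (ulim_eq _ (cvg_cst _)).
by apply: nearW => n; rewrite probability_setT.
Qed.

HB.instance Definition _ :=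
  @Measure_isProbability.Build _ loeb_measurable R loeb_measure loeb_measureT.

Lemma measurable_internal C : (forall n, measurable (C n)) ->
  measurable (internal C : set loeb_measurable).
Proof. by move=> mC; apply: sub_sigma_algebra; exists C. Qed.

(** A strict inequality for an ultralimit becomes a countable union of internal conditions, hence
    measurable. The margin 1 / (k + 1) is there because a < x n alone only gives a <= l. *)
Lemma cvg_ultra_gt (x : nat -> R) (l a : R) : x n @[n --> U] --> l ->
  (a < l) <-> exists k : nat, \forall n \near U, a + k.+1%:R^-1 <= x n.
Proof.
move=> xl; split => [al|[k ak]]; last first.
  have : a + k.+1%:R^-1 <= l by exact: cvgr_to_ge ak.
  by apply: lt_le_trans; rewrite ltrDl invr_gt0.
have la : 0 < l - a by rewrite subr_gt0.
have [k _ kP] := near_infty_natSinv_lt (PosNum la).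
exists k; have := kP k (leqnn k); rewrite /= ltrBrDl => h.
exact: cvgr_ge h.
Qed.

Lemma measurable_superlevel (f : loeb_measurable -> R) :
  (forall a : R, measurable [set s | a < f s]) -> measurable_fun setT f.
Proof.
move=> mf; apply: (measurability (@RGenOInfty.G R)).
  exact: RGenOInfty.measurableE.
move=> _ [_ [a ->] <-]; rewrite setTI.
rewrite (_ : f @^-1` _ = [set s | a < f s]); first exact: mf.
by apply/seteqP; split => s /=; rewrite in_itv/= andbT.
Qed.

Lemma measurable_level n (g : T n -> R) (a : R) : measurable_fun setT g ->
  measurable [set x | a <= g x].
Proof.
move=> mg; rewrite (_ : [set x | _] = g @^-1` `[a, +oo[).
  by rewrite -[X in measurable X]setTI; exact: mg.
by apply/seteqP; split => w /=; rewrite in_itv/= andbT.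
Qed.

Section bounded_limit.
Variables (g : forall n, T n -> R) (M : R).
Arguments g : clear implicits.
Hypothesis mg : forall n, measurable_fun setT (g n).
Hypothesis gM : forall n x, `|g n x| <= M.
Arguments gM : clear implicits.

Let G (s : loeb_measurable) : R := ulim (fun n => g n (s n)).

Let cvg_G s : g n (s n) @[n --> U] --> G s.
Proof. by apply: (@ultra_cvg_bounded _ _ U UU _ M); apply: nearW => n. Qed.
Arguments cvg_G : clear implicits.

Lemma bounded_measurable_ulim : bounded_measurable G.
Proof.
split; last first.
  exists M => s.
  have cs : `|g n (s n)| @[n --> U] --> `|G s| by apply: cvg_norm; exact: cvg_G.
  apply: (cvgr_to_le cs).
  by apply: nearW => n; exact: gM.
apply: measurable_superlevel => a.
rewrite (_ : [set s | _] =
    \bigcup_k internal (fun n => [set x | a + k.+1%:R^-1 <= g n x])).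
  apply: bigcupT_measurable => k; apply: measurable_internal => n.
  exact: measurable_level.
apply/seteqP; split => s /=.
  by move=> /(cvg_ultra_gt a (cvg_G s)) [k sk]; exists k.
by move=> [k _ sk]; apply/(cvg_ultra_gt a (cvg_G s)); exists k.
Qed.

(** Both sides are within c of the integral of a layer-cake step function, and for step functions
    the identity is [loeb_measureE] on the levels. *)
Lemma Rintegral_ulim :
  \int[loeb_measure]_s (G s) = ulim (fun n => \int[P n]_x (g n x)).
Proof.
have [M0|M0] := ltP M 0.
  exfalso; have := gM 0%N point; rewrite leNgt => /negP; apply.
  exact: lt_le_trans M0 (normr_ge0 _).
pose M' := M + 1; have M'0 : 0 < M' by rewrite ltr_wpDl.
have gM' n x : `|g n x| <= M' by rewrite (le_trans (gM n x))// lerDl.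
have bg n : bounded_measurable (g n) by split => //; exists M.
have cvg_int : \int[P n]_x (g n x) @[n --> U] --> ulim (fun n => \int[P n]_x (g n x)).
  apply: (@ultra_cvg_bounded _ _ U UU _ M); apply: nearW => n.
  exact: normr_Rintegral_le.
suff H (e : R) : 0 < e ->
    `|\int[loeb_measure]_s (G s) - ulim (fun n => \int[P n]_x (g n x))| <= e.
  apply/eqP; rewrite -subr_eq0 -normr_le0; apply/ler_addgt0Pr => e e0.
  by rewrite add0r H.
move=> e0; pose N := (Num.truncn (4 * M' / e)).+1; pose c : R := 2 * M' / N%:R.
have ce : c + c <= e.
  have : 4 * M' / e <= N%:R by exact/ltW/truncnS_gt.
  rewrite ler_pdivrMr// => h.
  rewrite (_ : c + c = 4 * M' / N%:R); last by rewrite /c; ring.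
  by rewrite ler_pdivrMr ?ltr0n// [leRHS]mulrC.
pose C (k : 'I_N) n := [set x | - M' + c * k.+1%:R <= g n x].
have mC k n : measurable (C k n) by exact: measurable_level.
pose v n x : R := - M' + c * \sum_(k < N) \1_(C k n) x.
(* The levels are [internal (C k)] and not the superlevel sets of [G], which may differ at the
   boundary; thus [v n (s n)] converges to [V s] at every s. *)
pose V (s : loeb_measurable) : R := - M' + c * \sum_(k < N) \1_(internal (C k)) s.
have bv n : bounded_measurable (v n).
  apply: bounded_measurableD; first exact: bounded_measurable_cst.
  apply: bounded_measurableZ; apply: bounded_measurable_sum => k.
  exact: bounded_measurable_indic.
have bI k : bounded_measurable (\1_(internal (C k)) : loeb_measurable -> R).
  by apply: bounded_measurable_indic; exact: measurable_internal.
have bV : bounded_measurable V.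
  apply: bounded_measurableD; first exact: bounded_measurable_cst.
  by apply: bounded_measurableZ; apply: bounded_measurable_sum => k.
have vg n x : `|g n x - v n x| <= c.
  have := @layer_cake _ N M' (g n x) isT M'0 (gM' n x).
  rewrite -/c /v; congr (`|_ - (_ + _ * _)| <= _); apply: eq_bigr => k _.
  by rewrite indicE; congr (nat_of_bool _)%:R; apply/idP/idP; rewrite inE.
have cvgI k s : \1_(C k n) (s n) @[n --> U] --> (\1_(internal (C k)) s : R).
  have [sC|sC] := pselect (internal (C k) s).
    rewrite indicE mem_set//; apply: cvg_near_cst.
    by apply: filterS sC => n sn; rewrite indicE mem_set.
  rewrite indicE memNset//; apply: cvg_near_cst.
  have : internal (fun n => ~` C k n) s by rewrite internalC.
  by apply: filterS => n sn; rewrite indicE memNset.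
have cvgV s : v n (s n) @[n --> U] --> V s.
  apply: cvgD; first exact: cvg_cst.
  apply: cvgM; first exact: cvg_cst.
  by apply: cvg_sum => k; exact: cvgI.
have VG s : `|G s - V s| <= c.
  apply: (cvgr_to_le (cvg_norm (cvgB (cvg_G s) (cvgV s)))).
  by apply: nearW => n; exact: vg.
have cvgvV : \int[P n]_x (v n x) @[n --> U] --> \int[loeb_measure]_s (V s).
  have -> : \int[loeb_measure]_s (V s) =
      - M' + c * \sum_(k < N) ulim (fun n => fine (P n (C k n))).
    rewrite bounded_RintegralD; [|exact: bounded_measurable_cst|].
      rewrite Rintegral_probability_cst bounded_RintegralZ; last exact: bounded_measurable_sum.
      rewrite bounded_Rintegral_sum//; congr (_ + _ * _); apply: eq_bigr => k _.
      rewrite Rintegral_indic; last by apply: measurable_internal => n; exact: mC.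
      exact: (congr1 fine (loeb_measureE (mC k))).
    by apply: bounded_measurableZ; exact: bounded_measurable_sum.
  rewrite (_ : (fun n => _) = (fun n =>
      - M' + c * \sum_(k < N) fine (P n (C k n)))).
    apply: cvgD; first exact: cvg_cst.
    apply: cvgM; first exact: cvg_cst.
    by apply: cvg_sum => k; exact: cvg_fine_probability.
  apply/funext => n.
  have bI' k : bounded_measurable (\1_(C k n) : T n -> R) by exact: bounded_measurable_indic.
  rewrite bounded_RintegralD; [|exact: bounded_measurable_cst|].
    rewrite Rintegral_probability_cst bounded_RintegralZ; last exact: bounded_measurable_sum.
    rewrite bounded_Rintegral_sum//; congr (_ + _ * _); apply: eq_bigr => k _.
    by rewrite Rintegral_indic.
  by apply: bounded_measurableZ; exact: bounded_measurable_sum.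
have h1 : `|\int[loeb_measure]_s (G s) - \int[loeb_measure]_s (V s)| <= c.
  by apply: ler_dist_Rintegral_cst => //; exact: bounded_measurable_ulim.
have h2 : `|\int[loeb_measure]_s (V s) - ulim (fun n => \int[P n]_x (g n x))| <= c.
  apply: (cvgr_to_le (cvg_norm (cvgB cvgvV cvg_int))).
  apply: nearW => n; apply: ler_dist_Rintegral_cst => // x.
  by rewrite distrC.
rewrite (le_trans _ ce)// (le_trans (ler_distD (\int[loeb_measure]_s (V s)) _ _))//.
exact: lerD.
Qed.

End bounded_limit.

Section tight_limit.
Variable I : Type.
Variable Y : forall n, I -> T n -> R.
Arguments Y : clear implicits.
Hypothesis mY : forall n i, measurable_fun setT (Y n i).
Hypothesis tightY : forall i (e : R), 0 < e -> exists K : R,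
  \forall n \near U, fine (P n [set x | K < `|Y n i x|]) <= e.

Let ultra_bounded i := [set s : loeb_measurable |
  exists k : nat, \forall n \near U, `|Y n i (s n)| <= k%:R].

(** Where the values are unbounded along U the ultralimit means nothing; the default 0 is taken
    there, on what tightness shows to be a null set. *)
Definition loeb_field i (s : loeb_measurable) : R :=
  if pselect (ultra_bounded i s) then ulim (fun n => Y n i (s n)) else 0.

Let measurable_ball n i (k : R) : measurable [set x | `|Y n i x| <= k].
Proof.
rewrite (_ : [set x | _] = Y n i @^-1` `[- k, k]).
  by rewrite -[X in measurable X]setTI; exact: mY.
by apply/seteqP; split => w /=; rewrite in_itv/= ler_norml.
Qed.

Let ultra_boundedE i : ultra_bounded i =
  \bigcup_(k : nat) internal (fun n => [set x | `|Y n i x| <= k%:R]).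
Proof. by apply/seteqP; split => s [k]; [exists k|move=> _; exists k]. Qed.

Let measurable_ultra_bounded i : measurable (ultra_bounded i).
Proof.
rewrite ultra_boundedE; apply: bigcupT_measurable => k.
exact: measurable_internal.
Qed.

Let cvg_loeb_field i s : ultra_bounded i s ->
  Y n i (s n) @[n --> U] --> loeb_field i s.
Proof.
move=> si; rewrite /loeb_field; case: pselect => // -[k sk].
exact: (@ultra_cvg_bounded _ _ U UU _ k%:R).
Qed.

Lemma measurable_loeb_field i : measurable_fun setT (loeb_field i).
Proof.
apply: measurable_superlevel => a.
(* The last set accounts for the default value 0, which exceeds a only when a < 0. *)
rewrite (_ : [set s | _] = (ultra_bounded i `&`
    \bigcup_k internal (fun n => [set x | a + k.+1%:R^-1 <= Y n i x])) `|`
    (if a < 0 then ~` ultra_bounded i else set0)).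
  apply: measurableU.
    apply: measurableI => //; apply: bigcupT_measurable => k.
    by apply: measurable_internal => n; exact: measurable_level.
  by case: ifP => // _; exact: measurableC.
apply/seteqP; split => s /=.
  have [si|si] := pselect (ultra_bounded i s).
    by move=> /(cvg_ultra_gt a (cvg_loeb_field si)) [k sk]; left; split => //; exists k.
  by rewrite /loeb_field; case: pselect => [//|ns] /= a0; right; rewrite a0.
move=> [[si [k _ sk]]|].
  by apply/(cvg_ultra_gt a (cvg_loeb_field si)); exists k.
by case: ifP => // a0 si; rewrite /loeb_field; case: pselect.
Qed.

Lemma loeb_measure_ultra_bounded i : loeb_measure (~` ultra_bounded i) = 0%E.
Proof.
apply/eqP; rewrite eq_le measure_ge0 andbT; apply/lee_addgt0Pr => e e0.
rewrite add0e; have [K tK] := tightY i e0.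
pose k := (Num.truncn K).+1.
have Kk : K <= k%:R by exact/ltW/truncnS_gt.
apply: (@le_trans _ _ (loeb_measure (internal (fun n => ~` [set x | `|Y n i x| <= k%:R])))).
  apply: le_measure; rewrite ?inE.
  - exact: measurableC.
  - by apply: measurable_internal => n; exact: measurableC.
  - rewrite internalC; apply: subsetC => s sk; by exists k.
rewrite loeb_measureE; last by move=> n; exact: measurableC.
rewrite lee_fin; apply: (cvgr_to_le (cvg_fine_probability _)).
  by move=> n; exact: measurableC.
apply: filterS tK => n; apply: le_trans; apply: fine_le.
- by apply: fin_num_measure; exact: measurableC.
- apply: fin_num_measure; rewrite (_ : mkset _ = ~` [set x | `|Y n i x| <= K]).
    exact: measurableC.
  by apply/seteqP; split => x /=; [rewrite ltNge => /negP|move/negP; rewrite ltNge].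
- apply: le_measure; rewrite ?inE.
  + exact: measurableC.
  + rewrite (_ : mkset _ = ~` [set x | `|Y n i x| <= K]); first exact: measurableC.
    by apply/seteqP; split => x /=; [rewrite ltNge => /negP|move/negP; rewrite ltNge].
  + by move=> x /= /negP; rewrite -ltNge; exact: le_lt_trans.
Qed.

(** The cosine is bounded, so [Rintegral_ulim] applies to the composition although the fields may be
    unbounded; by continuity the cosine commutes with the ultralimit off a null set. *)
Lemma loeb_field_characteristic (m : nat) (z : 'I_m -> I) (a : R) (t : 'I_m -> R)
    (c : R) :
  \int[P n]_x (cos (a + \sum_(i < m) t i * Y n (z i) x)) @[n --> U] --> c ->
  \int[loeb_measure]_s (cos (a + \sum_(i < m) t i * loeb_field (z i) s)) = c.
Proof.
move=> lc.
pose g n x := cos (a + \sum_(i < m) t i * Y n (z i) x).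
have mlin n : measurable_fun setT (fun x : T n => a + \sum_(i < m) t i * Y n (z i) x).
  apply: measurable_funD => //; apply: measurable_sum => i.
  exact: measurable_funM.
have mg n : measurable_fun setT (g n) by have [] := bounded_measurable_cos (mlin n).
have g1 n x : `|g n x| <= 1 by exact: cos_max.
have := Rintegral_ulim mg g1; rewrite /g.
have -> : ulim (fun n => \int[P n]_x cos (a + \sum_(i < m) t i * Y n (z i) x)) = c.
  by apply/cvg_lim.
move=> <-.
have mN : measurable_fun setT (fun s : loeb_measurable =>
    a + \sum_(i < m) t i * loeb_field (z i) s).
  apply: measurable_funD => //; apply: measurable_sum => i.
  by apply: measurable_funM => //; exact: measurable_loeb_field.
congr fine; apply: ae_eq_integral => //.
- by apply/measurable_EFinP; have [] := bounded_measurable_cos mN.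
- by apply/measurable_EFinP; have [] := bounded_measurable_ulim mg g1.
have : {ae loeb_measure, forall s, forall i, ultra_bounded (z i) s}.
  apply: filter_forall => i; exists (~` ultra_bounded (z i)); split => //.
    exact: measurableC.
  exact: loeb_measure_ultra_bounded.
apply: filterS => s sz _ /=; congr EFin.
apply/esym/cvg_lim => //.
apply: continuous_cvg; first exact: continuous_cos.
apply: cvgD; first exact: cvg_cst.
apply: cvg_sum => i; apply: cvgM; first exact: cvg_cst.
exact: cvg_loeb_field.
Qed.

End tight_limit.

End loeb_measure.

(** A limit along [\oo] is also the limit along U, so it is attained exactly on the Loeb space. One
    such space serves all finite families at once, however large the index set [I] is. *)
Lemma exists_limit_field (R : realType) (dT : nat -> measure_display)
    (T : forall n, measurableType (dT n)) (P : forall n, probability (T n) R)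
    (I : Type) (Y : forall n, I -> T n -> R) :
  (forall n i, measurable_fun setT (Y n i)) ->
  (forall i (e : R), 0 < e -> exists K : R,
     \forall n \near \oo, fine (P n [set x | K < `|Y n i x|]) <= e) ->
  exists (dS : measure_display) (S : measurableType dS) (Q : probability S R)
    (N : I -> {RV Q >-> R}),
    forall (m : nat) (z : 'I_m -> I) (a : R) (t : 'I_m -> R) (c : R),
      \int[P n]_x (cos (a + \sum_(i < m) t i * Y n (z i) x)) @[n --> \oo] --> c ->
      \int[Q]_s (cos (a + \sum_(i < m) t i * N (z i) s)) = c.
Proof.
move=> mY tY.
have [U [UU U_infty]] := @ultraFilterLemma nat \oo _.
have tU i (e : R) : 0 < e -> exists K : R,
    \forall n \near U, fine (P n [set x | K < `|Y n i x|]) <= e.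
  by move=> /(tY i)[K KP]; exists K; exact: U_infty.
have mN i : measurable_fun setT (loeb_field Y i : loeb_measurable T UU -> R).
  exact: measurable_loeb_field.
pose Q : probability (loeb_measurable T UU) R := loeb_measure P U_infty.
pose N i : {RV Q >-> R} := mfun_Sub (mem_set (mN i)).
exists _, _, Q, N => m z a t c cvgc.
apply: (loeb_field_characteristic UU U_infty mY tU).
exact: cvg_trans (cvg_app _ U_infty) cvgc.
Qed.

(** * The characteristic function of the normal law *)

Section dominated_convergence_Rintegral.
Context d (T : measurableType d) (R : realType) (mu : {measure set T -> \bar R}).

Lemma dominated_convergence_Rintegral (f_ : nat -> T -> R) (f g : T -> R) :
  (forall n, measurable_fun setT (f_ n)) -> measurable_fun setT f ->
  {ae mu, forall x, f_ n x @[n --> \oo] --> f x} ->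
  mu.-integrable setT (EFin \o g) ->
  (forall n x, `|f_ n x| <= g x) ->
  mu.-integrable setT (EFin \o f) /\
  \int[mu]_x (f_ n x) @[n --> \oo] --> \int[mu]_x (f x).
Proof.
move=> mf_ mf f_f ig f_g.
have if_ n : mu.-integrable setT (EFin \o f_ n).
  apply: (@le_integrable _ _ _ mu setT _ _ (EFin \o g)) => //.
  - exact/measurable_EFinP.
  - by move=> x _ /=; rewrite lee_fin (le_trans (f_g n x))// ler_norm.
have := @dominated_convergence _ _ _ mu setT measurableT
  (fun n x => (f_ n x)%:E) (EFin \o f) (EFin \o g).
case.
- by move=> n; exact/measurable_EFinP.
- exact/measurable_EFinP.
- apply: filterS f_f => x f_fx _; apply: cvg_EFin => //; exact: nearW.
- exact: ig.
- by apply/aeW => x n _ /=; rewrite lee_fin.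
move=> intf _ dct; split => //.
apply: fine_cvg; rewrite fineK//; exact: integrable_fin_num.
Qed.

End dominated_convergence_Rintegral.

Section density.
Context d (T : measurableType d) (R : realType).

(* A bounded function is a uniform limit of combinations of its superlevel
   indicators, so a bounded linear functional is determined on indicators. *)
Lemma bounded_functional_Rintegral (P : probability T R) (L : (T -> R) -> R) :
  (forall f g, bounded_measurable f -> bounded_measurable g ->
     L (fun x => f x + g x) = L f + L g) ->
  (forall r f, bounded_measurable f -> L (fun x => r * f x) = r * L f) ->
  (forall f (e : R), bounded_measurable f -> (forall x, `|f x| <= e) -> `|L f| <= e) ->
  (forall A, measurable A -> L \1_A = fine (P A)) ->
  forall f, bounded_measurable f -> L f = \int[P]_x (f x).
Proof.
move=> LD LZ Lb LI f bf; have [mf [M0 fM0]] := bf.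
pose M : R := `|M0| + 1; have Mgt0 : 0 < M by rewrite ltr_wpDl.
have fM x : `|f x| <= M.
  by rewrite (le_trans (fM0 x))// (le_trans (ler_norm _))// lerDl.
suff H (e : R) : 0 < e -> `|L f - \int[P]_x (f x)| <= e.
  apply/eqP; rewrite -subr_eq0 -normr_le0; apply/ler_addgt0Pr => e e0.
  by rewrite add0r H.
move=> e0; pose n := (Num.truncn (4 * M / e)).+1; pose c : R := 2 * M / n%:R.
have ce : c + c <= e.
  have : 4 * M / e <= n%:R by exact/ltW/truncnS_gt.
  rewrite ler_pdivrMr// => h.
  rewrite (_ : c + c = 4 * M / n%:R); last by rewrite /c; ring.
  by rewrite ler_pdivrMr ?ltr0n// [leRHS]mulrC.
pose A (k : 'I_n) := [set x | - M + c * k.+1%:R <= f x].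
have mA k : measurable (A k).
  rewrite (_ : A k = f @^-1` `[- M + c * k.+1%:R, +oo[).
    by rewrite -[X in measurable X]setTI; exact: mf.
  by apply/seteqP; split => w /=; rewrite in_itv/= andbT.
have bI k : bounded_measurable (\1_(A k) : T -> R) by exact: bounded_measurable_indic.
pose S x : R := \sum_(k < n) \1_(A k) x.
have bS : bounded_measurable S by exact: bounded_measurable_sum.
pose v x : R := (- M) * cst 1 x + c * S x.
have b1 : bounded_measurable (fun x : T => - M * cst 1 x).
  by apply: bounded_measurableZ; exact: bounded_measurable_cst.
have bv : bounded_measurable v.
  by apply: bounded_measurableD => //; exact: bounded_measurableZ.
have fv x : `|f x - v x| <= c.
  have := @layer_cake _ n M (f x) isT Mgt0 (fM x).
  rewrite -/c /v mulr1 /S; congr (`|_ - (_ + _ * _)| <= _); apply: eq_bigr => k _.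
  by rewrite indicE; congr (nat_of_bool _)%:R; apply/idP/idP; rewrite inE.
have LS (s : seq 'I_n) : L (fun x => \sum_(k <- s) \1_(A k) x) =
    \int[P]_x (\sum_(k <- s) \1_(A k) x).
  elim: s => [|k s IH].
    under [in LHS]eq_fun do rewrite big_nil.
    under [in RHS]eq_Rintegral do rewrite big_nil.
    rewrite Rintegral_probability_cst.
    have -> : (fun _ : T => 0 : R) = fun x => 0 * cst 0 x.
      by apply/funext => x; rewrite mul0r.
    by rewrite LZ ?mul0r//; exact: bounded_measurable_cst.
  under [in LHS]eq_fun do rewrite big_cons.
  under [in RHS]eq_Rintegral do rewrite big_cons.
  have bs := bounded_measurable_sum s bI.
  by rewrite LD// bounded_RintegralD// LI// Rintegral_indic// IH.
have Lv : L v = \int[P]_x (v x).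
  rewrite LD//; last exact: bounded_measurableZ.
  rewrite bounded_RintegralD//; last exact: bounded_measurableZ.
  have b1' : bounded_measurable (cst 1 : T -> R) by exact: bounded_measurable_cst.
  rewrite !LZ// !bounded_RintegralZ// LS; congr (_ * _ + _).
  rewrite Rintegral_probability_cst.
  have -> : cst 1 = \1_(setT : set T) :> (T -> R) by rewrite indicT.
  by rewrite LI// probability_setT.
have h1 : `|L f - L v| <= c.
  have -> : L f - L v = L (fun x => f x + (-1) * v x).
    rewrite LD// ?LZ// ?mulN1r//; exact: bounded_measurableZ.
  apply: Lb => [|x]; last by rewrite mulN1r.
  by apply: bounded_measurableD => //; exact: bounded_measurableZ.
have h2 : `|\int[P]_x (v x) - \int[P]_x (f x)| <= c.
  by apply: ler_dist_Rintegral_cst => // x; rewrite distrC.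
rewrite (le_trans _ ce)// (le_trans (ler_distD (L v) _ _))// lerD//.
by rewrite Lv.
Qed.

Lemma integrable_EFinZ (mu : {measure set T -> \bar R}) (r : R) (p : T -> R) :
  mu.-integrable setT (EFin \o p) ->
  mu.-integrable setT (EFin \o (fun x => r * p x)).
Proof.
move=> ip; rewrite (_ : EFin \o _ = fun x => (r%:E * (EFin \o p) x)%E).
  exact: integrableZl.
by apply/funext => x /=; rewrite EFinM.
Qed.

(** Integration against the density is a bounded linear functional that agrees with [P] on
    indicators. *)
Lemma Rintegral_density (mu : {measure set T -> \bar R}) (P : probability T R)
    (p : T -> R) :
  (forall x, 0 <= p x) -> mu.-integrable setT (EFin \o p) ->
  (forall A, measurable A -> P A = (\int[mu]_(x in A) (p x)%:E)%E) ->
  forall f, bounded_measurable f ->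
    \int[P]_x (f x) = \int[mu]_x (f x * p x).
Proof.
move=> p0 ip Pp f bf; apply/esym.
have mp : measurable_fun setT p by exact/measurable_EFinP/(measurable_int mu).
have ifp g : bounded_measurable g -> mu.-integrable setT (EFin \o (fun x => g x * p x)).
  move=> [mg [M gM]].
  apply: (@le_integrable _ _ _ mu setT _ _ (EFin \o (fun x => M * p x))) => //.
  - by apply/measurable_EFinP; exact: measurable_funM.
  - move=> x _ /=; rewrite lee_fin !normrM ler_wpM2r//.
    by rewrite (le_trans (gM x))// ler_norm.
  - exact: integrable_EFinZ.
have p1 : \int[mu]_x (p x) = 1.
  by rewrite /Rintegral -Pp// probability_setT.
apply: (bounded_functional_Rintegral (L := fun f => \int[mu]_x (f x * p x))) => //.
- move=> g h bg bh; rewrite -RintegralD//; [|exact: ifp..].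
  by apply: eq_Rintegral => x _; rewrite mulrDl.
- move=> r g bg; rewrite -RintegralZl//; last exact: ifp.
  by apply: eq_Rintegral => x _; rewrite mulrA.
- move=> g e bg ge; rewrite (le_trans (le_normr_Rintegral _ (ifp _ bg)))//.
  have -> : e = \int[mu]_x (e * p x) by rewrite RintegralZl// p1 mulr1.
  apply: le_Rintegral => //.
  + have := integrable_norm (ifp _ bg); apply: eq_integrable => //.
  + exact: integrable_EFinZ.
  + by move=> x _; rewrite normrM (ger0_norm (p0 x)) ler_wpM2r.
- move=> A mA; rewrite Pp// /Rintegral; congr fine.
  rewrite [RHS]integral_mkcond; apply: eq_integral => x _.
  by rewrite patchE indicE; case: (x \in A); rewrite ?mul1r ?mul0r.
Qed.

End density.

Section normal_characteristic.
Context {R : realType}.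
Notation mu := (@lebesgue_measure R).

(** The fundamental theorem of calculus on growing symmetric intervals; it serves as integration by
    parts with vanishing boundary terms. *)
Lemma Rintegral_derive_eq0 (F f : R -> R) : (forall x : R, is_derive x 1 F (f x)) ->
  continuous f -> mu.-integrable setT (EFin \o f) ->
  F n%:R @[n --> \oo] --> (0 : R) -> F (- n%:R) @[n --> \oo] --> (0 : R) ->
  \int[mu]_x (f x) = 0.
Proof.
move=> dF cf intf F0 FN0.
have mf : measurable_fun setT f by exact: continuous_measurable_fun.
pose D (n : nat) : set R := `[- n.+1%:R, n.+1%:R]%classic.
have ftc n : \int[mu]_x ((f \_ (D n)) x) = F n.+1%:R - F (- n.+1%:R).
  rewrite -Rintegral_mkcond /Rintegral (@continuous_FTC2 _ f F)//.
  - by rewrite -subr_gt0 opprK addr_gt0.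
  - exact: continuous_subspaceT.
  - have cF x : {for x, continuous F}.
      by apply/differentiable_continuous/derivable1_diffP; have [] := dF x.
    split => [x _||].
    + by have [] := dF x.
    + exact/cvg_at_right_filter/cF.
    + exact/cvg_at_left_filter/cF.
  - by move=> x _; rewrite derive1E; have [] := dF x.
have [||||_ dct] := @dominated_convergence_Rintegral _ _ _ mu
    (fun n => f \_ (D n)) f (fun x => `|f x|) _ mf.
- move=> n; have mD : measurable (D n) by exact: measurable_itv.
  by apply/(measurable_restrict _ mD measurableT); exact: measurable_funTS.
- apply/aeW => x; apply: cvg_near_cst; near=> n.
  rewrite patchE mem_set// /D/= in_itv/= -ler_norml.
  apply: (@le_trans _ _ n%:R); last by rewrite ler_nat.
  by near: n; exact: nbhs_infty_ger.
- exact: integrable_norm.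
- by move=> n x; rewrite patchE; case: ifP => // _; rewrite normr0.
have c2 : F n.+1%:R - F (- n.+1%:R) @[n --> \oo] --> (0 : R).
  rewrite -[X in _ --> X]subr0; apply: cvgB.
    by rewrite (cvg_shiftS (fun n => F n%:R)).
  by rewrite (cvg_shiftS (fun n => F (- n%:R))).
have c1 : \int[mu]_x ((f \_ (D n)) x) @[n --> \oo] --> (0 : R).
  by under eq_fun do rewrite ftc.
exact: (cvg_unique _ dct c1).
Unshelve. all: by end_near. Qed.

Section density.
Variable s : R.
Hypothesis s0 : s != 0.
Let p : R -> R := normal_pdf 0 s.
Let c := s ^+ 2.

Let c0 : 0 < c. Proof. by rewrite /c exprn_even_gt0. Qed.

Let pE x : p x = normal_peak s * expR (- (x ^+ 2 / (2 * c))).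
Proof.
by rewrite /p normal_pdfE//= /normal_fun subr0 -[s ^+ 2 *+ 2]mulr_natl mulNr.
Qed.

Let p_ge0 x : 0 <= p x. Proof. exact: normal_pdf_ge0. Qed.

Let integrable_p : mu.-integrable setT (EFin \o p).
Proof. exact: integrable_normal_pdf. Qed.

Let derive_affine (a t x : R) : is_derive x 1 (fun y : R => a + t * y) t.
Proof.
rewrite (_ : (fun y => _) = cst a + t *: @id R); last exact/funext.
apply: (is_derive_eq (is_deriveD (is_derive_cst a x 1) (is_deriveZ t (is_derive_id x 1)))).
rewrite add0r; exact: mulr1.
Qed.

Let derive_p (x : R) : is_derive x 1 p (- (x / c) * p x).
Proof.
have dq : is_derive x 1 (fun y : R => - (y ^+ 2 / (2 * c))) (- (x / c)).
  rewrite (_ : (fun y => _) = (- (2 * c)^-1) *: ((@id R) ^+ 2)); last first.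
    by apply/funext => y /=; rewrite mulrC -mulNr.
  apply: (is_derive_eq (is_deriveZ _ (is_deriveX 2 (is_derive_id x 1)))).
  rewrite /GRing.scale/= expr1 mulr1.
  by field; rewrite gt_eqF.
have de := is_derive1_comp (is_derive_expR _) dq.
have pf : p = normal_peak s \*: (expR \o (fun y : R => - (y ^+ 2 / (2 * c)))).
  by apply/funext => y; rewrite pE.
rewrite pE {}pf; apply: (is_derive_eq (is_deriveZ (normal_peak s) de)).
rewrite /GRing.scale/=; ring.
Qed.

Let continuous_p : continuous p. Proof. exact: continuous_normal_pdf. Qed.

(** As c p' = - x p, this is the primitive behind the integration by parts. *)
Let derive_psin (a t x : R) :
  is_derive x 1 (fun y : R => c * (p y * sin (a + t * y)))
    (- (x * p x * sin (a + t * x)) + c * t * (p x * cos (a + t * x))).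
Proof.
have ds := is_derive1_comp (is_derive_sin _) (derive_affine a t x).
have dp := derive_p x.
rewrite (_ : (fun y => _) = c *: (p * (@sin R \o (fun y : R => a + t * y)))); last exact/funext.
apply: (is_derive_eq (is_deriveZ c (is_deriveM dp ds))); rewrite /GRing.scale/=.
by field; rewrite gt_eqF.
Qed.

(** Up to a constant, p is the square of exp(- x^2 / (4 c)): one copy absorbs |x|, the other is a
    normal density of variance 2 c, whence [s']. *)
Let integrable_xp : mu.-integrable setT (EFin \o (fun x => `|x| * p x)).
Proof.
pose s' := Num.sqrt 2 * s; have s'0 : s' != 0 by rewrite mulf_neq0// gt_eqF// sqrtr_gt0.
have s'2 : s' ^+ 2 = 2 * c by rewrite exprMn sqr_sqrtr.
pose K := (c + 1) * normal_peak s / normal_peak s'.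
have iq := integrable_EFinZ K (integrable_normal_pdf 0 s').
have mp : measurable_fun setT p by exact: measurable_normal_pdf.
apply: (@le_integrable _ _ _ mu setT _ _ (EFin \o (fun x => K * normal_pdf 0 s' x))) => //.
  by apply/measurable_EFinP; apply: measurable_funM => //; exact: measurable_normr.
move=> x _ /=; rewrite lee_fin normrM normr_id (ger0_norm (p_ge0 x)).
rewrite (le_trans _ (ler_norm _))// pE normal_pdfE//= /normal_fun subr0.
rewrite -[s' ^+ 2 *+ 2]mulr_natl s'2 mulNr; set E := expR (- (_ / (2 * (2 * c)))).
have -> : K * (normal_peak s' * E) = normal_peak s * ((c + 1) * E).
  by rewrite /K; field; rewrite gt_eqF// normal_peak_gt0.
rewrite mulrCA ler_pM2l ?normal_peak_gt0// /E.
have xc : `|x| <= (c + 1) * expR (x ^+ 2 / (4 * c)).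
  apply: (@le_trans _ _ ((c + 1) * (1 + x ^+ 2 / (4 * c)))); last first.
    by rewrite ler_wpM2l ?expR_ge1Dx// addr_ge0// ltW.
  (* Completing the square gives |x| <= x^2 / (4 c) + c, whence the factor c + 1 in [K]. *)
  have : 0 <= (`|x| - 2 * c) ^+ 2 / (4 * c).
    by rewrite divr_ge0 ?sqr_ge0// mulr_ge0// ltW.
  have -> : (`|x| - 2 * c) ^+ 2 / (4 * c) = x ^+ 2 / (4 * c) - `|x| + c.
    by rewrite sqrrB -normrX ger0_norm ?sqr_ge0//; field; rewrite gt_eqF.
  have : 0 <= x ^+ 2 / (4 * c) by rewrite divr_ge0 ?sqr_ge0// mulr_ge0// ltW.
  set y := _ / _; move: c0; nra.
rewrite -ler_pdivlMr ?expR_gt0// -mulrA -expRN -expRD opprK.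
apply: (le_trans xc); rewrite ler_wpM2l ?ler_expR ?addr_ge0 ?(ltW c0)//.
by rewrite le_eqVlt; apply/orP; left; apply/eqP; field; rewrite gt_eqF.
Qed.

Let mp : measurable_fun setT p. Proof. exact: measurable_normal_pdf. Qed.

Let Cf a t := \int[mu]_x (cos (a + t * x) * p x).

Let integrable_trig (g : R -> R) : bounded_measurable g ->
  mu.-integrable setT (EFin \o (fun x => g x * p x)).
Proof.
move=> [mg [M gM]].
apply: (@le_integrable _ _ _ mu setT _ _ (EFin \o (fun x => M * p x))) => //.
- by apply/measurable_EFinP; exact: measurable_funM.
- move=> x _ /=; rewrite lee_fin !normrM ler_wpM2r//.
  by rewrite (le_trans (gM x))// ler_norm.
- exact: integrable_EFinZ.
Qed.

Let measurable_affine (a t : R) : measurable_fun setT (fun x : R => a + t * x).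
Proof. by apply: measurable_funD => //; exact: measurable_funM. Qed.

Let cvg_p (e : R) : e ^+ 2 = 1 -> p (e * n%:R) @[n --> \oo] --> (0 : R).
Proof.
move=> e1; apply/cvgrPdist_le => d d0; near=> n.
rewrite sub0r normrN ger0_norm// pE exprMn e1 mul1r.
have peak0 := normal_peak_gt0 s0.
rewrite expRN ler_pdivrMr ?expR_gt0// mulrC -ler_pdivrMr//.
apply: le_trans (expR_ge1Dx _); apply: (@le_trans _ _ (n%:R ^+ 2 / (2 * c))); last first.
  by rewrite lerDr.
have c20 : 0 < 2 * c by rewrite mulr_gt0.
rewrite ler_pdivlMr//; apply: (@le_trans _ _ (n%:R : R)).
  by near: n; exact: nbhs_infty_ger.
by rewrite expr2 ler_peMl// ler1n; near: n; exact: nbhs_infty_gt.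
Unshelve. all: by end_near. Qed.

Let cvg_psin (a t e : R) : e ^+ 2 = 1 ->
  c * (p (e * n%:R) * sin (a + t * (e * n%:R))) @[n --> \oo] --> (0 : R).
Proof.
move=> e1; apply/norm_cvg0P.
apply: (@squeeze_cvgr _ _ _ _ (cst 0) (fun n => c * p (e * n%:R))).
- apply: nearW => n; rewrite normr_ge0/= normrM (gtr0_norm c0) ler_pM2l//.
  by rewrite normrM (ger0_norm (p_ge0 _)) ler_piMr// sin_max.
- exact: cvg_cst.
- rewrite -[X in _ --> X](mulr0 c); apply: cvgM; first exact: cvg_cst.
  exact: cvg_p.
Qed.

Let int_xpsin a t : \int[mu]_x (- (x * p x * sin (a + t * x))) = - (c * t) * Cf a t.
Proof.
have i1 : mu.-integrable setT (EFin \o (fun x => - (x * p x * sin (a + t * x)))).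
  apply: (@le_integrable _ _ _ mu setT _ _ (EFin \o (fun x => `|x| * p x))) => //.
    apply/measurable_EFinP; apply: measurableT_comp => //.
    apply: measurable_funM; first exact: measurable_funM.
    by have [] := bounded_measurable_sin (measurable_affine a t).
  by move=> x _ /=; rewrite lee_fin normrN !normrM normr_id ler_piMr ?sin_max.
have i2 : mu.-integrable setT (EFin \o (fun x => p x * cos (a + t * x))).
  under eq_fun do rewrite mulrC; apply: integrable_trig.
  exact: bounded_measurable_cos.
have i3 := integrable_EFinZ (c * t) i2.
have : \int[mu]_x (- (x * p x * sin (a + t * x)) + c * t * (p x * cos (a + t * x))) = 0.
  apply: (@Rintegral_derive_eq0 (fun x => c * (p x * sin (a + t * x)))).
  - exact: derive_psin.
  - have caff (x : R) : a + t * y @[y --> x] --> a + t * x.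
      by apply: cvgD; [exact: cvg_cst|apply: cvgM; [exact: cvg_cst|exact: cvg_id]].
    move=> x; apply: cvgD.
      apply: cvgN; apply: cvgM.
        by apply: cvgM; [exact: cvg_id|exact: continuous_p].
      by apply: continuous_cvg; [exact: continuous_sin|exact: caff].
    apply: cvgM; first exact: cvg_cst; apply: cvgM; first exact: continuous_p.
    by apply: continuous_cvg; [exact: continuous_cos|exact: caff].
  - have := integrableD measurableT i1 i3; apply: eq_integrable => //.
  - have := @cvg_psin a t 1; rewrite expr1n => /(_ erefl).
    by under eq_fun do rewrite !mul1r.
  - have := @cvg_psin a t (-1); rewrite sqrrN expr1n => /(_ erefl).
    by under eq_fun do rewrite !mulN1r.
rewrite RintegralD// RintegralZl// => /eqP; rewrite addr_eq0 => /eqP ->.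
by rewrite mulNr /Cf; congr (- (_ * _)); apply: eq_Rintegral => x _; rewrite mulrC.
Qed.

(** Differentiation under the integral brings down a factor x, which the integration by parts in
    [int_xpsin] trades for c t. The result is a linear differential equation in t with the phase a
    as a parameter. *)
Let derive_Cf (a t : R) : is_derive t 1 (Cf a) (- (c * t) * Cf a t).
Proof.
have dcos (x u : R) : is_derive u 1 (fun t => cos (a + t * x) * p x)
    (- (x * p x * sin (a + u * x))).
  have da := derive_affine a x u.
  have dc := is_derive1_comp (is_derive_cos _) da.
  rewrite (_ : (fun t => _) = p x \*: (@cos R \o (fun y : R => a + x * y))); last first.
    by apply/funext => y /=; rewrite mulrC (mulrC x).
  apply: (is_derive_eq (is_deriveZ (p x) dc)).
  by rewrite /GRing.scale/= (mulrC x u); ring.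
have I1 : `]t - 1, t + 1[%classic t by rewrite /= in_itv/= gtrBl ltrDl ltr01.
have H1 (u : R) : `]t - 1, t + 1[%classic u ->
    mu.-integrable setT (EFin \o (fun x => cos (a + u * x) * p x)).
  move=> _; under eq_fun do rewrite (mulrC u).
  by apply: integrable_trig; apply: bounded_measurable_cos; apply: measurable_funD => //; exact: measurable_funM.
have d1E u x : partial1of2 (fun u x => cos (a + u * x) * p x) u x =
    - (x * p x * sin (a + u * x)).
  by rewrite partial1of2E; have [] := dcos x u.
have H2 (u x : R) : `]t - 1, t + 1[%classic u -> [set: R] x ->
    derivable (fun u : R => cos (a + u * x) * p x) u 1.
  by move=> _ _; have [] := dcos x u.
have H3 (x : R) : 0 <= `|x| * p x by rewrite mulr_ge0.
have H4 (u x : R) : `]t - 1, t + 1[%classic u -> [set: R] x ->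
    `|partial1of2 (fun u x => cos (a + u * x) * p x) u x| <= `|x| * p x.
  move=> _ _; rewrite d1E normrN !normrM (ger0_norm (p_ge0 x)).
  by rewrite ler_piMr ?sin_max// mulr_ge0.
apply: DeriveDef.
  exact: (derivable_under_integral measurableT I1 H1 H2 H3 integrable_xp H4).
rewrite -derive1E.
rewrite (differentiation_under_integral measurableT I1 H1 H2 H3 integrable_xp H4).
by under eq_Rintegral do rewrite d1E; rewrite int_xpsin.
Qed.

Lemma Rintegral_normal_pdf_cos (a t : R) :
  \int[mu]_x (cos (a + t * x) * p x) = expR (- (t ^+ 2 * s ^+ 2 / 2)) * cos a.
Proof.
(* Integrating factor: [D] is constant, and its value at 0 is cos a. *)
pose D u := expR (c * u ^+ 2 / 2) * Cf a u.
have dD (u : R) : is_derive u 1 D 0.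
  have dq : is_derive u 1 (fun y : R => c * y ^+ 2 / 2) (c * u).
    rewrite (_ : (fun y => _) = (c / 2) \*: ((@id R) ^+ 2)); last first.
      by apply/funext => y /=; rewrite mulrAC.
    apply: (is_derive_eq (is_deriveZ _ (is_deriveX 2 (is_derive_id u 1)))).
    by rewrite /GRing.scale/= expr1 mulr1; field.
  have de := is_derive1_comp (is_derive_expR _) dq.
  apply: (is_derive_eq (is_deriveM de (derive_Cf a u))).
  by rewrite /GRing.scale/=; ring.
have : D t = D 0 by exact: is_derive_0_is_cst.
rewrite /D expr0n mulr0 mul0r expR0 mul1r => /(congr1 (fun x => expR (- (c * t ^+ 2 / 2)) * x)).
rewrite mulrA -expRD addNr expR0 mul1r -[in X in _ -> X]/(Cf a t) => ->; rewrite (mulrC c); congr (_ * _).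
rewrite /Cf; under eq_Rintegral do rewrite mul0r addr0.
by rewrite RintegralZl// /Rintegral integral_normal_pdf mulr1.
Qed.

End density.

Lemma normal_characteristic (s a t : R) : s != 0 ->
  \int[normal_prob 0 s]_x (cos (a + t * x)) = expR (- (t ^+ 2 * s ^+ 2 / 2)) * cos a.
Proof.
move=> s0; rewrite -Rintegral_normal_pdf_cos//.
apply: (@Rintegral_density _ _ _ mu) => //.
- by move=> x; exact: normal_pdf_ge0.
- exact: integrable_normal_pdf.
- by apply: bounded_measurable_cos; apply: measurable_funD.
Qed.

End normal_characteristic.

(** * Taylor bounds, uniqueness and moments *)

Section taylor_bounds.
Context {R : realType}.

(** The bounds below climb one degree at a time: the derivative of each difference is the previous
    difference, and each vanishes at 0. *)
Lemma ge0_of_derive_ge0 (F f : R -> R) : (forall x : R, is_derive x 1 F (f x)) ->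
  (forall x : R, 0 <= x -> 0 <= f x) -> 0 <= F 0 ->
  forall x : R, 0 <= x -> 0 <= F x.
Proof.
move=> dF f0 F0 x; rewrite le_eqVlt => /predU1P[<-//|x0].
have cF : {within `[0, x], continuous F}.
  by apply: derivable_within_continuous => y _; have [] := dF y.
have [c] := MVT x0 (fun y _ => dF y) cF.
rewrite in_itv/= => /andP[c0 _] FE.
rewrite -(subrK (F 0) (F x)) FE subr0 addr_ge0// mulr_ge0// ?(ltW x0)//.
by rewrite f0// ltW.
Qed.

Lemma sin_le_id (x : R) : 0 <= x -> sin x <= x.
Proof.
move=> x0; rewrite -subr_ge0.
apply: (@ge0_of_derive_ge0 (fun x => x - sin x) (fun x => 1 - cos x)) => //.
by rewrite sin0 subr0.
Qed.

Lemma one_minus_cos_le_nneg (x : R) : 0 <= x -> 1 - cos x <= x ^+ 2 / 2.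
Proof.
move=> x0; rewrite -subr_ge0.
apply: (@ge0_of_derive_ge0 (fun x => x ^+ 2 / 2 - (1 - cos x)) (fun x => x - sin x)) => //.
- move=> y.
  rewrite (_ : (fun x => _) = 2^-1 \*: ((@id R) ^+ 2) - (cst 1 - @cos R)); last first.
    by apply/funext => z /=; rewrite mulrC.
  apply: is_derive_eq; rewrite /GRing.scale/= expr1 mulr1; by field.
- by move=> y y0; rewrite subr_ge0 sin_le_id.
- by rewrite cos0 subrr subr0 expr0n mul0r.
Qed.

Lemma sin_ge_cubic_nneg (x : R) : 0 <= x -> x - sin x <= x ^+ 3 / 6.
Proof.
move=> x0; rewrite -subr_ge0.
apply: (@ge0_of_derive_ge0 (fun x => x ^+ 3 / 6 - (x - sin x)) (fun x => x ^+ 2 / 2 - (1 - cos x))) => //.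
- move=> y.
  rewrite (_ : (fun x => _) = 6^-1 \*: ((@id R) ^+ 3) - (@id R - @sin R)); last first.
    by apply/funext => z /=; rewrite mulrC.
  apply: is_derive_eq; rewrite /GRing.scale/= mulr1; by field.
- by move=> y y0; rewrite subr_ge0 one_minus_cos_le_nneg.
- by rewrite sin0 !subr0 expr0n mul0r.
Qed.

Lemma one_minus_cos_ge_nneg (x : R) : 0 <= x -> x ^+ 2 / 2 - (1 - cos x) <= x ^+ 4 / 24.
Proof.
move=> x0; rewrite -subr_ge0.
apply: (@ge0_of_derive_ge0 (fun x => x ^+ 4 / 24 - (x ^+ 2 / 2 - (1 - cos x)))
   (fun x => x ^+ 3 / 6 - (x - sin x))) => //.
- move=> y.
  rewrite (_ : (fun x => _) = 24^-1 \*: ((@id R) ^+ 4) - (2^-1 \*: ((@id R) ^+ 2) - (cst 1 - @cos R))); last first.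
    by apply/funext => z /=; rewrite mulrC (mulrC (z ^+ 2)).
  apply: is_derive_eq; rewrite /GRing.scale/= mulr1 expr1; by field.
- by move=> y y0; rewrite subr_ge0 sin_ge_cubic_nneg.
- by rewrite cos0 subrr subr0 !expr0n !mul0r subrr.
Qed.

Lemma one_minus_cos_ge0 (x : R) : 0 <= 1 - cos x.
Proof. by rewrite subr_ge0 cos_le1. Qed.

Lemma one_minus_cos_le (x : R) : 1 - cos x <= x ^+ 2 / 2.
Proof.
by rewrite -cos_norm -(real_normK (num_real x)) one_minus_cos_le_nneg.
Qed.

Lemma one_minus_cos_approx (x : R) : `|x ^+ 2 / 2 - (1 - cos x)| <= x ^+ 4 / 24.
Proof.
rewrite ger0_norm; last by rewrite subr_ge0 one_minus_cos_le.
have := @one_minus_cos_ge_nneg `|x| (normr_ge0 x).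
by rewrite cos_norm (real_normK (num_real x)) -normrX ger0_norm// exprn_even_ge0.
Qed.

Lemma sin_approx3 (x : R) : `|sin x - x| <= `|x| ^+ 3 / 6.
Proof.
wlog x0 : x / 0 <= x => [H|].
  have [/H//|/ltW x0] := leP 0 x.
  by have := H (- x); rewrite oppr_ge0 sinN -opprD !normrN; apply.
rewrite distrC ger0_norm; last by rewrite subr_ge0 sin_le_id.
by rewrite ger0_norm// sin_ge_cubic_nneg.
Qed.

(** The cubic bound would ask for third moments of the amplitudes; a quadratic one only uses second
    moments. Up to 6 it follows from the cubic bound, beyond 6 from sin x >= -1. *)
Lemma sin_approx2 (x : R) : `|sin x - x| <= x ^+ 2.
Proof.
wlog x0 : x / 0 <= x => [H|].
  have [/H//|/ltW x0] := leP 0 x.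
  by have := H (- x); rewrite oppr_ge0 sinN -opprD normrN sqrrN; apply.
rewrite distrC ger0_norm; last by rewrite subr_ge0 sin_le_id.
have [x6|x6] := leP x 6.
  rewrite (le_trans (sin_ge_cubic_nneg x0))// ler_pdivrMr// exprSr.
  by rewrite ler_wpM2l// sqr_ge0.
have := sin_geN1 x; nra.
Qed.

Lemma normr_sin_le (x : R) : `|sin x| <= `|x|.
Proof.
wlog x0 : x / 0 <= x => [H|].
  have [/H//|/ltW x0] := leP 0 x.
  by have := H (- x); rewrite oppr_ge0 sinN !normrN; apply.
rewrite (ger0_norm x0) ler_norml sin_le_id// andbT.
have [x1|x1] := leP x 1; last by rewrite (le_trans _ (sin_geN1 _))// lerN2 ltW.
have : 0 <= sin x.
  apply: sin_ge0_pi; rewrite x0/= (le_trans x1)// (le_trans _ (pi_ge2 _))//.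
  by rewrite ler1n.
by apply: le_trans; rewrite oppr_le0.
Qed.

Lemma cos_lipschitz (x y : R) : `|cos x - cos y| <= `|x - y|.
Proof.
(* In terms of the half-sum u and the half-difference v, the difference of the cosines is - 2 sin u
   sin v. *)
suff H (u v : R) : `|cos (u + v) - cos (u - v)| <= `|(u + v) - (u - v)|.
  have := H ((x + y) / 2) ((x - y) / 2).
  have -> : (x + y) / 2 + (x - y) / 2 = x by field.
  by have -> : (x + y) / 2 - (x - y) / 2 = y by field.
rewrite cosD cosB.
have -> : cos u * cos v - sin u * sin v - (cos u * cos v + sin u * sin v) =
  - (2 * (sin u * sin v)) by ring.
have -> : u + v - (u - v) = 2 * v by ring.
rewrite normrN !normrM (ger0_norm (_ : 0 <= 2))// ler_pM2l//.
by rewrite (le_trans _ (normr_sin_le v))// ler_piMl// sin_max.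
Qed.

Lemma expRN_le_quadratic (x : R) : 0 <= x -> expR (- x) <= 1 - x + x ^+ 2 / 2.
Proof.
move=> x0; rewrite -subr_ge0.
have de (y : R) : is_derive y 1 (fun y => expR (- y)) (- expR (- y)).
  have dn : is_derive y 1 (fun y : R => - y) (- 1) by exact: is_deriveNid.
  by have := is_derive1_comp (is_derive_expR _) dn; rewrite mulrN1.
apply: (@ge0_of_derive_ge0 (fun x => (1 - x + x ^+ 2 / 2) - expR (- x))
   (fun x => expR (- x) - 1 + x)) => //.
- move=> y.
  rewrite (_ : (fun x => _) = (cst 1 - @id R + 2^-1 \*: ((@id R) ^+ 2)) -
      (fun y => expR (- y))); last first.
    by apply/funext => z /=; rewrite (mulrC (z ^+ 2)).
  apply: (is_derive_eq (is_deriveB (is_deriveD (is_deriveB (is_derive_cst _ y 1) (is_derive_id y 1)) (is_deriveZ 2^-1 (is_deriveX 2 (is_derive_id y 1)))) (de y))).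
  rewrite /GRing.scale/= mulr1 expr1; by field.
by move=> y _; have := expR_ge1Dx (- y); lra.
Qed.

End taylor_bounds.

Section law.
Context d d' (T : measurableType d) (T' : measurableType d') (R : realType).
Variables (P : probability T R) (X : T -> T').
Hypothesis mX : measurable_fun setT X.

Definition law : probability T' R :=
  distribution P (mfun_Sub (mem_set mX) : {mfun T >-> T'}).

Lemma lawE A : law A = P (X @^-1` A).
Proof. by []. Qed.

Lemma bounded_measurable_comp (f : T' -> R) : bounded_measurable f ->
  bounded_measurable (fun w => f (X w)).
Proof.
by move=> [mf [M fM]]; split; [exact: measurableT_comp|exists M => w].
Qed.

Lemma Rintegral_law (f : T' -> R) : bounded_measurable f ->
  \int[law]_x (f x) = \int[P]_w (f (X w)).
Proof.
move=> bf; congr fine; rewrite integral_distribution//.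
  by apply/measurable_EFinP; have [] := bf.
exact: bounded_measurable_integrable (bounded_measurable_comp bf).
Qed.

End law.

Section uniqueness.
Context {R : realType}.

Lemma tight_probability m (nu : probability 'rV[R]_m R) (e : R) : 0 < e ->
  exists2 K : R, 0 < K & (nu (~` cube K) <= e%:E)%E.
Proof.
move=> e0.
have : nu (~` cube n.+1%:R) @[n --> \oo] --> nu (\bigcap_n ~` cube n.+1%:R).
  apply: nonincreasing_cvg_mu.
  - exact: (le_lt_trans (probability_le1 nu (measurableC (measurable_cube _))) (ltry _)).
  - by move=> n; apply: measurableC; exact: measurable_cube.
  - by apply: bigcapT_measurable => n; apply: measurableC; exact: measurable_cube.
  - move=> k l kl; apply/subsetPset; apply: subsetC => x xk i.
    by rewrite (le_trans (xk i))// ler_nat ltnS.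
rewrite (_ : \bigcap_n _ = set0) ?measure0; last first.
  apply/seteqP; split => // x xn.
  pose K := \sum_(j < m) `|x ord0 j|.
  apply: (xn (Num.truncn K) I) => i.
  apply: (@le_trans _ _ K); last exact/ltW/truncnS_gt.
  by rewrite /K (bigD1 i)//= lerDl sumr_ge0.
move=> /fine_cvgP[_ /cvgrPdist_le/(_ _ e0)[n _ /(_ n (leqnn n))]] /=.
rewrite sub0r normrN => h; exists n.+1%:R => //.
rewrite -[leLHS]fineK ?fin_num_measure//; last first.
  by apply: measurableC; exact: measurable_cube.
by rewrite lee_fin (le_trans _ h)// ler_norm.
Qed.

(** The continuity theorem for a constant sequence, in dimension one, identifies the integrals of
    bounded continuous functions; ramps then give the half-lines, which generate the
    sigma-algebra. *)
Lemma eq_law_of_characteristic (nu1 nu2 : probability R R) :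
  (forall a t : R, \int[nu1]_x (cos (a + t * x)) = \int[nu2]_x (cos (a + t * x))) ->
  forall A, measurable A -> nu1 A = nu2 A.
Proof.
move=> h.
pose X (x : R) : 'rV[R]_1 := const_mx x.
have mX : measurable_fun setT X.
  apply: measurable_fun_coordP => i; rewrite /X.
  by under eq_fun do rewrite mxE; exact: measurable_id.
have bc a t : bounded_measurable (fun x : 'rV[R]_1 => cos (a + dot t x)).
  apply: bounded_measurable_cos; apply: measurable_funD => //.
  exact: measurable_dot.
have eqf (f : R -> R) : continuous f -> (exists M : R, forall x, `|f x| <= M) ->
    \int[nu1]_x (f x) = \int[nu2]_x (f x).
  move=> cf [M fM].
  have cf' : continuous (fun x : 'rV[R]_1 => f (x ord0 ord0)).
    suff H (x : 'rV[R]_1) : f (x' ord0 ord0) @[x' --> x] --> f (x ord0 ord0).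
      by move=> x; exact: H.
    have c1 : x' ord0 ord0 @[x' --> x] --> x ord0 ord0 by exact: coord_continuous.
    exact: (continuous_cvg _ (cf _) c1).
  have bf' := continuous_bounded_measurable cf' (fun x => fM (x ord0 ord0)).
  have key : \int[law nu1 mX]_x (f (x ord0 ord0)) @[n --> \oo] -->
      \int[law nu2 mX]_x (f (x ord0 ord0)).
    apply: (@cvg_of_characteristic _ _ nat \oo _ (fun=> law nu1 mX)) => //.
    - move=> a t; rewrite !Rintegral_law//.
      have E (nu : probability R R) : \int[nu]_w (cos (a + dot t (X w))) =
          \int[nu]_w (cos (a + t ord0 * w)).
        by apply: eq_Rintegral => w _; rewrite /dot big_ord1 mxE.
      by rewrite !E h; exact: cvg_cst.
    - move=> e e0; have [K1 K10 e1] := tight_probability (law nu1 mX) e0.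
      have [K2 K20 e2] := tight_probability (law nu2 mX) e0.
      exists (Num.max K1 K2); first by rewrite lt_max K10.
      split; first apply: nearW => _.
        apply: le_trans e1; apply: le_measure; rewrite ?inE.
        + by apply: measurableC; exact: measurable_cube.
        + by apply: measurableC; exact: measurable_cube.
        + by apply: subsetC => x xK i; rewrite (le_trans (xK i))// le_max lexx.
      apply: le_trans e2; apply: le_measure; rewrite ?inE.
      + by apply: measurableC; exact: measurable_cube.
      + by apply: measurableC; exact: measurable_cube.
      + by apply: subsetC => x xK i; rewrite (le_trans (xK i))// le_max lexx orbT.
    - by exists M => x.
  have E (nu : probability R R) : \int[law nu mX]_x (f (x ord0 ord0)) =
      \int[nu]_w (f w).
    by rewrite Rintegral_law//; apply: eq_Rintegral => w _; rewrite mxE.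
  by move: key; rewrite !E => key; apply: (cvg_unique _ (cvg_cst _) key).
apply: (@measure_unique _ R _ (@RGenOInfty.G R) (fun k => `]- k%:R, +oo[%classic)) => //.
- exact: RGenOInfty.measurableE.
- move=> _ _ [x ->] [y ->]; exists (Num.max x y).
  by apply/seteqP; split => z /=; rewrite !in_itv/= !andbT gt_max; [case=> -> ->|move/andP].
- by move=> k; exists (- k%:R).
- apply/seteqP; split => // x _; exists (Num.truncn `|x|).+1 => //=.
  rewrite in_itv/= andbT ltrNl; apply: le_lt_trans (truncnS_gt _).
  by rewrite -normrN ler_norm.
- move=> _ [a ->].
  (* Continuous ramps tending to the indicator of ]a, +oo[: for n > 0, zero up to a and one from a +
     1 / n on. *)
  pose f (n : nat) (x : R) : R := Num.max 0 (Num.min 1 (n%:R * (x - a))).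
  have f01 n x : 0 <= f n x <= 1 by rewrite /f le_max lexx/= ge_max ler01/= ge_min lexx.
  have cf n : continuous (f n).
    have ci : continuous (fun x : R => n%:R * (x - a)).
      move=> x; apply: cvgM; first exact: cvg_cst.
      by apply: cvgB; [exact: cvg_id|exact: cvg_cst].
    move=> x; have c0 : {for x, continuous (fun=> 0 : R^o)} by exact: cvg_cst.
    have c1 : {for x, continuous (fun=> 1 : R^o)} by exact: cvg_cst.
    exact: (continuous_max c0 (continuous_min c1 (ci x))).
  have fb n : exists M : R, forall x, `|f n x| <= M.
    by exists 1 => x; have /andP[? ?] := f01 n x; rewrite ger0_norm.
  have mI : measurable (`]a, +oo[%classic : set R) by exact: measurable_itv.
  have fI x : f n x @[n --> \oo] --> (\1_(`]a, +oo[%classic : set R) x : R).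
    rewrite indicE; have [ax|ax] := ltP a x.
      rewrite mem_set/= ?in_itv/= ?ax//; apply: cvg_near_cst; near=> n.
      rewrite /f min_l ?max_r//.
      rewrite -ler_pdivrMr ?subr_gt0// mul1r; near: n; exact: nbhs_infty_ger.
    rewrite memNset/= ?in_itv/= ?andbT; last by apply/negP; rewrite -leNgt.
    apply: cvg_near_cst; apply: nearW => n; rewrite /f max_l// ge_min.
    by apply/orP; right; rewrite mulr_ge0_le0// subr_le0.
  have lim (nu : probability R R) : \int[nu]_x (f n x) @[n --> \oo] -->
      fine (nu `]a, +oo[%classic).
    rewrite -Rintegral_indic//.
    apply: (@dominated_convergence_Rintegral _ _ _ nu f _ (cst 1) _ _ _ _ _).2.
    - by move=> n; exact: continuous_measurable_fun.
    - exact: measurable_indic.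
    - exact: aeW.
    - exact: bounded_measurable_integrable (bounded_measurable_cst _ _).
    - by move=> n x; have /andP[? ?] := f01 n x; rewrite ger0_norm.
  have l1 := lim nu1; have l2 := lim nu2.
  have e12 : fine (nu1 `]a, +oo[%classic) = fine (nu2 `]a, +oo[%classic).
    apply: (cvg_unique _ _ l2) => //; move: l1; under eq_fun do rewrite eqf//.
    exact.
  have := f_equal EFin e12; rewrite !fineK ?fin_num_measure//.
- by move=> k; exact: (le_lt_trans (probability_le1 nu1 (measurable_itv _)) (ltry _)).
Unshelve. all: by end_near. Qed.

End uniqueness.

Section moments_of_characteristic.
Context d (T : measurableType d) (R : realType) (P : probability T R).
Variables (Y : T -> R) (v : R).
Hypothesis mY : measurable_fun setT Y.
Hypothesis v0 : 0 <= v.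

(** A bounded stand-in for Y^2: it stays below Y^2, tends to it, and its mean is read off the
    characteristic function at 1 / (n + 1). *)
Let q (n : nat) (w : T) : R := 2 * n.+1%:R ^+ 2 * (1 - cos (Y w / n.+1%:R)).

Let bq n : bounded_measurable (q n).
Proof.
apply: bounded_measurableZ; apply: bounded_measurableB; first exact: bounded_measurable_cst.
by apply: bounded_measurable_cos; exact: measurable_funM.
Qed.

Let q_ge0 n w : 0 <= q n w.
Proof. by rewrite !mulr_ge0 ?sqr_ge0// one_minus_cos_ge0. Qed.

Let q_le n w : q n w <= Y w ^+ 2.
Proof.
rewrite /q mulrAC -ler_pdivlMr ?exprn_gt0// -expr_div_n.
move: (Y w / n.+1%:R) => u; have := one_minus_cos_le u; lra.
Qed.

Let cvg_q w : q n w @[n --> \oo] --> Y w ^+ 2.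
Proof.
apply/cvgrPdist_le => e e0; near=> n.
have N0 : 0 < n.+1%:R :> R by [].
have nN : Y w ^+ 4 / e <= n.+1%:R ^+ 2.
  apply: (@le_trans _ _ (n%:R : R)); first by near: n; exact: nbhs_infty_ger.
  by rewrite -natrX ler_nat (@leq_trans n.+1)// expnS expn1 leq_pmull.
rewrite /q; move: (n.+1%:R : R) N0 nN => N N0 nN.
have NN0 : 0 < N ^+ 2 by rewrite exprn_gt0.
have := one_minus_cos_approx (Y w / N); set u := 1 - cos _ => h.
have -> : Y w ^+ 2 - 2 * N ^+ 2 * u = 2 * N ^+ 2 * ((Y w / N) ^+ 2 / 2 - u).
  by field; rewrite gt_eqF.
rewrite normrM (ger0_norm (mulr_ge0 _ (ltW NN0)))//.
apply: (@le_trans _ _ (2 * N ^+ 2 * ((Y w / N) ^+ 4 / 24))).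
  by rewrite ler_wpM2l// mulr_ge0// ltW.
have -> : 2 * N ^+ 2 * ((Y w / N) ^+ 4 / 24) = Y w ^+ 4 / 12 / N ^+ 2.
  by field; rewrite gt_eqF.
rewrite ler_pdivrMr//; apply: (@le_trans _ _ (Y w ^+ 4)).
  by rewrite ler_pdivrMr// ler_peMr ?ler1n// exprn_even_ge0.
by rewrite mulrC -ler_pdivrMr.
Unshelve. all: by end_near. Qed.

Let int_q n : \int[P]_w (q n w) = 2 * n.+1%:R ^+ 2 * (1 - \int[P]_w (cos (Y w / n.+1%:R))).
Proof.
have bc : bounded_measurable (fun w => cos (Y w / n.+1%:R)).
  by apply: bounded_measurable_cos; exact: measurable_funM.
rewrite bounded_RintegralZ; last first.
  by apply: bounded_measurableB => //; exact: bounded_measurable_cst.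
by rewrite bounded_RintegralB ?Rintegral_probability_cst//; exact: bounded_measurable_cst.
Qed.

(** Fatou's lemma for the bounded functions [q n], so no moment of [Y] is presupposed. *)
Lemma second_moment_le_of_characteristic :
  (forall e : R, 0 < e -> \forall n \near \oo,
     2 * n.+1%:R ^+ 2 * (1 - \int[P]_w (cos (Y w / n.+1%:R))) <= v + e) ->
  (\int[P]_w (Y w ^+ 2)%:E <= v%:E)%E.
Proof.
move=> hv; apply/lee_addgt0Pr => e e0.
have -> : (\int[P]_w (Y w ^+ 2)%:E = \int[P]_w limn_einf (fun n => (q n w)%:E))%E.
  apply: eq_integral => w _; apply/esym.
  have c : (q n w)%:E @[n --> \oo] --> (Y w ^+ 2)%:E.
    by apply: cvg_EFin; [exact: nearW|exact: cvg_q].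
  by have [] := cvg_limn_einf_sup c.
have mq n : measurable_fun setT (fun w => (q n w)%:E).
  by apply/measurable_EFinP; have [] := bq n.
apply: (le_trans (fatou _ measurableT mq _)); first by move=> n w _; rewrite lee_fin.
rewrite limn_einf_lim; apply: lime_le; first exact: is_cvg_einfs.
apply: filterS (hv e e0) => n hn.
apply: (@le_trans _ _ (\int[P]_w (q n w)%:E)%E).
  by apply: ereal_inf_lbound; exists n => //=.
by rewrite EFin_bounded_Rintegral// int_q -EFinD lee_fin.
Qed.

Lemma moments_of_normal_characteristic :
  (forall a t : R, \int[P]_w (cos (a + t * Y w)) = expR (- (t ^+ 2 * v / 2)) * cos a) ->
  [/\ P.-integrable setT (EFin \o (fun w => Y w ^+ 2)),
      P.-integrable setT (EFin \o Y),
      \int[P]_w (Y w ^+ 2) = v & \int[P]_w (Y w) = 0].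
Proof.
move=> charY.
have charq n : \int[P]_w (q n w) =
    2 * n.+1%:R ^+ 2 * (1 - expR (- (v / (2 * n.+1%:R ^+ 2)))).
  rewrite int_q; congr (_ * (1 - _)).
  have := charY 0 (n.+1%:R^-1); rewrite cos0 mulr1 => E.
  transitivity (\int[P]_w (cos (0 + n.+1%:R^-1 * Y w))).
    by apply: eq_Rintegral => w _; rewrite add0r mulrC.
  rewrite E; congr (expR (- _)); move: (n.+1%:R : R) (ltr0Sn R n) => N N0.
  by field; rewrite gt_eqF.
have cvg_v : \int[P]_w (q n w) @[n --> \oo] --> v.
  apply/cvgrPdist_le => e e0; near=> n; rewrite charq.
  have N0 : 0 < n.+1%:R :> R by [].
  have nN : v ^+ 2 / e <= n.+1%:R ^+ 2.
    apply: (@le_trans _ _ (n%:R : R)); first by near: n; exact: nbhs_infty_ger.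
    by rewrite -natrX ler_nat (@leq_trans n.+1)// expnS expn1 leq_pmull.
  move: (n.+1%:R : R) N0 nN => N N0 nN.
  have NN0 : 0 < N ^+ 2 by rewrite exprn_gt0.
  set x := v / (2 * N ^+ 2).
  have x0 : 0 <= x by rewrite divr_ge0// mulr_ge0// ltW.
  have vE : v = 2 * N ^+ 2 * x by rewrite /x; field; rewrite gt_eqF.
  have h1 := expR_ge1Dx (- x); have h2 := expRN_le_quadratic x0.
  rewrite {1}vE -mulrBr normrM (ger0_norm (mulr_ge0 _ (ltW NN0)))//.
  apply: (@le_trans _ _ (2 * N ^+ 2 * (x ^+ 2 / 2))).
    apply: ler_wpM2l; first by rewrite mulr_ge0// ltW.
    rewrite ger0_norm; lra.
  have -> : 2 * N ^+ 2 * (x ^+ 2 / 2) = v ^+ 2 / 4 / N ^+ 2.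
    by rewrite /x; field; rewrite gt_eqF.
  rewrite ler_pdivrMr//; apply: (@le_trans _ _ (v ^+ 2)).
    by rewrite ler_pdivrMr// ler_peMr ?ler1n// sqr_ge0.
  by rewrite mulrC -ler_pdivrMr.
have mY2 : measurable_fun setT (fun w => Y w ^+ 2) by exact: measurable_funX.
have iY2 : P.-integrable setT (EFin \o (fun w => Y w ^+ 2)).
  apply/integrableP; split; first exact/measurable_EFinP.
  under eq_integral do rewrite /= ger0_norm ?sqr_ge0//.
  apply: (le_lt_trans (second_moment_le_of_characteristic _) (ltry _)) => e e0.
  have /cvgrPdist_le/(_ _ e0) := cvg_v; apply: filterS => n.
  by rewrite int_q distrC ler_distl => /andP[].
have iY : P.-integrable setT (EFin \o Y).
  have i1 : P.-integrable setT (EFin \o (fun w => 1 + Y w ^+ 2)).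
    have ic : P.-integrable setT (EFin \o cst 1).
      exact: bounded_measurable_integrable (bounded_measurable_cst _ _).
    by have := integrableD measurableT ic iY2; apply: eq_integrable.
  apply: (le_integrable measurableT _ _ i1); first exact/measurable_EFinP.
  move=> w _ /=; rewrite lee_fin (le_trans _ (ler_norm _))//.
  have := sqr_ge0 (`|Y w| - 1); rewrite sqrrB real_normK ?num_real//.
  have := sqr_ge0 (Y w); rewrite expr1n mulr1; lra.
split => //.
  apply: (cvg_unique _ _ cvg_v) => //.
  apply: (dominated_convergence_Rintegral _ mY2 _ iY2 _).2.
  - by move=> n; have [] := bq n.
  - by apply/aeW => w; exact: cvg_q.
  - by move=> n w; rewrite ger0_norm.
(* First-moment analogue of [q]: bounded, dominated by |Y| and tending to Y. The phase - pi / 2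
   turns the cosine into a sine, and cos(- pi / 2) = 0 makes its mean vanish. *)
pose r (n : nat) w : R := n.+1%:R * sin (Y w / n.+1%:R).
have r0 n : \int[P]_w (r n w) = 0.
  rewrite bounded_RintegralZ; last first.
    by apply: bounded_measurable_sin; exact: measurable_funM.
  rewrite (_ : \int[P]_w _ = 0) ?mulr0//.
  have := charY (- (pi / 2)) n.+1%:R^-1; rewrite cosN cos_pihalf mulr0 => <-.
  by apply: eq_Rintegral => w _; rewrite addrC cosBpihalf mulrC.
have c0 : \int[P]_w (r n w) @[n --> \oo] --> (0 : R).
  by under eq_fun do rewrite r0; exact: cvg_cst.
apply: (cvg_unique _ _ c0) => //.
have inY : P.-integrable setT (EFin \o (fun w => `|Y w|)) by exact: integrable_norm.
apply: (dominated_convergence_Rintegral _ mY _ inY _).2.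
- move=> n; apply: measurable_funM => //.
  by have [] := bounded_measurable_sin (_ : measurable_fun setT (fun w => Y w / n.+1%:R)); first exact: measurable_funM.
- apply/aeW => w; apply/cvgrPdist_le => e e0; near=> n.
  have N0 : 0 < n.+1%:R :> R by [].
  have nN : Y w ^+ 2 / e <= n.+1%:R.
    apply: (@le_trans _ _ (n%:R : R)); first by near: n; exact: nbhs_infty_ger.
    by rewrite ler_nat.
  rewrite /r; move: (n.+1%:R : R) N0 nN => N N0 nN.
  have := sin_approx2 (Y w / N) => h.
  have -> : Y w - N * sin (Y w / N) = N * (Y w / N - sin (Y w / N)).
    by field; rewrite gt_eqF.
  rewrite normrM (gtr0_norm N0) distrC.
  apply: (le_trans (ler_wpM2l (ltW N0) h)).
  have -> : N * (Y w / N) ^+ 2 = Y w ^+ 2 / N by field; rewrite gt_eqF.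
  by rewrite ler_pdivrMr// mulrC -ler_pdivrMr.
- move=> n w; rewrite normrM gtr0_norm// -ler_pdivlMl// mulrC.
  by rewrite (le_trans (normr_sin_le _))// normrM (ger0_norm (_ : 0 <= n.+1%:R^-1)) ?invr_ge0.
Unshelve. all: by end_near. Qed.

End moments_of_characteristic.

(** * Lebesgue measure on R^n *)

Lemma ge0_integral_preserving d (T : measurableType d) (R : realType)
    (mu : {measure set T -> \bar R}) (phi : T -> T) (f : T -> \bar R) :
  measurable_fun setT phi ->
  (forall B, measurable B -> mu (phi @^-1` B) = mu B) ->
  measurable_fun setT f -> (forall x, 0 <= f x)%E ->
  (\int[mu]_x f (phi x) = \int[mu]_x f x)%E.
Proof.
move=> mphi hphi mf f0.
have -> : (\int[mu]_x f (phi x) = \int[pushforward mu phi]_x f x)%E.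
  by apply/esym; apply: (ge0_integral_pushforward mphi _ measurableT mf) => x _.
by apply: eq_measure_integral => A mA _; exact: hphi.
Qed.

Section lebesgue_rV_theory.
Context (R : realType).
Local Open Scope ereal_scope.

Lemma lebesgue_measure_reflection (z : R) (B : set R) : measurable B ->
  lebesgue_measure [set t : R | B (z - t)%R] = lebesgue_measure B.
Proof.
move=> mB; have mz : measurable_fun [set: measurableTypeR R]
      (fun t : R => (z - t)%R : measurableTypeR R).
  exact: measurable_funB.
pose nu : {measure set (measurableTypeR R) -> \bar R} :=
  measure_function_pushforward__canonical__measure_function_Measure
    (@lebesgue_measure R) mz.
suff h : forall X, ocitv X -> lebesgue_measure X = nu X.
  by have /esym := lebesgue_measure_unique h mB.
move=> _ [[a b]/= _ <-]; rewrite /nu/= /pushforward.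
rewrite (_ : _ @^-1` _ = `[(z - b)%R, (z - a)%R[%classic); last first.
  apply/seteqP; split => t /=; rewrite !in_itv/= => /andP[h1 h2];
    apply/andP; split; lra.
rewrite !lebesgue_measure_itv/= !lte_fin ltrD2l ltrN2.
by case: ifPn => // _; rewrite -!EFinB; congr EFin; lra.
Qed.

Lemma measurable_reflection n (z : 'rV[R]_n) :
  measurable_fun setT (fun x : 'rV[R]_n => (z - x)%R).
Proof.
apply: measurable_fun_coordP => i; under eq_fun do rewrite !mxE.
by apply: measurable_funB => //; exact: measurable_coord.
Qed.

Lemma rV_consE n (p : 'rV[R]_n * R) i :
  (rV_cons p ord0 i = if unlift ord0 i is Some j then p.1 ord0 j else p.2)%R.
Proof.
rewrite /rV_cons mxE; case: (@splitP 1 n i) => j ij.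
  rewrite (_ : i = ord0) ?unlift_none ?mxE ?(ord1 j) ?eqxx//.
  by apply/val_inj; rewrite /= ij (ord1 j).
by rewrite (_ : i = lift ord0 j) ?liftK//; apply/val_inj.
Qed.

(** Induction on the dimension along [rV_cons]: the first coordinate is reflected inside the
    sections, the others by the induction hypothesis. This is what makes the integral of ell(z - x)
    independent of z. *)
Lemma lebesgue_rV_reflection n (z : 'rV[R]_n) (B : set 'rV[R]_n) :
  measurable B ->
  lebesgue_rV n [set x | B (z - x)%R] = lebesgue_rV n B.
Proof.
elim: n z B => [z B mB|n IH z B mB].
  rewrite /= (_ : [set x | B (z - x)%R] = B)//.
  by apply/seteqP; split => x /=; rewrite [(z - x)%R]thinmx0 [x]thinmx0.
rewrite /= /lebesgue_rVS /pushforward /product_measure1.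
pose z' : 'rV[R]_n := \row_i z ord0 (lift ord0 i).
pose g (x : 'rV[R]_n) :=
  lebesgue_measure (xsection ((@rV_cons R n) @^-1` B) x).
have mB' : measurable ((@rV_cons R n) @^-1` B).
  by rewrite -[X in measurable X]setTI; exact: measurable_rV_cons.
have mg : measurable_fun setT g by exact: measurable_fun_xsection.
have sE m (u v : 'rV[R]_m) i : ((u - v) ord0 i = u ord0 i - v ord0 i)%R.
  by rewrite !mxE.
have zE (x : 'rV[R]_n) (t : R) :
    (z - rV_cons (x, t) = rV_cons ((z' - x)%R, (z ord0 ord0 - t)%R))%R.
  by apply/rowP => i; rewrite sE !rV_consE; case: unliftP => [j|] ->; rewrite ?sE ?mxE.
transitivity (\int[lebesgue_rV n]_x g (z' - x)%R).
  apply: eq_integral => x _ /=; rewrite /g.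
  rewrite -[RHS](lebesgue_measure_reflection (z ord0 ord0)); last exact: measurable_xsection.
  congr (lebesgue_measure _); apply/seteqP; split => t /=.
    by rewrite /xsection/= !inE/= zE.
  by rewrite /xsection/= !inE/= zE.
rewrite ge0_integral_preserving//; first exact: measurable_reflection.
by move=> A mA; exact: IH.
Qed.

Lemma ge0_integral_reflection n (z : 'rV[R]_n) (f : 'rV[R]_n -> \bar R) :
  measurable_fun setT f -> (forall x, 0 <= f x) ->
  \int[lebesgue_rV n]_x f (z - x)%R = \int[lebesgue_rV n]_x f x.
Proof.
move=> mf f0; apply: ge0_integral_preserving => //; first exact: measurable_reflection.
by move=> B mB; exact: lebesgue_rV_reflection.
Qed.

Lemma lebesgue_rV_cube_lty n (K : R) : lebesgue_rV n (cube K) < +oo.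
Proof.
elim: n => [|n IH]; first by rewrite /= diracE ltry.
rewrite /= /lebesgue_rVS /pushforward.
rewrite (_ : _ @^-1` _ = cube K `*` `[(- K)%R, K]%classic); last first.
  apply/seteqP; split => -[x t] /=.
    move=> h; split => [i|]; first by have := h (lift ord0 i); rewrite rV_consE liftK.
    by have := h ord0; rewrite rV_consE unlift_none/= in_itv/= -ler_norml.
  move=> [h1 h2] i; rewrite rV_consE; case: unliftP => [j _|_]; first exact: h1.
  by move: h2; rewrite /= in_itv/= -ler_norml.
rewrite product_measure1E//; last exact: measurable_cube.
rewrite lte_mul_pinfty//; last 2 first.
  by rewrite ge0_fin_numE.
have := @lebesgue_measure_itv R `[(- K)%R, K] => /= ->; case: ifPn => _; rewrite ?ltry// -EFinB ltry.
Qed.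

Lemma lebesgue_rV_sigma_finite n : sigma_finite setT (lebesgue_rV (R := R) n).
Proof.
exists (fun k => cube k%:R%R).
  apply/seteqP; split => // x _; exists (Num.truncn (\sum_i `|x ord0 i|)%R).+1 => //= i.
  apply/ltW/(le_lt_trans _ (truncnS_gt _)).
  by rewrite (bigD1 i)//= lerDl sumr_ge0.
by move=> k; split; [exact: measurable_cube|exact: lebesgue_rV_cube_lty].
Qed.

End lebesgue_rV_theory.

(** * Poisson counts *)

Section trigonometric_exponential_series.
Context (R : realType).
Implicit Types a b t : R.

(** Partial sum of the real part of e^(i a) exp(t e^(i b)); multiplication by e^(i b) shifts the
    phase a by b. *)
Definition exp_cos_sum b n a t : R :=
  \sum_(k < n) t ^+ k / k`!%:R * cos (a + k%:R * b).

Lemma is_derive_exp_cos_sum b n a t :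
  is_derive t 1 (exp_cos_sum b n.+1 a) (exp_cos_sum b n (a + b) t).
Proof.
elim: n a t => [|n IH] a t.
  rewrite (_ : exp_cos_sum b 1 a = cst (cos a)).
    by rewrite /exp_cos_sum big_ord0; exact: is_derive_cst.
  by apply/funext => s; rewrite /exp_cos_sum big_ord1/= fact0 divr1 mul1r mul0r addr0.
rewrite (_ : exp_cos_sum b n.+2 a = exp_cos_sum b n.+1 a +
    (cos (a + n.+1%:R * b) / n.+1`!%:R) \*: ((@id R) ^+ n.+1)); last first.
  apply/funext => s; rewrite /exp_cos_sum big_ord_recr/= /GRing.scale/=.
  by rewrite fctE exprfctE/= mulrC mulrA mulrAC.
apply: (is_derive_eq (is_deriveD (IH a t) (is_deriveZ _ (is_deriveX n.+1 (is_derive_id t 1))))).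
rewrite /exp_cos_sum big_ord_recr/=; congr (_ + _).
rewrite /GRing.scale/= factS natrM (_ : a + b + n%:R * b = a + n.+1%:R * b); last first.
  by rewrite -natr1; ring.
have : n`!%:R != 0 :> R by rewrite pnatr_eq0 -lt0n fact_gt0.
have : n.+1%:R != 0 :> R by rewrite pnatr_eq0.
move: (n.+1%:R : R) (n`!%:R : R) (t ^+ n) => p q u p0 q0.
by field; rewrite p0 q0.
Qed.

Lemma is_derive_exp_cos b a t :
  is_derive t 1 (fun t => expR (t * cos b) * cos (a + t * sin b))
    (expR (t * cos b) * cos (a + b + t * sin b)).
Proof.
have d1 : is_derive t 1 (fun t => expR (t * cos b)) (expR (t * cos b) * cos b).
  have h : is_derive t 1 (fun t => t * cos b) (cos b).
    rewrite (_ : (fun t => _) = cos b \*: @id R); last by apply/funext => s /=; rewrite mulrC.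
    by apply: (is_derive_eq (is_deriveZ _ (is_derive_id t 1))); rewrite /GRing.scale/= mulr1.
  exact: (is_derive1_comp (is_derive_expR _) h).
have d2 : is_derive t 1 (fun t => cos (a + t * sin b)) (- sin (a + t * sin b) * sin b).
  have h : is_derive t 1 (fun t => a + t * sin b) (sin b).
    rewrite (_ : (fun t => _) = cst a + sin b \*: @id R); last by apply/funext => s /=; rewrite mulrC.
    by apply: (is_derive_eq (is_deriveD (is_derive_cst _ t 1) (is_deriveZ _ (is_derive_id t 1)))); rewrite /GRing.scale/= mulr1 add0r.
  exact: (is_derive1_comp (is_derive_cos _) h).
apply: (is_derive_eq (is_deriveM d1 d2)).
rewrite /GRing.scale/= (_ : a + b + t * sin b = a + t * sin b + b); last by ring.
by rewrite (cosD (a + t * sin b) b); ring.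
Qed.

(** Taylor's remainder for exp(t e^(i b)), whose derivatives in t have modulus at most e^t.
    Induction on n: differentiating in t lowers n by one and shifts a by b. *)
Lemma exp_cos_sum_remainder b n a t : 0 <= t ->
  `|expR (t * cos b) * cos (a + t * sin b) - exp_cos_sum b n a t| <=
  expR t * (t ^+ n / n`!%:R).
Proof.
have cospi (x : R) : cos (x + pi) = - cos x.
  by rewrite cosD cospi sinpi; ring.
(* Adding pi to the phase changes the sign, so a one-sided bound for all phases is a two-sided
   one. *)
suff H : forall n a t, 0 <= t ->
    expR (t * cos b) * cos (a + t * sin b) - exp_cos_sum b n a t <=
    expR t * (t ^+ n / n`!%:R).
  move=> t0; rewrite ler_norml H// andbT lerNl.
  have := H n (a + pi) t t0; apply: le_trans; rewrite le_eqVlt; apply/orP; left.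
  rewrite addrAC cospi /exp_cos_sum.
  under [X in _ == _ - X]eq_bigr do rewrite addrAC cospi mulrN.
  by rewrite sumrN; apply/eqP; ring.
elim=> [|{}n IH] {}a {}t t0.
  rewrite /exp_cos_sum big_ord0 subr0 fact0 divr1 mulr1.
  apply: (@le_trans _ _ (expR (t * cos b))).
    by rewrite ler_piMr ?expR_ge0// cos_le1.
  by rewrite ler_expR ler_piMr// cos_le1.
rewrite -subr_ge0.
pose F t := expR t * (t ^+ n.+1 / n.+1`!%:R) -
  (expR (t * cos b) * cos (a + t * sin b) - exp_cos_sum b n.+1 a t).
pose f t := expR t * (t ^+ n.+1 / n.+1`!%:R) + expR t * (t ^+ n / n`!%:R) -
  (expR (t * cos b) * cos (a + b + t * sin b) - exp_cos_sum b n (a + b) t).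
apply: (@ge0_of_derive_ge0 R F f) => //.
- move=> s.
  have ds : is_derive s 1 (fun s : R => s ^+ n.+1 / n.+1`!%:R) (s ^+ n / n`!%:R).
    rewrite (_ : (fun s => _) = (n.+1`!%:R)^-1 \*: ((@id R) ^+ n.+1)); last first.
      by apply/funext => u /=; rewrite mulrC exprfctE.
    apply: (is_derive_eq (is_deriveZ _ (is_deriveX n.+1 (is_derive_id s 1)))).
    have : n`!%:R != 0 :> R by rewrite pnatr_eq0 -lt0n fact_gt0.
    have : n.+1%:R != 0 :> R by rewrite pnatr_eq0.
    rewrite /GRing.scale/= factS natrM.
    by move: (n.+1%:R : R) (n`!%:R : R) (s ^+ n) => p q u p0 q0; field; rewrite p0 q0.
  apply: (is_derive_eq (is_deriveB (is_deriveM (is_derive_expR s) ds) (is_deriveB (is_derive_exp_cos b a s) (is_derive_exp_cos_sum b n a s)))).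
  by rewrite /f /GRing.scale/=; congr (_ - _); rewrite addrC; congr (_ + _); rewrite mulrC.
- move=> s s0; rewrite /f -addrA addr_ge0//.
    by rewrite mulr_ge0 ?expR_ge0// divr_ge0// exprn_ge0.
  by rewrite subr_ge0 IH.
- rewrite /F expr0n/= mul0r mulr0 mul0r expR0 mul1r mul0r addr0 sub0r opprB.
  rewrite /exp_cos_sum big_ord_recl/= expr0 fact0 divr1 mul1r mul0r addr0.
  rewrite big1 ?addr0 ?subrr// => i _.
  by rewrite /bump/= add1n expr0n/= !mul0r.
Qed.

Lemma cvg_exp_cos_sum b a t : 0 <= t ->
  exp_cos_sum b n a t @[n --> \oo] --> expR (t * cos b) * cos (a + t * sin b).
Proof.
move=> t0; apply/cvgrPdist_le => e e0.
have c0 : expR t * (t ^+ n / n`!%:R) @[n --> \oo] --> (0 : R).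
  rewrite -(mulr0 (expR t)); apply: cvgM; first exact: cvg_cst.
  by apply/cvg_series_cvg_0; exact: is_cvg_series_exp_coeff.
have /cvgrPdist_le/(_ _ e0) := c0; apply: filterS => n.
rewrite sub0r normrN => h.
by rewrite (le_trans (exp_cos_sum_remainder _ _ _ t0))// (le_trans (ler_norm _)).
Qed.

Lemma polar_coordinates (x y : R) :
  exists r b, [/\ 0 <= r, x = r * cos b & y = r * sin b].
Proof.
pose r := Num.sqrt (x ^+ 2 + y ^+ 2).
have r2 : r ^+ 2 = x ^+ 2 + y ^+ 2 by rewrite sqr_sqrtr// addr_ge0// sqr_ge0.
have [r0|rn0] := eqVneq r 0.
  exists 0, 0; rewrite !mul0r; move: r2; rewrite r0 expr0n/= => /esym/eqP.
  by rewrite paddr_eq0 ?sqr_ge0// !sqrf_eq0 => /andP[/eqP -> /eqP ->].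
have r_ge0 : 0 <= r by exact: sqrtr_ge0.
have r_gt0 : 0 < r by rewrite lt_def rn0.
have xr : -1 <= x / r <= 1.
  rewrite -ler_norml normrM normfV (ger0_norm r_ge0) ler_pdivrMr// mul1r.
  by rewrite -(ler_pXn2r (n := 2))// ?nnegrE// real_normK ?num_real// r2 lerDl sqr_ge0.
have [y0|y0] := leP 0 y.
  exists r, (acos (x / r)); split => //; first by rewrite acosK// mulrC divfK.
  rewrite sin_acos// -{1}(ger0_norm r_ge0) -sqrtr_sqr -sqrtrM ?sqr_ge0//.
  rewrite mulrBr mulr1 expr_div_n mulrC divfK ?expf_neq0// r2 addrC addKr sqrtr_sqr ger0_norm//.
exists r, (- acos (x / r)); split => //; first by rewrite cosN acosK// mulrC divfK.
rewrite sinN sin_acos// mulrN -{1}(ger0_norm r_ge0) -sqrtr_sqr -sqrtrM ?sqr_ge0//.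
by rewrite mulrBr mulr1 expr_div_n mulrC divfK ?expf_neq0// r2 addrC addKr sqrtr_sqr ltr0_norm// opprK.
Qed.

End trigonometric_exponential_series.

Section amplitude_phase.
Context d (T : measurableType d) (R : realType) (P : probability T R).

(* If each pair [(r i cos th i, r i sin th i)] has mean
   [(rho i cos b i, rho i sin b i)] and the means of products factor, then
   the product of the complex numbers [r i e^(i th i)] has mean the product of
   the [rho i e^(i b i)]; only real parts of rotations of it are mentioned. *)
Lemma Rintegral_prod_amplitude_phase (I : eqType) (s : seq I) (g : T -> R)
    (c : R) (r th : I -> T -> R) (rho b : I -> R) : uniq s ->
  bounded_measurable g -> (forall i, bounded_measurable (r i)) ->
  (forall i, measurable_fun setT (th i)) ->
  (forall e : I -> bool,
     \int[P]_w (g w * \prod_(i <- s)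
        (r i w * if e i then cos (th i w) else sin (th i w))) =
     c * \prod_(i <- s) (rho i * if e i then cos (b i) else sin (b i))) ->
  forall a : R,
    \int[P]_w (g w * \prod_(i <- s) r i w *
                cos (a + \sum_(i <- s) th i w)) =
    c * \prod_(i <- s) rho i * cos (a + \sum_(i <- s) b i).
Proof.
elim: s g c => [|i s IH] g c.
  move=> _ bg br mth h a; have := h (fun=> true).
  rewrite !big_nil addr0 !mulr1 => gc.
  under eq_Rintegral do rewrite !big_nil addr0 !mulr1 mulrC.
  rewrite bounded_RintegralZ// mulrC; congr (_ * _).
  by rewrite -gc; apply: eq_Rintegral => w _; rewrite big_nil mulr1.
move=> /= /andP[is_ us] bg br mth h a.
(* The factor of index i is absorbed into [g], once with its cosine and once with its sine; the
   addition formula recombines the two. *)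
have bc : bounded_measurable (fun w => g w * (r i w * cos (th i w))).
  apply: bounded_measurableM => //; apply: bounded_measurableM => //.
  exact: bounded_measurable_cos.
have bs : bounded_measurable (fun w => g w * (r i w * sin (th i w))).
  apply: bounded_measurableM => //; apply: bounded_measurableM => //.
  exact: bounded_measurable_sin.
have eE (e : I -> bool) v : exists e', e' i = v /\ forall j, j \in s -> e' j = e j.
  exists (fun j => if j == i then v else e j); rewrite eqxx; split => // j js.
  by case: eqVneq js => // ->; rewrite (negbTE is_).
have hc : forall e : I -> bool,
    \int[P]_w (g w * (r i w * cos (th i w)) * \prod_(i <- s)
        (r i w * if e i then cos (th i w) else sin (th i w))) =
    (c * (rho i * cos (b i))) *
    \prod_(i <- s) (rho i * if e i then cos (b i) else sin (b i)).
  move=> e; have [e' [e'i e's]] := eE e true.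
  have := h e'; rewrite big_cons e'i [in RHS]big_seq.
  under [in RHS]eq_bigr => j js do rewrite (e's _ js).
  rewrite -[in RHS]big_seq mulrA => <-; apply: eq_Rintegral => w _.
  rewrite big_cons e'i -mulrA; congr (_ * (_ * _)).
  by rewrite big_seq [RHS]big_seq; apply: eq_bigr => j js; rewrite (e's _ js).
have hs : forall e : I -> bool,
    \int[P]_w (g w * (r i w * sin (th i w)) * \prod_(i <- s)
        (r i w * if e i then cos (th i w) else sin (th i w))) =
    (c * (rho i * sin (b i))) *
    \prod_(i <- s) (rho i * if e i then cos (b i) else sin (b i)).
  move=> e; have [e' [e'i e's]] := eE e false.
  have := h e'; rewrite big_cons e'i [in RHS]big_seq.
  under [in RHS]eq_bigr => j js do rewrite (e's _ js).
  rewrite -[in RHS]big_seq mulrA => <-; apply: eq_Rintegral => w _.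
  rewrite big_cons e'i -mulrA; congr (_ * (_ * _)).
  by rewrite big_seq [RHS]big_seq; apply: eq_bigr => j js; rewrite (e's _ js).
have sinE (x : R) : sin x = cos (x - pi / 2).
  by rewrite cosB cos_pihalf sin_pihalf mulr0 add0r mulr1.
have cosE (x y : R) : cos (a + (x + y)) =
    cos x * cos (a + y) - sin x * cos (a - pi / 2 + y).
  rewrite (_ : a - pi / 2 + y = a + y - pi / 2); last by ring.
  by rewrite -sinE -cosD; congr cos; ring.
rewrite !big_cons cosE.
transitivity (\int[P]_w
   ((g w * (r i w * cos (th i w)) * \prod_(i <- s) r i w *
       cos (a + \sum_(i <- s) th i w)) -
    (g w * (r i w * sin (th i w)) * \prod_(i <- s) r i w *
       cos (a - pi / 2 + \sum_(i <- s) th i w)))).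
  by apply: eq_Rintegral => w _; rewrite !big_cons cosE; ring.
have bp (f : T -> R) (a' : R) : bounded_measurable f ->
    bounded_measurable (fun w => f w * \prod_(i <- s) r i w *
       cos (a' + \sum_(i <- s) th i w)).
  move=> bf; apply: bounded_measurableM.
    by apply: bounded_measurableM => //; exact: bounded_measurable_prod.
  apply: bounded_measurable_cos; apply: measurable_funD => //.
  by apply: measurable_sum => j.
rewrite bounded_RintegralB; [|exact: bp|exact: bp].
rewrite (IH _ _ us bc br mth hc) (IH _ _ us bs br mth hs); ring.
Qed.

End amplitude_phase.

Lemma measurable_truncn_fine (R : realType) (h : nat -> R) :
  measurable_fun setT (fun e : \bar R => h (Num.truncn (fine e))).
Proof.
suff m : measurable_fun [set: R] (fun x => h (Num.truncn x)).
  exact: (measurableT_comp m (fine_measurable measurableT)).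
move=> _ Y mY.
rewrite setTI.
(* Truncation sends everything below 1 to 0, negative numbers included, hence the unbounded first
   cell. *)
rewrite (_ : _ @^-1` Y = \bigcup_(k in [set k | Y (h k)])
    (if k is k'.+1 then `[k%:R, k.+1%:R[%classic else `]-oo, 1[%classic)).
  by apply: bigcup_measurable => -[|k] _; exact: measurable_itv.
apply/seteqP; split => x /=.
  move=> Yx; exists (Num.truncn x) => //.
  have [x0|x0] := leP 0 x; last first.
    by rewrite (elimT (truncn0Pn _)) -?ltNge ?(lt_trans x0)//= in_itv/= (lt_trans x0).
  case E : (Num.truncn x) => [|k]; rewrite /= in_itv/=.
    by have := truncn_itv x0; rewrite E => /andP[].
  by have := truncn_itv x0; rewrite E.
move=> [[|k]] /= Yk; rewrite in_itv/= => xk.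
  by rewrite (elimT (truncn0Pn _)) -?ltNge//; exact: Yk.
by rewrite (truncn_def xk); exact: Yk.
Qed.

Section poisson_count.
Context d (T : measurableType d) (R : realType) (P : probability T R).
Variables (N : T -> \bar R) (r : R).
Hypotheses (mN : measurable_fun setT N) (N0 : forall w, (0 <= N w)%E).
Hypothesis r0 : 0 <= r.
Hypothesis lawN : forall k,
  P [set w | N w = k%:R%:E] = poisson_prob r 0 [set k].

(** For r = 0 the law [poisson_prob] is a Dirac mass at 0, which fits the formula because r ^+ 0 =
    1. *)
Lemma poisson_count_pmf k :
  P [set w | N w = k%:R%:E] = (expR (- r) * (r ^+ k / k`!%:R))%:E.
Proof.
rewrite lawN /poisson_prob; case: ifPn => [r_gt0|].
  by rewrite esum_set1 ?lee_fin ?poisson_pmf_ge0// /poisson_pmf r_gt0 mulrC.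
rewrite -leNgt => rle0; have -> : r = 0 by apply/le_anti; rewrite rle0.
rewrite oppr0 expR0 mul1r diracE expr0n; case: k => [|k]/=.
  by rewrite mem_set// fact0 divr1.
by rewrite memNset ?mul0r// => /esym.
Qed.

Let mlevel k : measurable [set w | N w = k%:R%:E].
Proof.
rewrite -[X in measurable X]setTI.
exact: (mN measurableT (emeasurable_set1 k%:R%:E)).
Qed.

(** Only the probabilities of the natural values are given; they sum to 1, which leaves probability
    0 for +oo and for everything else. *)
Lemma poisson_count_ae_nat : {ae P, forall w, exists k : nat, N w = k%:R%:E}.
Proof.
pose F k := [set w | N w = k%:R%:E].
have mF : measurable (\bigcup_k F k) by exact: bigcupT_measurable.
have tF : trivIset setT F.
  apply/trivIsetP => i j _ _ ij; rewrite -subset0 => w [] /=; rewrite /F/= => -> [/eqP].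
  by rewrite eqr_nat (negbTE ij).
have PF : P (\bigcup_k F k) = 1%E.
  rewrite measure_bigcup//; last by move=> k _; exact: mlevel.
  have : (\sum_(0 <= k < n) P (F k))%E @[n --> \oo] --> (1%E : \bar R).
    (* With a = b = 0 the trigonometric series is the exponential series. *)
    rewrite (_ : (fun n => _) =
        fun n => (expR (- r) * exp_cos_sum 0 n 0 r)%:E); last first.
      apply/funext => n; rewrite big_mkord /exp_cos_sum mulr_sumr -sumEFin.
      apply: eq_bigr => k _.
      by rewrite poisson_count_pmf mulr0 addr0 cos0 mulr1.
    apply: cvg_EFin; first exact: nearW.
    rewrite -(_ : expR (- r) * (expR (r * cos 0) * cos (0 + r * sin 0)) = 1).
      by apply: cvgM; [exact: cvg_cst|exact: cvg_exp_cos_sum].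
    by rewrite cos0 sin0 mulr0 addr0 cos0 !mulr1 -expRD addNr expR0.
  by move=> /cvg_lim <-//; congr (lim (_ @ \oo)); apply/funext => n; apply: eq_bigl => k; rewrite in_setT.
exists (~` \bigcup_k F k); split; first exact: measurableC.
  by rewrite probability_setC// PF subee.
by move=> w /= h [k _ Nk]; apply: h; exists k.
Qed.

Lemma poisson_count_Rintegral (h : nat -> R) (l : R) :
  (exists M : R, forall k, `|h k| <= M) ->
  \sum_(k < n) h k * (expR (- r) * (r ^+ k / k`!%:R)) @[n --> \oo] --> l ->
  \int[P]_w h (Num.truncn (fine (N w))) = l.
Proof.
move=> [M hM] hl; apply: (cvg_unique _ _ hl) => //.
have mh := measurableT_comp (measurable_truncn_fine h) mN.
have -> : (fun n => \sum_(k < n) h k * (expR (- r) * (r ^+ k / k`!%:R))) =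
    (fun n => \int[P]_w \sum_(k < n) h k * \1_[set w | N w = k%:R%:E] w).
  apply/funext => n; rewrite bounded_Rintegral_sum; last first.
    by move=> k; apply: bounded_measurableZ; exact: bounded_measurable_indic.
  apply: eq_bigr => k _.
  rewrite bounded_RintegralZ; last exact: bounded_measurable_indic.
  by rewrite Rintegral_indic// poisson_count_pmf.
have N1 n w : \sum_(k < n) h k * \1_[set w | N w = k%:R%:E] w =
    if [exists k : 'I_n, N w == k%:R%:E]
    then h (Num.truncn (fine (N w))) else 0.
  case: ifPn => [/existsP[k /eqP Nk]|/existsPn Nk].
    rewrite (bigD1 k)//= indicE mem_set//= mulr1 Nk natrK big1 ?addr0// => j jk.
    rewrite indicE memNset ?mulr0//= Nk => -[/eqP]; rewrite eqr_nat => /eqP kj.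
    by move: jk => /eqP; apply; apply/val_inj.
  rewrite big1// => k _; rewrite indicE memNset ?mulr0//= => Nw.
  by have := Nk k; rewrite Nw eqxx.
apply: (@dominated_convergence_Rintegral _ _ _ P _ _ (cst M) _ _ _ _ _).2.
- move=> n; apply: measurable_sum => k; by apply: measurable_funM.
- exact: mh.
- apply: filterS poisson_count_ae_nat => w [k Nk]; apply: cvg_near_cst.
  near=> n; rewrite N1; case: ifPn => // /existsPn.
  have kn : (k < n)%N by near: n; exact: nbhs_infty_gt.
  by move=> /(_ (Ordinal kn)); rewrite /= Nk eqxx.
- exact: bounded_measurable_integrable (bounded_measurable_cst _ _).
- move=> n w; rewrite N1; case: ifPn => _; first exact: hM.
  by rewrite normr0; exact: le_trans (hM 0).
Unshelve. all: by end_near. Qed.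

(** The generating function of a Poisson variable at the complex point z = rho e^(i b), namely exp(r
    (z - 1)), rotated by a and in real part. The modulus is at most 1, which keeps the integrand
    bounded. *)
Lemma poisson_count_characteristic (rho b a : R) : 0 <= rho <= 1 ->
  \int[P]_w (rho ^+ Num.truncn (fine (N w)) *
              cos (a + (Num.truncn (fine (N w)))%:R * b)) =
  expR (r * (rho * cos b - 1)) * cos (a + r * (rho * sin b)).
Proof.
move=> /andP[rho0 rho1].
apply: (poisson_count_Rintegral (h := fun k => rho ^+ k * cos (a + k%:R * b))).
  exists 1 => k; rewrite normrM ger0_norm ?exprn_ge0//.
  by rewrite mulr_ile1// ?exprn_ge0// ?exprn_ile1// cos_max.
rewrite (_ : (fun n => _) = fun n => expR (- r) * exp_cos_sum b n a (r * rho)).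
  rewrite mulrBr mulr1 addrC expRD -mulrA !(mulrA r rho).
  by apply: cvgM; [exact: cvg_cst|apply: cvg_exp_cos_sum; rewrite mulr_ge0].
apply/funext => n; rewrite /exp_cos_sum mulr_sumr; apply: eq_bigr => k _.
by rewrite exprMn; ring.
Qed.

Lemma poisson_count_expectation : (\int[P]_w N w = r%:E)%E.
Proof.
transitivity (\int[P]_w \sum_(0 <= k <oo)
    (k%:R * \1_[set w | N w = k%:R%:E] w)%:E)%E.
  apply: ge0_ae_eq_integral => //.
  - apply: ge0_emeasurable_sum.
      by move=> k w _ _; rewrite lee_fin mulr_ge0// indicE.
    move=> k _; apply/measurable_EFinP; by apply: measurable_funM.
  - move=> w _; apply: nneseries_ge0 => k _ _; rewrite lee_fin mulr_ge0//.
  - apply: filterS poisson_count_ae_nat => w [k Nk] _.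
    rewrite (@nneseriesD1 _ _ k)//=.
    rewrite indicE mem_set//= mulr1 eseries0 ?adde0 ?Nk// => j _ jk.
    rewrite indicE memNset ?mulr0//= Nk => -[/eqP]; rewrite eqr_nat => /eqP kj.
    by move: jk; rewrite kj eqxx.
rewrite integral_nneseries//; last first.
  by move=> k; apply/measurable_EFinP; apply: measurable_funM.
have E k : (\int[P]_w (k%:R * \1_[set w | N w = k%:R%:E] w)%:E =
    (k%:R * (expR (- r) * (r ^+ k / k`!%:R)))%:E)%E.
  rewrite EFin_bounded_Rintegral; last first.
    by apply: bounded_measurableZ; exact: bounded_measurable_indic.
  rewrite bounded_RintegralZ; last exact: bounded_measurable_indic.
  by rewrite Rintegral_indic// poisson_count_pmf.
under eq_eseriesr do rewrite E.
apply/cvg_lim => //; rewrite -cvg_shiftS/=.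
rewrite (_ : (fun n => _) = fun n => (r * (expR (- r) * exp_cos_sum 0 n 0 r))%:E).
  apply: cvg_EFin; first exact: nearW.
  rewrite -[X in _ --> X]mulr1; apply: cvgM; first exact: cvg_cst.
  rewrite -(_ : expR (- r) * (expR (r * cos 0) * cos (0 + r * sin 0)) = 1).
    by apply: cvgM; [exact: cvg_cst|exact: cvg_exp_cos_sum].
  by rewrite cos0 sin0 mulr0 addr0 cos0 !mulr1 -expRD addNr expR0.
apply/funext => n; rewrite big_mkord big_ord_recl/= mul0r add0e sumEFin.
congr EFin; rewrite /exp_cos_sum !mulr_sumr; apply: eq_bigr => k _.
rewrite mulr0 addr0 cos0 mulr1 /bump/= add1n factS natrM exprS.
have : k`!%:R != 0 :> R by rewrite pnatr_eq0 -lt0n fact_gt0.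
have : k.+1%:R != 0 :> R by rewrite pnatr_eq0.
by move: (k.+1%:R : R) (k`!%:R : R) (r ^+ k) => p q u p0 q0; field; rewrite p0 q0.
Qed.

End poisson_count.

(** * Campbell's formula *)

Section independent_product.
Context d d1 d2 (T : measurableType d) (T1 : measurableType d1)
  (T2 : measurableType d2) (R : realType) (P : probability T R).
Variables (X : T -> T1) (Y : T -> T2).
Hypotheses (mX : measurable_fun setT X) (mY : measurable_fun setT Y).
Local Open Scope ereal_scope.

Lemma ge0_integral_law (f : T1 -> \bar R) : measurable_fun setT f ->
  (forall x, 0 <= f x) -> \int[law P mX]_x f x = \int[P]_w f (X w).
Proof.
by move=> mf f0; rewrite /law /distribution ge0_integral_pushforward.
Qed.

Lemma ge0_expectation_mul (f : T1 -> \bar R) (g : T2 -> \bar R) :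
  (forall B1 B2, measurable B1 -> measurable B2 ->
     P (X @^-1` B1 `&` Y @^-1` B2) = P (X @^-1` B1) * P (Y @^-1` B2)) ->
  measurable_fun setT f -> measurable_fun setT g ->
  (forall x, 0 <= f x) -> (forall y, 0 <= g y) ->
  \int[P]_w (f (X w) * g (Y w)) = \int[P]_w f (X w) * \int[P]_w g (Y w).
Proof.
move=> indep mf mg f0 g0.
have mXY : measurable_fun setT (fun w => (X w, Y w)).
  exact/measurable_fun_pair.
pose nu := pushforward P (fun w => (X w, Y w)).
have mh : measurable_fun setT (fun z : T1 * T2 => f z.1 * g z.2).
  by apply: emeasurable_funM; apply: measurableT_comp.
have h0 (z : T1 * T2) : 0 <= f z.1 * g z.2 by rewrite mule_ge0.
transitivity (\int[pushforward P (fun w => (X w, Y w))]_z (f z.1 * g z.2)).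
  by rewrite ge0_integral_pushforward.
transitivity (\int[law P mX \x law P mY]_z (f z.1 * g z.2)).
  apply: eq_measure_integral => B mB _; apply/esym.
  pose nu' : {measure set (T1 * T2) -> \bar R} :=
    measure_function_pushforward__canonical__measure_function_Measure P mXY.
  have H : forall B1 B2, measurable B1 -> measurable B2 ->
      nu' (B1 `*` B2) = law P mX B1 * law P mY B2.
    by move=> B1 B2 mB1 mB2; exact: indep.
  exact: (product_measure_unique H).
rewrite (fubini_tonelli1 _ mh)//.
under eq_integral => x _ do rewrite /fubini_F/= ge0_integralZl//.
rewrite ge0_integralZr//; last exact: integral_ge0.
by rewrite !ge0_integral_law// /law /distribution ge0_integral_pushforward.
Qed.

End independent_product.

Section campbell.
Context d (T : measurableType d) (R : realType) (n : nat).
Variables (P : probability T R) (lam : R) (X : nat -> {RV P >-> 'rV[R]_n}).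
Hypotheses (lam0 : 0 < lam) (poisX : poisson_process P lam X).
Local Open Scope ereal_scope.
Local Notation mu := (@lebesgue_rV R n).

Let diracE_indic (B : set 'rV[R]_n) k w :
  \d_(X k w) B = (\1_(X k @^-1` B) w)%:E :> \bar R.
Proof. by rewrite diracE indicE; congr (_%:R%:E). Qed.

Let mpreim (B : set 'rV[R]_n) k : measurable B -> measurable (X k @^-1` B).
Proof.
by move=> mB; rewrite -[Y in measurable Y]setTI; exact: measurable_funP.
Qed.

Let measurable_dirac_comp (B : set 'rV[R]_n) k : measurable B ->
  measurable_fun setT (fun w => \d_(X k w) B : \bar R).
Proof.
move=> mB; under eq_fun do rewrite diracE_indic.
by apply/measurable_EFinP; apply: measurable_indic; exact: mpreim.
Qed.

Lemma measurable_point_process (B : set 'rV[R]_n) : measurable B ->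
  measurable_fun setT (point_process X B).
Proof.
move=> mB; apply: ge0_emeasurable_sum => // k _; exact: measurable_dirac_comp.
Qed.

Lemma mean_point_process (B : set 'rV[R]_n) : measurable B -> mu B < +oo ->
  \sum_(0 <= k <oo) P (X k @^-1` B) = lam%:E * mu B.
Proof.
move=> mB Boo; have [pB _] := poisX.
have fB : mu B \is a fin_num by rewrite ge0_fin_numE.
transitivity (\int[P]_w point_process X B w).
  rewrite /point_process integral_nneseries//; last first.
    by move=> k; exact: measurable_dirac_comp.
  apply: eq_eseriesr => k _.
  under eq_integral do rewrite diracE_indic.
  by rewrite integral_indic ?setIT//; exact: mpreim.
rewrite (poisson_count_expectation (r := (lam * fine (mu B))%R)).
- by rewrite EFinM fineK.
- exact: measurable_point_process.
- by move=> w; apply: nneseries_ge0.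
- by rewrite mulr_ge0// ?ltW// fine_ge0.
- by move=> k; exact: pB.
Qed.

Lemma mean_point_process_all (B : set 'rV[R]_n) : measurable B ->
  \sum_(0 <= k <oo) P (X k @^-1` B) = lam%:E * mu B.
Proof.
move=> mB.
have /sigma_finiteP[F [FT ndF mF]] := @lebesgue_rV_sigma_finite R n.
have mBF k : measurable (B `&` F k) by apply: measurableI => //; exact: (mF k).1.
have BFE : \bigcup_k (B `&` F k) = B by rewrite -setI_bigcupr -FT setIT.
have ndBF : nondecreasing_seq (fun k => B `&` F k).
  by move=> i j ij; apply/subsetPset; apply: setIS; apply/subsetPset; exact: ndF.
pose m_ (k : nat) : {measure set 'rV[R]_n -> \bar R} := law P (measurable_funPT (X k)).
pose m := mseries m_ 0.
have c1 := nondecreasing_cvg_mu (mu := m) mBF (bigcup_measurable (fun k _ => mBF k)) ndBF.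
have c2 := nondecreasing_cvg_mu (mu := mu) mBF (bigcup_measurable (fun k _ => mBF k)) ndBF.
rewrite BFE in c1 c2.
apply: (cvg_unique _ c1) => //.
have c3 := cvgeZl (y := lam%:E) isT c2.
rewrite (_ : (m \o _) = (fun k => lam%:E * mu (B `&` F k))) //.
apply/funext => k /=; rewrite -mean_point_process//.
by apply: le_lt_trans (mF k).2; apply: le_measure; rewrite ?inE//; exact: (mF k).1.
Qed.

(** The sum of the laws of the X k equals lam times Lebesgue measure as a measure, so it integrates
    every nonnegative function; the separate laws stay unknown. *)
Lemma campbell (h : 'rV[R]_n -> \bar R) : measurable_fun setT h ->
  (forall x, 0 <= h x) ->
  \sum_(0 <= k <oo) \int[P]_w h (X k w) = lam%:E * \int[mu]_x h x.
Proof.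
move=> mh h0.
pose m_ (k : nat) : {measure set 'rV[R]_n -> \bar R} := law P (measurable_funPT (X k)).
have -> : \sum_(0 <= k <oo) \int[P]_w h (X k w) = \int[mseries m_ 0]_x h x.
  rewrite ge0_integral_measure_series//; apply: eq_eseriesr => k _.
  exact/esym/ge0_integral_law.
pose l := NngNum (ltW lam0).
rewrite -(ge0_integral_mscale mu measurableT l)//.
by apply: eq_measure_integral => B mB _; exact: mean_point_process_all.
Qed.

End campbell.

(** * Sums with independent amplitudes *)

Section amplitudes.
Context d d' (T : measurableType d) (V : measurableType d') (R : realType).
Variables (P : probability T R) (A : nat -> {RV P >-> R}) (X : nat -> {RV P >-> V}).
Hypotheses (indA : independent_RVs P A) (indAX : independent_seqs P A X).

(** The index [None] carries the whole sequence X, so that all positions together count as one more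
    independent component beside the single amplitudes. *)
Definition amplitude_events (i : option nat) : set (set T) :=
  if i is Some k then g_sigma_algebra_preimage (A k) else sigma_seq X.

Lemma measurable_sigma_seq d1 (T1 : measurableType d1) (Y : nat -> {RV P >-> T1}) E :
  sigma_seq Y E -> measurable E.
Proof.
apply: smallest_sub; first exact: sigma_algebra_measurable.
move=> B [k _ [C mC <-]]; exact: measurable_funP.
Qed.

Lemma measurable_amplitude_events i E : amplitude_events i E -> measurable E.
Proof.
case: i => [k|]; last exact: measurable_sigma_seq.
by move=> [C mC <-]; exact: measurable_funP.
Qed.

Lemma sigma_seq_setI d1 (T1 : measurableType d1) (Y : nat -> {RV P >-> T1}) E F :
  sigma_seq Y E -> sigma_seq Y F -> sigma_seq Y (E `&` F).
Proof.
move=> YE YF; rewrite -[E]setCK -[F]setCK -setCU; apply: sigma_algebraC.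
rewrite -bigcup2E; apply: sigma_algebra_bigcup => -[|[|k]]/=.
- exact: sigma_algebraC.
- exact: sigma_algebraC.
- exact: sigma_algebra0.
Qed.

Lemma sigma_seq_preimage d1 (T1 : measurableType d1) (Y : nat -> {RV P >-> T1}) k B :
  measurable B -> sigma_seq Y (Y k @^-1` B).
Proof.
move=> mB; apply: sub_sigma_algebra; exists k => //.
by exists B => //; rewrite setTI.
Qed.

(** An intersection of amplitude events lies in the sigma-algebra of the sequence A, so the
    independence of the two sequences splits off the index [None], and that of the amplitudes does
    the rest. *)
Lemma mutually_independent_amplitude_events :
  mutually_independent P amplitude_events.
Proof.
suff H (s : seq nat) E : uniq s ->
    (forall i, i \in s -> amplitude_events (Some i) (E (Some i))) ->
    sigma_seq A (\bigcap_(i in [set` s]) E (Some i)) /\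
    P (\bigcap_(i in [set` s]) E (Some i)) = (\prod_(i <- s) P (E (Some i)))%E.
  move=> s E us hE; pose t := pmap id s.
  have ut : uniq t by apply: (@pmap_uniq _ _ id Some) => // -[].
  have ht i : (i \in t) = (Some i \in s) by rewrite mem_pmap map_id.
  have [|At Pt] := H t E ut; first by move=> i; rewrite ht; exact: hE.
  have [nos|nos] := boolP (None \in s).
    have ps : perm_eq s (None :: map Some t).
      apply: uniq_perm => //=.
        by rewrite map_inj_uniq ?ut ?andbT; [apply/mapP => -[]|move=> ? ? []].
      move=> -[i|]; rewrite !inE ?nos//= mem_map ?ht//; by move=> ? ? [].
    rewrite (perm_big _ ps)/= big_cons big_map -Pt.
    rewrite muleC -indAX//; last exact: (hE None).
    congr (P _); apply/seteqP; split => [w h|w [h1 h2] [i|]/= iS].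
    - split; last exact: h.
      by move=> i /=; rewrite ht => iS; exact: h.
    - by apply: h1 => /=; rewrite ht.
    - exact: h2.
  have ps : perm_eq s (map Some t).
    apply: uniq_perm => //=; first by rewrite map_inj_uniq// => ? ? [].
    move=> -[i|]; first by rewrite mem_map ?ht// => ? ? [].
    by rewrite (negbTE nos); apply/esym/negbTE/mapP => -[].
  rewrite (perm_big _ ps)/= big_map -Pt.
  congr (P _); apply/seteqP; split => [w h i /=|w h [i|]/= iS].
  - by rewrite ht => iS; exact: h.
  - by apply: h => /=; rewrite ht.
  - by rewrite iS in nos.
move=> us hE; split; last exact: (indA us).
elim: s us hE => [_ _|k s IH /= /andP[_ us] hE].
  rewrite (_ : \bigcap_(i in _) _ = setT); last by apply/seteqP; split.
  by rewrite -setC0; apply: sigma_algebraC; exact: sigma_algebra0.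
rewrite (_ : \bigcap_(i in _) _ =
    E (Some k) `&` \bigcap_(i in [set` s]) E (Some i)).
  apply: sigma_seq_setI.
    by apply: sub_sigma_algebra; exists k => //; apply: hE; rewrite mem_head.
  by apply: IH => // i si; apply: hE; rewrite inE si orbT.
apply/seteqP; split => [x xE|x [xj xE] i /=].
  split; first by apply: xE => /=; rewrite mem_head.
  by move=> i /= is2; apply: xE => /=; rewrite inE is2 orbT.
by rewrite inE => /orP[/eqP ->//|/xE].
Qed.

Lemma Rintegral_sigma_seq_prod (F : set T) (s : seq nat) (u : nat -> R -> R) :
  sigma_seq X F -> uniq s -> (forall k, bounded_measurable (u k)) ->
  \int[P]_w (\1_F w * \prod_(k <- s) u k (A k w)) =
  fine (P F) * \prod_(k <- s) \int[P]_w u k (A k w).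
Proof.
move=> XF us bu; have mF := measurable_sigma_seq XF.
pose v (i : option nat) : T -> R :=
  if i is Some k then fun w => u k (A k w) else \1_F.
have := @mutually_independent_expectation_prod _ _ _ P _ amplitude_events v
  (None :: map Some s) mutually_independent_amplitude_events
  measurable_amplitude_events.
rewrite big_cons/= big_map Rintegral_indic// => <-.
- by apply: eq_Rintegral => w _; rewrite big_cons big_map.
- by rewrite map_inj_uniq ?us ?andbT; [apply/mapP => -[]|move=> ? ? []].
- move=> [k|] _; last exact: bounded_measurable_indic.
  exact: (bounded_measurable_comp (measurable_funPT (A k))).
- move=> [k|] _ r /=.
    have [mu _] := bu k.
    exists [set x | r <= u k x]; last by rewrite setTI.
    by rewrite -[Y in measurable Y]setTI; exact: measurable_fun_le.
  have [r0|r0] := leP r 0.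
    rewrite (_ : [set w | _] = setT).
      by rewrite -setC0; apply: sigma_algebraC; exact: sigma_algebra0.
    by apply/seteqP; split => // w _ /=; rewrite (le_trans r0)// indicE.
  have [r1|r1] := leP r 1.
    rewrite (_ : [set w | _] = F)//.
    apply/seteqP; split => w /=; rewrite indicE.
      by case: (boolP (w \in F)) => [/set_mem//|_]; rewrite leNgt r0.
    by move=> Fw; rewrite mem_set.
  rewrite (_ : [set w | _] = set0); first exact: sigma_algebra0.
  apply/seteqP; split => w //=; rewrite indicE => h.
  by have := lt_le_trans r1 h; case: (_ \in _); rewrite ?ltxx// ltr10.
Qed.

End amplitudes.

(** * Modulus and argument of the amplitude characteristic function *)

Section characteristic_polar.
Context (R : realType) (FP : probability R R).

Definition char_re (c : R) : R := \int[FP]_t cos (c * t).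
Definition char_im (c : R) : R := \int[FP]_t sin (c * t).

(** The argument will be a bare choice, with no measurability in c, which is why it is composed only
    with finite-valued functions. Its normalization at c = 0 lets points where f vanishes contribute
    the factor 1 and the argument 0. *)
Lemma char_polar_subproof (c : R) : exists z : R * R,
  [/\ 0 <= z.1, char_re c = z.1 * cos z.2, char_im c = z.1 * sin z.2 &
      c = 0 -> z = (1, 0)].
Proof.
have [->|c0] := eqVneq c 0; last first.
  have [r [b [r0 re im]]] := polar_coordinates (char_re c) (char_im c).
  by exists (r, b); split=> // /eqP; rewrite (negbTE c0).
exists (1, 0); split => //=; rewrite !mul1r ?cos0 ?sin0.
  rewrite /char_re; under eq_Rintegral do rewrite mul0r cos0.
  exact: Rintegral_probability_cst.
rewrite /char_im; under eq_Rintegral do rewrite mul0r sin0.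
exact: Rintegral_probability_cst.
Qed.

Definition char_polar (c : R) : R * R := projT1 (cid (char_polar_subproof c)).
Definition char_mod (c : R) : R := (char_polar c).1.
Definition char_arg (c : R) : R := (char_polar c).2.

Lemma char_mod_ge0 c : 0 <= char_mod c.
Proof. by rewrite /char_mod /char_polar; case: cid => z []. Qed.

Lemma char_reE c : char_re c = char_mod c * cos (char_arg c).
Proof. by rewrite /char_mod /char_arg /char_polar; case: cid => z []. Qed.

Lemma char_imE c : char_im c = char_mod c * sin (char_arg c).
Proof. by rewrite /char_mod /char_arg /char_polar; case: cid => z []. Qed.

Lemma char_mod0 : char_mod 0 = 1.
Proof. by rewrite /char_mod /char_polar; case: cid => z [/= _ _ _ z1]; rewrite z1. Qed.

Lemma char_arg0 : char_arg 0 = 0.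
Proof. by rewrite /char_arg /char_polar; case: cid => z [/= _ _ _ z1]; rewrite z1. Qed.

Lemma bounded_measurable_cos_scale (c : R) : bounded_measurable (fun t : R => cos (c * t)).
Proof. exact: bounded_measurable_cos. Qed.

Lemma bounded_measurable_sin_scale (c : R) : bounded_measurable (fun t : R => sin (c * t)).
Proof. exact: bounded_measurable_sin. Qed.

(* The modulus is the mean of [cos (c t - arg)]. *)
Lemma char_mod_le1 c : char_mod c <= 1.
Proof.
set b := char_arg c.
have bc := bounded_measurable_cos_scale c.
have bs := bounded_measurable_sin_scale c.
have -> : char_mod c = \int[FP]_t (cos b * cos (c * t) + sin b * sin (c * t)).
  rewrite bounded_RintegralD; try exact: bounded_measurableZ.
  rewrite !bounded_RintegralZ// -/(char_re c) -/(char_im c) char_reE char_imE -/b.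
  rewrite mulrCA (mulrCA (sin b)) -mulrDr -!expr2 cos2Dsin2 mulr1//.
rewrite -[leRHS](Rintegral_probability_cst FP); apply: le_bounded_Rintegral.
- by apply: bounded_measurableD; exact: bounded_measurableZ.
- exact: bounded_measurable_cst.
- by move=> t; rewrite -cosB cos_le1.
Qed.

End characteristic_polar.

Section conditional_characteristic.
Context d d' (T : measurableType d) (V : measurableType d') (R : realType).
Variables (P : probability T R) (A : nat -> {RV P >-> R}) (X : nat -> {RV P >-> V}).
Variable FP : probability R R.
Hypotheses (indA : independent_RVs P A) (indAX : independent_seqs P A X).
Hypothesis lawA : forall k, has_law P (A k) FP.

Lemma Rintegral_has_law k (u : R -> R) : bounded_measurable u ->
  \int[P]_w u (A k w) = \int[FP]_t u t.
Proof.
move=> bu; rewrite -(Rintegral_law P (measurable_funPT (A k)))// /Rintegral.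
by congr fine; apply: eq_measure_integral => B mB _; exact: lawA.
Qed.

Lemma Rintegral_cos_sum_amplitudes (F : set T) (s : seq nat) (c : nat -> R) (a : R) :
  sigma_seq X F -> uniq s ->
  \int[P]_w (\1_F w * cos (a + \sum_(k <- s) c k * A k w)) =
  fine (P F) * \prod_(k <- s) char_mod FP (c k) *
    cos (a + \sum_(k <- s) char_arg FP (c k)).
Proof.
move=> XF us; have mF := measurable_sigma_seq XF.
have mcA k : measurable_fun setT (fun w => c k * A k w).
  by apply: measurable_funM => //; exact: measurable_funPT.
rewrite -(@Rintegral_prod_amplitude_phase _ _ _ P _ s \1_F (fine (P F))
  (fun=> cst 1) (fun k w => c k * A k w) (fun k => char_mod FP (c k))
  (fun k => char_arg FP (c k)))//.
- by apply: eq_Rintegral => w _; rewrite [X in _ * X * _]big1 ?mulr1.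
- exact: bounded_measurable_indic.
- by move=> k; exact: bounded_measurable_cst.
- move=> e.
  pose u k t : R := if e k then cos (c k * t) else sin (c k * t).
  have bu k : bounded_measurable (u k).
    by rewrite /u; case: (e k);
      [exact: bounded_measurable_cos_scale|exact: bounded_measurable_sin_scale].
  transitivity (\int[P]_w (\1_F w * \prod_(k <- s) u k (A k w))).
    apply: eq_Rintegral => w _; congr (_ * _); apply: eq_bigr => k _.
    by rewrite /u mul1r.
  rewrite (Rintegral_sigma_seq_prod indA indAX)//; congr (_ * _); apply: eq_bigr => k _.
  rewrite Rintegral_has_law// /u.
  by case: (e k); rewrite -?char_reE -?char_imE.
Qed.

(** The amplitudes are integrated out with the positions given: exp(i A_k f(X_k)) is replaced by its
    conditional mean. Since f has finitely many values, plain events take the place of conditional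
    expectations. *)
Lemma Rintegral_cos_marked_sum (f : V -> R) (vs : seq R) :
  measurable_fun setT f -> uniq vs -> (forall x, f x \in vs) ->
  forall (s : seq nat) (a : R), uniq s ->
  \int[P]_w cos (a + \sum_(k <- s) A k w * f (X k w)) =
  \int[P]_w (\prod_(k <- s) char_mod FP (f (X k w)) *
             cos (a + \sum_(k <- s) char_arg FP (f (X k w)))).
Proof.
move=> mf uvs fvs s a us.
have mfX k : measurable_fun setT (fun w => f (X k w)).
  by apply: measurableT_comp => //; exact: measurable_funPT.
have mlevel v : measurable [set x | f x = v].
  by rewrite -[Y in measurable Y]setTI; exact: (mf measurableT [set v]).
have mcomp (h : R -> R) k : measurable_fun setT (fun w => h (f (X k w))).
  have E : (fun w => h (f (X k w))) =
      fun w => \sum_(v <- vs) h v * \1_(X k @^-1` [set x | f x = v]) w.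
    apply/funext => w; rewrite (bigD1_seq (f (X k w)))//= indicE mem_set//= mulr1.
    rewrite big1 ?addr0// => v vf; rewrite indicE memNset ?mulr0//= => fv.
    by rewrite fv eqxx in vf.
  rewrite E; apply: measurable_sum => v; apply: measurable_funM => //.
  apply: measurable_indic; rewrite -[Y in measurable Y]setTI.
  by apply: measurable_funP; [exact: measurableT|exact: mlevel].
pose lhs (F : set T) (c : nat -> R) s1 s2 (w : T) : R := \1_F w *
  cos (a + (\sum_(k <- s1) c k * A k w + \sum_(k <- s2) A k w * f (X k w))).
pose rhs (F : set T) (c : nat -> R) s1 s2 (w : T) : R := \1_F w *
  (\prod_(k <- s1) char_mod FP (c k) * \prod_(k <- s2) char_mod FP (f (X k w)) *
   cos (a + (\sum_(k <- s1) char_arg FP (c k) +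
             \sum_(k <- s2) char_arg FP (f (X k w))))).
have bL F c s1 s2 : measurable F -> bounded_measurable (lhs F c s1 s2).
  move=> mF; apply: bounded_measurableM; first exact: bounded_measurable_indic.
  apply: bounded_measurable_cos; apply: measurable_funD => //.
  apply: measurable_funD; apply: measurable_sum => k; apply: measurable_funM => //;
    exact: measurable_funPT.
have bR F c s1 s2 : measurable F -> bounded_measurable (rhs F c s1 s2).
  move=> mF; apply: bounded_measurableM; first exact: bounded_measurable_indic.
  apply: bounded_measurableM.
    apply: bounded_measurableZ; apply: bounded_measurable_prod => k _.
    split; first exact: mcomp.
    by exists 1 => w; rewrite ger0_norm ?char_mod_ge0// char_mod_le1.
  apply: bounded_measurable_cos; apply: measurable_funD => //.
  apply: measurable_funD => //; apply: measurable_sum => k; exact: mcomp.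
(* On the event [F] the points of [s1] have been given the fixed values [c], those of [s2] are still
   random. Each step splits the event according to the value of f at one more point. *)
suff H F c s1 s2 : sigma_seq X F -> uniq (s1 ++ s2) ->
    \int[P]_w lhs F c s1 s2 w = \int[P]_w rhs F c s1 s2 w.
  have XT : sigma_seq X setT.
    by rewrite -setC0; apply: sigma_algebraC; exact: sigma_algebra0.
  have := H setT (fun=> 0) [::] s XT us; rewrite /lhs /rhs => HT.
  transitivity (\int[P]_w lhs setT (fun=> 0) [::] s w).
    by apply: eq_Rintegral => w _; rewrite /lhs big_nil add0r indicE in_setT mul1r.
  rewrite /lhs HT; apply: eq_Rintegral => w _.
  by rewrite !big_nil add0r indicE in_setT !mul1r.
elim: s2 s1 c F {s us} => [|k s2 IH] s1 c F XF us.
  rewrite cats0 in us; rewrite /lhs /rhs.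
  under eq_Rintegral do rewrite big_nil addr0.
  under [in RHS]eq_Rintegral do rewrite !big_nil addr0 mulr1 mulrC.
  rewrite Rintegral_cos_sum_amplitudes//.
  rewrite bounded_RintegralZ; last first.
    exact/bounded_measurable_indic/(measurable_sigma_seq XF).
  by rewrite Rintegral_indic; [ring|exact: (measurable_sigma_seq XF)].
have mF := measurable_sigma_seq XF.
have XFv v : sigma_seq X (F `&` X k @^-1` [set x | f x = v]).
  by apply: sigma_seq_setI => //; exact: sigma_seq_preimage.
have us' : uniq ((k :: s1) ++ s2) by move: us; rewrite uniq_catC/= mem_cat uniq_catC orbC -mem_cat.
have ks1 : k \notin s1.
  by move: us' => /= /andP[]; rewrite mem_cat negb_or => /andP[].
pose c' v j := if j == k then v else c j.
have split1 w : \1_F w = \sum_(v <- vs) \1_(F `&` X k @^-1` [set x | f x = v]) w :> R.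
  rewrite (bigD1_seq (f (X k w)))//= big1 ?addr0.
    rewrite !indicE; congr (_%:R); congr nat_of_bool; apply/idP/idP => /set_mem.
      by move=> Fw; apply/mem_set; split.
    by move=> [Fw _]; exact/mem_set.
  by move=> v vf; rewrite indicE memNset//= => -[_ fv]; rewrite fv eqxx in vf.
have c's1 v j : j \in s1 -> c' v j = c j.
  by move=> js; rewrite /c'; case: eqVneq => // jk; rewrite -jk js in ks1.
transitivity (\int[P]_w \sum_(v <- vs)
    lhs (F `&` X k @^-1` [set x | f x = v]) (c' v) (k :: s1) s2 w).
  apply: eq_Rintegral => w _; rewrite /lhs split1 mulr_suml; apply: eq_bigr => v _.
  rewrite indicE; case: (boolP (w \in _)) => [/set_mem[_ /= fv]|_]; last by rewrite !mul0r.
  have e1 : \sum_(j <- s1) c' v j * A j w = \sum_(j <- s1) c j * A j w.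
    by apply: eq_big_seq => j js; rewrite c's1.
  rewrite !mul1r !big_cons e1 fv.
  by rewrite /c' eqxx; congr cos; ring.
transitivity (\int[P]_w \sum_(v <- vs)
    rhs (F `&` X k @^-1` [set x | f x = v]) (c' v) (k :: s1) s2 w).
  rewrite !bounded_Rintegral_sum; last 2 first.
  - by move=> v; apply: bR; exact: (measurable_sigma_seq (XFv v)).
  - by move=> v; apply: bL; exact: (measurable_sigma_seq (XFv v)).
  by apply: eq_bigr => v _; exact: IH.
apply: eq_Rintegral => w _; rewrite /rhs split1 mulr_suml; apply: eq_bigr => v _.
rewrite indicE; case: (boolP (w \in _)) => [/set_mem[_ /= fv]|_]; last by rewrite !mul0r.
have e1 : \prod_(j <- s1) char_mod FP (c' v j) = \prod_(j <- s1) char_mod FP (c j).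
  by apply: eq_big_seq => j js; rewrite c's1.
have e2 : \sum_(j <- s1) char_arg FP (c' v j) = \sum_(j <- s1) char_arg FP (c j).
  by apply: eq_big_seq => j js; rewrite c's1.
rewrite !mul1r !big_cons e1 e2 fv.
by rewrite /c' eqxx; congr (_ * cos _); ring.
Qed.

End conditional_characteristic.

(** * The characteristic function of a marked Poisson sum *)

Lemma Rintegral_simple d (T : measurableType d) (R : realType)
    (mu : {measure set T -> \bar R}) (I : Type) (s : seq I) (c : I -> R)
    (B : I -> set T) :
  (forall i, measurable (B i)) -> (forall i, mu (B i) < +oo)%E ->
  mu.-integrable setT (EFin \o (fun x => \sum_(i <- s) c i * \1_(B i) x)) /\
  \int[mu]_x (\sum_(i <- s) c i * \1_(B i) x) =
  \sum_(i <- s) c i * fine (mu (B i)).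
Proof.
move=> mB Boo.
have i1 i : mu.-integrable setT (EFin \o (\1_(B i) : T -> R)).
  apply/integrableP; split; first exact/measurable_EFinP/measurable_indic.
  under eq_integral do rewrite /= ger0_norm ?indicE//.
  under eq_integral do rewrite -indicE.
  by rewrite integral_indic// setIT.
have ic i : mu.-integrable setT (EFin \o (fun x => c i * \1_(B i) x)).
  exact: integrable_EFinZ.
elim: s => [|i s [IHi IH]].
  rewrite big_nil; under eq_Rintegral do rewrite big_nil.
  rewrite [LHS]/Rintegral integral0; split => //.
  rewrite (_ : EFin \o _ = cst 0%E); first exact: integrable0.
  by apply/funext => x /=; rewrite big_nil.
rewrite big_cons -IH; split.
  by under eq_fun do rewrite big_cons; have := integrableD measurableT (ic i) IHi; apply: eq_integrable.
under eq_Rintegral do rewrite big_cons.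
rewrite RintegralD// RintegralZl//; congr (_ * _ + _).
by rewrite /Rintegral integral_indic// setIT.
Qed.

(** Markov's inequality: on the level set |h| is the positive constant |v|. *)
Lemma integrable_level_lty d (T : measurableType d) (R : realType)
    (mu : {measure set T -> \bar R}) (h : T -> R) (v : R) :
  mu.-integrable setT (EFin \o h) -> v != 0 ->
  (mu [set x | h x = v] < +oo)%E.
Proof.
move=> hi v0; have mh : measurable_fun setT h.
  by apply/measurable_EFinP; exact: measurable_int hi.
have mB : measurable [set x | h x = v].
  by rewrite -[Y in measurable Y]setTI; exact: (mh measurableT [set v]).
have v_gt0 : 0 < `|v| by rewrite normr_gt0.
have : (`|v|%:E * mu [set x | h x = v] < +oo)%E.
  have /integrableP[_] := hi; apply: le_lt_trans.
  rewrite -[X in mu X]setIT -integral_indic// -ge0_integralZl//; last first.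
    by apply/measurable_EFinP; exact: measurable_indic.
  apply: ge0_le_integral => //.
  - by apply/measurable_EFinP; apply: measurable_funM => //; exact: measurable_indic.
  - by apply/measurable_EFinP; apply: measurableT_comp.
  - move=> x _ /=; rewrite -EFinM lee_fin indicE.
    by case: (boolP (x \in _)) => [/set_mem/= ->|_]; rewrite ?mulr1 ?mulr0.
by case: (mu _) (measure_ge0 mu [set x | h x = v]) => [r||]//= _; rewrite ?ltry ?gt0_muley.
Qed.

Section char_lipschitz.
Context (R : realType) (FP : probability R R).
Hypothesis iFP : FP.-integrable setT (EFin \o (fun t : R => t)).

Definition mean_amplitude : R := \int[FP]_t `|t|.
Local Notation p := mean_amplitude.

Let inFP : FP.-integrable setT (EFin \o (fun t : R => `|t|)).
Proof. exact: (integrable_norm iFP). Qed.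

Lemma mean_amplitude_ge0 : 0 <= p.
Proof. by apply: Rintegral_ge0. Qed.

Lemma EFin_mean_amplitude : (\int[FP]_t `|t|%:E)%E = p%:E.
Proof. by rewrite /mean_amplitude /Rintegral fineK//; exact: integrable_fin_num. Qed.

Lemma sin_lipschitz (x y : R) : `|sin x - sin y| <= `|x - y|.
Proof.
have sinE (z : R) : sin z = cos (z - pi / 2).
  by rewrite cosB cos_pihalf sin_pihalf mulr0 add0r mulr1.
rewrite !sinE (le_trans (cos_lipschitz _ _))//.
by rewrite le_eqVlt; apply/orP; left; apply/eqP; congr `|_|; ring.
Qed.

Let Rintegral_lipschitz (h : R -> R) c c' :
  (forall c, bounded_measurable (fun t : R => h (c * t))) ->
  (forall x y, `|h x - h y| <= `|x - y|) ->
  `|\int[FP]_t h (c * t) - \int[FP]_t h (c' * t)| <= p * `|c - c'|.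
Proof.
move=> bh lh; rewrite (le_trans (ler_bounded_dist_Rintegral FP (bh c) (bh c')))//.
rewrite mulrC -RintegralZl//; apply: le_Rintegral => //.
- apply: bounded_measurable_integrable; apply: bounded_measurable_norm.
  exact: bounded_measurableB.
- exact: integrable_EFinZ.
- by move=> t _; rewrite (le_trans (lh _ _))// -mulrBl normrM.
Qed.

Lemma char_re_lipschitz c c' :
  `|char_re FP c - char_re FP c'| <= p * `|c - c'|.
Proof.
apply: (Rintegral_lipschitz (h := @cos R)); last exact: cos_lipschitz.
exact: bounded_measurable_cos_scale.
Qed.

Lemma char_im_lipschitz c c' :
  `|char_im FP c - char_im FP c'| <= p * `|c - c'|.
Proof.
apply: (Rintegral_lipschitz (h := @sin R)); last exact: sin_lipschitz.
exact: bounded_measurable_sin_scale.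
Qed.

Let lipschitz_measurable (h : R -> R) :
  (forall c c', `|h c - h c'| <= p * `|c - c'|) -> measurable_fun setT h.
Proof.
move=> hl; apply: continuous_measurable_fun => x.
apply/cvgrPdist_le => e e0.
have p1 : 0 < p + 1 by rewrite ltr_wpDl// mean_amplitude_ge0.
near=> y; rewrite (le_trans (hl _ _))//.
apply: (@le_trans _ _ ((p + 1) * `|x - y|)); first by rewrite ler_wpM2r// lerDl.
rewrite mulrC -ler_pdivlMr//; near: y.
apply/nbhs_ballP; exists (e / (p + 1)) => [|y /ltW //]; exact: divr_gt0.
Unshelve. all: by end_near. Qed.

Lemma measurable_char_re : measurable_fun setT (char_re FP).
Proof. exact: (lipschitz_measurable char_re_lipschitz). Qed.

Lemma measurable_char_im : measurable_fun setT (char_im FP).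
Proof. exact: (lipschitz_measurable char_im_lipschitz). Qed.

Lemma char_re0 : char_re FP 0 = 1.
Proof. by rewrite char_reE char_mod0 char_arg0 cos0 mulr1. Qed.

Lemma char_im0 : char_im FP 0 = 0.
Proof. by rewrite char_imE char_arg0 sin0 mulr0. Qed.

Context d (V : measurableType d) (mu : {measure set V -> \bar R}).

(** A Lipschitz h vanishing at 0 satisfies |h(f)| <= p |f|; this is why 1 is subtracted from the
    real part of the characteristic function. *)
Let integrable_lipschitz (h : R -> R) (f : V -> R) :
  (forall c c', `|h c - h c'| <= p * `|c - c'|) -> h 0 = 0 ->
  mu.-integrable setT (EFin \o f) -> mu.-integrable setT (EFin \o (h \o f)).
Proof.
move=> hl h0 fi; have mf : measurable_fun setT f.
  by apply/measurable_EFinP; exact: measurable_int fi.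
apply: (le_integrable measurableT _ _ (integrable_EFinZ p (integrable_norm fi))).
  by apply/measurable_EFinP; apply: measurableT_comp => //; exact: lipschitz_measurable.
move=> x _ /=; rewrite lee_fin [leRHS]ger0_norm; last by rewrite mulr_ge0// mean_amplitude_ge0.
by have := hl (f x) 0; rewrite h0 !subr0.
Qed.

Let dist_Rintegral_lipschitz (h : R -> R) (f g : V -> R) :
  (forall c c', `|h c - h c'| <= p * `|c - c'|) -> h 0 = 0 ->
  mu.-integrable setT (EFin \o f) -> mu.-integrable setT (EFin \o g) ->
  `|\int[mu]_x h (f x) - \int[mu]_x h (g x)| <= p * \int[mu]_x `|f x - g x|.
Proof.
move=> hl h0 fi gi.
have hf := integrable_lipschitz hl h0 fi; have hg := integrable_lipschitz hl h0 gi.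
have fg : mu.-integrable setT (EFin \o (fun x => f x - g x)).
  by have := integrableB measurableT fi gi; apply: eq_integrable.
have hfg : mu.-integrable setT (EFin \o (fun x => h (f x) - h (g x))).
  by have := integrableB measurableT hf hg; apply: eq_integrable.
rewrite -RintegralB// (le_trans (le_normr_Rintegral _ hfg))//.
rewrite -RintegralZl//; last exact: (integrable_norm fg).
apply: le_Rintegral => //.
- exact: (integrable_norm hfg).
- by apply: integrable_EFinZ; exact: (integrable_norm fg).
Qed.

Let lip1 c c' : `|(char_re FP c - 1) - (char_re FP c' - 1)| <= p * `|c - c'|.
Proof.
rewrite (_ : _ - _ = char_re FP c - char_re FP c'); last by ring.
exact: char_re_lipschitz.
Qed.

Let zero1 : char_re FP 0 - 1 = 0. Proof. by rewrite char_re0 subrr. Qed.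

Lemma integrable_char_re f : mu.-integrable setT (EFin \o f) ->
  mu.-integrable setT (EFin \o (fun x => char_re FP (f x) - 1)).
Proof. exact: (integrable_lipschitz lip1 zero1). Qed.

Lemma integrable_char_im f : mu.-integrable setT (EFin \o f) ->
  mu.-integrable setT (EFin \o (fun x => char_im FP (f x))).
Proof. exact: (integrable_lipschitz char_im_lipschitz char_im0). Qed.

Lemma dist_Rintegral_char_re f g : mu.-integrable setT (EFin \o f) ->
  mu.-integrable setT (EFin \o g) ->
  `|\int[mu]_x (char_re FP (f x) - 1) - \int[mu]_x (char_re FP (g x) - 1)| <=
  p * \int[mu]_x `|f x - g x|.
Proof. exact: (dist_Rintegral_lipschitz lip1 zero1). Qed.

Lemma dist_Rintegral_char_im f g : mu.-integrable setT (EFin \o f) ->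
  mu.-integrable setT (EFin \o g) ->
  `|\int[mu]_x char_im FP (f x) - \int[mu]_x char_im FP (g x)| <=
  p * \int[mu]_x `|f x - g x|.
Proof. exact: (dist_Rintegral_lipschitz char_im_lipschitz char_im0). Qed.

End char_lipschitz.

Section shot_noise_characteristic.
Context d (T : measurableType d) (R : realType) (n : nat).
Variables (P : probability T R) (lam : R) (X : nat -> {RV P >-> 'rV[R]_n})
  (A : nat -> {RV P >-> R}) (FP : probability R R).
Hypotheses (lam0 : 0 < lam) (poisX : poisson_process P lam X).
Hypotheses (indA : independent_RVs P A) (indAX : independent_seqs P A X).
Hypothesis lawA : forall k, has_law P (A k) FP.
Local Notation mu := (@lebesgue_rV R n).

(** A convergent sequence of integers is eventually constant, so a finite count is reached after
    finitely many points. *)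
Lemma point_process_count (B : set 'rV[R]_n) w m :
  point_process X B w = m%:R%:E ->
  \forall N \near \oo, (\sum_(0 <= k < N) (X k w \in B))%N = m.
Proof.
move=> Bm.
have c1 : (\sum_(0 <= k < N) (\d_(X k w) B : \bar R))%E @[N --> \oo] --> (m%:R%:E : \bar R).
  by rewrite -Bm; apply: is_cvg_nneseries.
have c2 : ((\sum_(0 <= k < N) (X k w \in B))%N%:R : R) @[N --> \oo] --> (m%:R : R).
  have := fine_cvg c1; rewrite (_ : fine \o _ = fun N =>
      (\sum_(0 <= k < N) (X k w \in B))%N%:R); first by apply.
  apply/funext => N /=; rewrite natr_sum -[RHS]/(fine _%:E) -sumEFin.
  by congr fine; apply: eq_bigr => k _; rewrite diracE.
have /cvgrPdist_lt/(_ 1 ltr01) := c2; apply: filterS => N.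
rewrite ltr_distl => /andP[h1 h2]; apply/eqP; rewrite eqn_leq.
by rewrite -ltnS -(ltr_nat R) -natr1 -ltrBlDr h1 -ltnS -(ltr_nat R) -natr1 h2.
Qed.

Lemma cvg_characteristic_simple (f : 'rV[R]_n -> R) (vs : seq R) :
  measurable_fun setT f -> uniq vs -> (forall x, f x \in vs) ->
  (forall v : R, v != 0 -> (mu [set x | f x = v] < +oo)%E) ->
  forall a : R,
  \int[P]_w cos (a + \sum_(0 <= k < N) A k w * f (X k w)) @[N --> \oo] -->
  expR (lam * \int[mu]_x (char_re FP (f x) - 1)) *
    cos (a + lam * \int[mu]_x char_im FP (f x)).
Proof.
move=> mf uvs fvs fin a.
(* The value 0 is left out: its level set may have infinite measure, hence no Poisson count. *)
pose vs' := [seq v <- vs | v != 0]; pose m := size vs'.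
have uvs' : uniq vs' by rewrite filter_uniq.
pose v (i : 'I_m) : R := vs'`_i.
have v0 i : v i != 0 by have := mem_nth 0 (ltn_ord i); rewrite mem_filter => /andP[].
have vinj : injective v.
  by move=> i j /eqP; rewrite nth_uniq// => /eqP ij; exact/val_inj.
have vsurj x : f x != 0 -> exists i, f x = v i.
  move=> fx0; have fx : f x \in vs' by rewrite mem_filter fx0 fvs.
  have fi : (index (f x) vs' < m)%N by rewrite index_mem.
  by exists (Ordinal fi); rewrite /v /= nth_index.
pose B i := [set x | f x = v i].
have mB i : measurable (B i).
  by rewrite -[Y in measurable Y]setTI; exact: (mf measurableT [set v i]).
have Boo i : (mu (B i) < +oo)%E by exact: fin.
have tB : trivIset setT B.
  apply/trivIsetP => i j _ _ ij; rewrite -subset0 => x []; rewrite /B/= => -> /vinj.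
  exact/eqP.
have decomp (h : R -> R) x : h 0 = 0 -> h (f x) = \sum_i h (v i) * \1_(B i) x.
  move=> h0; have [fx0|/vsurj[i fxi]] := eqVneq (f x) 0.
    rewrite fx0 h0 big1// => i _; rewrite indicE memNset ?mulr0//.
    by rewrite /B/= fx0 => /esym/eqP; rewrite (negbTE (v0 i)).
  rewrite (bigD1 i)//= indicE mem_set// mulr1 fxi big1 ?addr0// => j ji.
  rewrite indicE memNset ?mulr0// /B/= fxi => /vinj ij.
  by rewrite ij eqxx in ji.
pose N i := point_process X (B i).
have mN i : measurable_fun setT (N i) by exact: measurable_point_process.
have N0 i w : (0 <= N i w)%E by apply: nneseries_ge0.
pose r i := lam * fine (mu (B i)).
have r0 i : 0 <= r i by rewrite mulr_ge0// ?ltW// fine_ge0.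
have lawN i k : P [set w | N i w = k%:R%:E] = poisson_prob (r i) 0 [set k].
  by have [+ _] := poisX; apply.
pose M i w := Num.truncn (fine (N i w)).
pose rho i := char_mod FP (v i); pose ph i := char_arg FP (v i).
have rho01 i : 0 <= rho i <= 1 by rewrite char_mod_ge0 char_mod_le1.
have brho i : bounded_measurable (fun w => rho i ^+ M i w).
  split; first exact: measurableT_comp (measurable_truncn_fine _) (mN i).
  have /andP[? ?] := rho01 i.
  by exists 1 => w; rewrite ger0_norm ?exprn_ge0// exprn_ile1.
have mph i : measurable_fun setT (fun w => (M i w)%:R * ph i).
  exact: measurableT_comp (measurable_truncn_fine (fun k => k%:R * ph i)) (mN i).
(* The limit of the integrands: with full counts of the level sets, it is the real part of a product
   of powers whose exponents are independent Poisson variables, and its mean is explicit. *)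
pose G w := \prod_i rho i ^+ M i w * cos (a + \sum_i (M i w)%:R * ph i).
have bG : bounded_measurable G.
  apply: bounded_measurableM; first exact: bounded_measurable_prod.
  by apply: bounded_measurable_cos; apply: measurable_funD => //; exact: measurable_sum.
have intG : \int[P]_w G w = expR (lam * \int[mu]_x (char_re FP (f x) - 1)) *
    cos (a + lam * \int[mu]_x char_im FP (f x)).
  have charN i (b : R) : \int[P]_w (rho i ^+ M i w * cos (b + (M i w)%:R * ph i)) =
      expR (r i * (char_re FP (v i) - 1)) * cos (b + r i * char_im FP (v i)).
    rewrite (poisson_count_characteristic (mN i) (r0 i) (lawN i))//.
    by rewrite -char_reE -char_imE.
  have sinE (x : R) : sin x = cos (- (pi / 2) + x).
    by rewrite addrC cosB cos_pihalf sin_pihalf mulr0 add0r mulr1.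
  rewrite /G.
  have := @Rintegral_prod_amplitude_phase _ _ _ P 'I_m (index_enum 'I_m)
    (cst 1) 1 (fun i w => rho i ^+ M i w) (fun i w => (M i w)%:R * ph i)
    (fun i => expR (r i * (char_re FP (v i) - 1)))
    (fun i => r i * char_im FP (v i)).
  move=> /(_ (index_enum_uniq _) (bounded_measurable_cst _ _) brho mph).
  have prodrule (e : 'I_m -> bool) :
      \int[P]_w (cst 1 w * \prod_i
        (rho i ^+ M i w * if e i then cos ((M i w)%:R * ph i) else sin ((M i w)%:R * ph i))) =
      1 * \prod_i (expR (r i * (char_re FP (v i) - 1)) *
        if e i then cos (r i * char_im FP (v i)) else sin (r i * char_im FP (v i))).
    rewrite mul1r; under eq_Rintegral do rewrite mul1r.
    pose h i (k : nat) : R :=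
      rho i ^+ k * if e i then cos (k%:R * ph i) else sin (k%:R * ph i).
    have [_ /(_ m B (fun i => conj (mB i) (Boo i)) tB) indN] := poisX.
    rewrite (@mutually_independent_expectation_prod _ _ _ P _
      (fun i => g_sigma_algebra_preimage (N i)) (fun i w => h i (M i w)) _ indN).
    - apply: eq_bigr => i _; rewrite /h; case: (e i).
        have := charN i 0; rewrite add0r => <-.
        by apply: eq_Rintegral => w _; rewrite add0r.
      by rewrite sinE -charN; apply: eq_Rintegral => w _; rewrite sinE.
    - by move=> i Y [C mC <-]; exact: mN.
    - exact: index_enum_uniq.
    - move=> i _; apply: bounded_measurableM => //; case: (e i).
        exact: bounded_measurable_cos.
      exact: bounded_measurable_sin.
    - move=> i _ q; exists [set y | q <= h i (Num.truncn (fine y))]; last by rewrite setTI.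
      rewrite -[Y in measurable Y]setTI; apply: measurable_fun_le => //.
      exact: measurable_truncn_fine.
  move=> /(_ prodrule a).
  under eq_Rintegral do rewrite /= mul1r.
  move=> ->; rewrite mul1r.
  have cre0 : char_re FP 0 - 1 = 0 by rewrite char_reE char_mod0 char_arg0 cos0 mulr1 subrr.
  have cim0 : char_im FP 0 = 0 by rewrite char_imE char_arg0 sin0 mulr0.
  under [in RHS]eq_Rintegral do rewrite (decomp (fun c => char_re FP c - 1))//.
  under [X in _ = _ * cos (_ + _ * X)]eq_Rintegral do rewrite (decomp (char_im FP))//.
  rewrite !(Rintegral_simple _ _ mB Boo).2.
  rewrite -expR_sum; congr (expR _ * cos (_ + _)).
    by rewrite mulr_sumr; apply: eq_bigr => i _; rewrite /r; ring.
  by rewrite mulr_sumr; apply: eq_bigr => i _; rewrite /r; ring.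
rewrite -intG.
(* The conditional mean of the first K factors, given the positions. Regrouped by levels in [FE], it
   equals [G] as soon as the first K points exhaust the level sets. *)
pose F K w := \prod_(0 <= k < K) char_mod FP (f (X k w)) *
  cos (a + \sum_(0 <= k < K) char_arg FP (f (X k w))).
have -> : (fun K => \int[P]_w cos (a + \sum_(0 <= k < K) A k w * f (X k w))) =
    (fun K => \int[P]_w F K w).
  apply/funext => K.
  exact: (Rintegral_cos_marked_sum indA indAX lawA mf uvs fvs _ (iota_uniq _ _)).
have FE K w : F K w =
   \prod_i rho i ^+ (\sum_(0 <= k < K) (X k w \in B i)) *
   cos (a + \sum_i (\sum_(0 <= k < K) (X k w \in B i))%N%:R * ph i).
  rewrite /F; congr (_ * cos (_ + _)).
    under [RHS]eq_bigr do rewrite expr_sum.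
    rewrite exchange_big/=; apply: eq_bigr => k _.
    have [fx0|/vsurj[i fxi]] := eqVneq (f (X k w)) 0.
      rewrite fx0 char_mod0 big1// => i _; rewrite memNset ?expr0//.
      by rewrite /B/= fx0 => /esym/eqP; rewrite (negbTE (v0 i)).
    rewrite (bigD1 i)//= mem_set// expr1 fxi big1 ?mulr1// => j ji.
    rewrite memNset ?expr0// /B/= fxi => /vinj ij.
    by rewrite ij eqxx in ji.
  under [RHS]eq_bigr do rewrite natr_sum mulr_suml.
  rewrite exchange_big/=; apply: eq_bigr => k _.
  rewrite (decomp (char_arg FP)) ?char_arg0//; apply: eq_bigr => i _.
  by rewrite mulrC indicE.
apply: (@dominated_convergence_Rintegral _ _ _ P _ _ (cst 1) _ _ _ _ _).2.
- move=> K; rewrite (_ : F K = fun w => \prod_i rho i ^+ (\sum_(0 <= k < K) (X k w \in B i)) *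
   cos (a + \sum_i (\sum_(0 <= k < K) (X k w \in B i))%N%:R * ph i)); last exact/funext.
  have mcount i (h : nat -> R) :
      measurable_fun setT (fun w => h (\sum_(0 <= k < K) (X k w \in B i))%N).
    have E w : h (\sum_(0 <= k < K) (X k w \in B i))%N =
        h (Num.truncn (\sum_(0 <= k < K) \1_(X k @^-1` B i) w : R)).
      rewrite (_ : \sum_(0 <= k < K) \1_(X k @^-1` B i) w =
        (\sum_(0 <= k < K) (X k w \in B i))%N%:R) ?natrK//.
      by rewrite natr_sum.
    under eq_fun do rewrite E.
    have ms : measurable_fun setT (fun w => (\sum_(0 <= k < K) \1_(X k @^-1` B i) w : R)%:E).
      apply/measurable_EFinP; apply: measurable_sum => k; apply: measurable_indic.
      rewrite -[Y in measurable Y]setTI.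
      by apply: measurable_funP; [exact: measurableT|exact: mB].
    exact: measurableT_comp (measurable_truncn_fine h) ms.
  apply: measurable_funM.
    by apply: measurable_prod => i _; exact: (mcount i (fun k => rho i ^+ k)).
  apply: (bounded_measurable_cos _).1; apply: measurable_funD => //.
  by apply: measurable_sum => i; exact: (mcount i (fun k => k%:R * ph i)).
- by have [] := bG.
- have : {ae P, forall w, forall i, exists k : nat, N i w = k%:R%:E}.
    apply: filter_forall => i.
    exact: (poisson_count_ae_nat (mN i) (r0 i) (lawN i)).
  apply: filterS => w hw; apply: cvg_near_cst.
  have : \forall K \near \oo, forall i, (\sum_(0 <= k < K) (X k w \in B i))%N = M i w.
    apply: filter_forall => i; have [k Nk] := hw i.
    by rewrite /M Nk natrK; exact: point_process_count.
  apply: filterS => K hK; rewrite FE /G.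
  by congr (_ * cos (_ + _)); apply: eq_bigr => i _; rewrite hK.
- exact: bounded_measurable_integrable (bounded_measurable_cst _ _).
- move=> K w; rewrite /F normrM mulr_ile1// ?cos_max// normr_prod.
  by apply: prodr_ile1 => k; rewrite normr_ge0/= ger0_norm ?char_mod_ge0// char_mod_le1.
Qed.

Hypothesis A0 : forall k w, 0 <= A k w.
Hypothesis iFP : FP.-integrable setT (EFin \o (fun t : R => t)).
Local Notation p := (mean_amplitude FP).

Lemma integral_amplitude k : (\int[P]_w (A k w)%:E)%E = p%:E.
Proof.
rewrite -EFin_mean_amplitude//.
transitivity (\int[law P (measurable_funPT (A k))]_t `|t|%:E)%E.
  rewrite ge0_integral_law//.
    by apply: eq_integral => w _; rewrite ger0_norm.
  by apply/measurable_EFinP; exact: normr_measurable.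
by apply: eq_measure_integral => B mB _; exact: lawA.
Qed.

Lemma campbell_marked (h : 'rV[R]_n -> \bar R) : measurable_fun setT h ->
  (forall x, 0 <= h x)%E ->
  (\sum_(0 <= k <oo) \int[P]_w ((A k w)%:E * h (X k w)) =
   p%:E * (lam%:E * \int[mu]_x h x))%E.
Proof.
move=> mh h0; rewrite -(campbell lam0 poisX mh h0) -nneseriesZl; last first.
  by move=> k _; apply: integral_ge0.
apply: eq_eseriesr => k _; rewrite -(integral_amplitude k).
under eq_integral => w _ do rewrite -{1}(ger0_norm (A0 k w)).
rewrite (@ge0_expectation_mul _ _ _ _ _ _ _ P (A k) (X k) _ _ (fun t => `|t|%:E) h)//.
- by congr (_ * _)%E; apply: eq_integral => w _; rewrite ger0_norm.
- move=> B1 B2 mB1 mB2; apply: indAX; exact: sigma_seq_preimage.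
- by apply/measurable_EFinP; exact: normr_measurable.
Qed.

(** The cosine is 1-Lipschitz, and Campbell's formula bounds the mean of the sum of A_k |f(X_k) -
    g(X_k)| over all k. The bound is therefore uniform in N, which allows exchanging the limit in N
    with the approximation of f. *)
Lemma dist_characteristic_le (f g : 'rV[R]_n -> R) (a : R) N :
  mu.-integrable setT (EFin \o f) -> mu.-integrable setT (EFin \o g) ->
  `|\int[P]_w cos (a + \sum_(0 <= k < N) A k w * f (X k w)) -
    \int[P]_w cos (a + \sum_(0 <= k < N) A k w * g (X k w))| <=
  lam * (p * \int[mu]_x `|f x - g x|).
Proof.
move=> fi gi.
have mf : measurable_fun setT f by apply/measurable_EFinP; exact: measurable_int fi.
have mg : measurable_fun setT g by apply/measurable_EFinP; exact: measurable_int gi.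
have fg : mu.-integrable setT (EFin \o (fun x => `|f x - g x|)).
  by apply: integrable_norm; have := integrableB measurableT fi gi; apply: eq_integrable.
have mh : measurable_fun setT (fun x => `|f x - g x|%:E).
  by apply/measurable_EFinP; apply: measurableT_comp => //; exact: measurable_funB.
have mS (h : 'rV[R]_n -> R) : measurable_fun setT h ->
    measurable_fun setT (fun w => a + \sum_(0 <= k < N) A k w * h (X k w)).
  move=> hm; apply: measurable_funD => //; apply: measurable_sum => k.
  by apply: measurable_funM; [exact: measurable_funPT|
    apply: measurableT_comp => //; exact: measurable_funPT].
have bf := bounded_measurable_cos (mS f mf); have bg := bounded_measurable_cos (mS g mg).
rewrite (le_trans (ler_bounded_dist_Rintegral P bf bg))//.
rewrite -lee_fin -EFin_bounded_Rintegral; last first.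
  by apply: bounded_measurable_norm; exact: bounded_measurableB.
have mt k : measurable_fun setT (fun w => ((A k w)%:E * `|f (X k w) - g (X k w)|%:E)%E).
  apply: emeasurable_funM; first by apply/measurable_EFinP; exact: measurable_funPT.
  by apply: measurableT_comp mh _; exact: measurable_funPT.
apply: (@le_trans _ _ (\int[P]_w (\sum_(0 <= k < N)
    ((A k w)%:E * `|f (X k w) - g (X k w)|%:E))%E)%E).
  apply: ge0_le_integral => //.
  - apply/measurable_EFinP; apply: measurableT_comp => //.
    by apply: measurable_funB; [have [] := bf|have [] := bg].
  - exact: emeasurable_sum.
  - move=> w _; rewrite (le_trans (y := `|\sum_(0 <= k < N) A k w * (f (X k w) - g (X k w))|%:E))//.
      rewrite lee_fin (le_trans (cos_lipschitz _ _))//.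
      rewrite opprD addrACA subrr add0r -sumrB.
      rewrite le_eqVlt; apply/orP; left; apply/eqP; congr `|_|.
      by apply: eq_bigr => k _; rewrite mulrBr.
    rewrite (_ : \sum_(0 <= k < N) _ =
      (\sum_(0 <= k < N) A k w * `|f (X k w) - g (X k w)|)%:E); last first.
      by rewrite -sumEFin; apply: eq_bigr => k _; rewrite EFinM.
    rewrite lee_fin (le_trans (ler_norm_sum _ _ _))//.
    by apply: ler_sum => k _; rewrite normrM ger0_norm.
rewrite ge0_integral_sum//; last by move=> k w _; rewrite mule_ge0// lee_fin.
rewrite (le_trans (nneseries_lim_ge _ _))//.
  by move=> k _ _; apply: integral_ge0 => w _; rewrite mule_ge0// lee_fin.
rewrite (campbell_marked (h := fun x => `|f x - g x|%:E) mh)// (_ : (\int[mu]_x `|f x - g x|%:E)%E =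
    (\int[mu]_x `|f x - g x|)%:E); last first.
  by rewrite /Rintegral fineK//; exact: integrable_fin_num.
by rewrite -!EFinM lee_fin mulrCA.
Qed.

Import HBSimple.

Lemma cvg_characteristic (f : 'rV[R]_n -> R) (a : R) :
  mu.-integrable setT (EFin \o f) ->
  \int[P]_w cos (a + \sum_(0 <= k < N) A k w * f (X k w)) @[N --> \oo] -->
  expR (lam * \int[mu]_x (char_re FP (f x) - 1)) *
    cos (a + lam * \int[mu]_x char_im FP (f x)).
Proof.
move=> fi.
pose L (h : 'rV[R]_n -> R) := expR (lam * \int[mu]_x (char_re FP (h x) - 1)) *
    cos (a + lam * \int[mu]_x char_im FP (h x)).
have [g [gi _ gL1]] := approximation_sfun_integrable measurableT fi.
pose D j := \int[mu]_x `|f x - g j x|.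
have cD : D j @[j --> \oo] --> (0 : R).
  exact: (fine_cvg gL1).
have cgL j : \int[P]_w cos (a + \sum_(0 <= k < N) A k w * g j (X k w)) @[N --> \oo] --> L (g j).
  have mgj : measurable_fun setT (g j) by exact: measurable_funPT.
  apply: (cvg_characteristic_simple (vs := finmap.enum_fset (fset_set (range (g j))))) => //.
  - exact: finmap.fset_uniq.
  - by move=> x; rewrite in_fset_set ?mem_set//; exact: fimfunP.
  - by move=> v v0; exact: (integrable_level_lty (gi j)).
have cpD : p * D j @[j --> \oo] --> (0 : R).
  by rewrite -(mulr0 p); apply: cvgM => //; exact: cvg_cst.
have cre : \int[mu]_x (char_re FP (g j x) - 1) @[j --> \oo] -->
    \int[mu]_x (char_re FP (f x) - 1).
  apply/cvgrPdist_le => e e0; have /cvgrPdist_le/(_ e e0) := cpD; apply: filterS => j.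
  rewrite sub0r normrN => /(le_trans (ler_norm _)); apply: le_trans.
  exact: dist_Rintegral_char_re.
have cim : \int[mu]_x char_im FP (g j x) @[j --> \oo] -->
    \int[mu]_x char_im FP (f x).
  apply/cvgrPdist_le => e e0; have /cvgrPdist_le/(_ e e0) := cpD; apply: filterS => j.
  rewrite sub0r normrN => /(le_trans (ler_norm _)); apply: le_trans.
  exact: dist_Rintegral_char_im.
have cL : L (g j) @[j --> \oo] --> L f.
  apply: cvgM.
    by apply: continuous_cvg; [exact: continuous_expR|apply: cvgM => //; exact: cvg_cst].
  apply: continuous_cvg; first exact: continuous_cos.
  by apply: cvgD; [exact: cvg_cst|apply: cvgM => //; exact: cvg_cst].
have clD : lam * (p * D j) @[j --> \oo] --> (0 : R).
  by rewrite -(mulr0 lam); apply: cvgM => //; exact: cvg_cst.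
apply/cvgrPdist_le => e e0.
have e3 : 0 < e / 3 by rewrite divr_gt0.
have /cvgrPdist_le/(_ _ e3) h1 := clD.
have /cvgrPdist_le/(_ _ e3) h2 := cL.
have [j _ /(_ j (leqnn _)) [{}h1 {}h2]] := filterI h1 h2.
have /cvgrPdist_le/(_ _ e3) := cgL j; apply: filterS => N h3.
have h4 := dist_characteristic_le a N fi (gi j).
rewrite -/(D j) in h4; rewrite sub0r normrN in h1.
have h5 := le_trans h4 (le_trans (ler_norm _) h1).
rewrite -/(L f); move: h2 h3 h5.
move: (L f) (L (g j)) (\int[P]_w _) (\int[P]_w _) => l l' x y h2 h3 h5.
rewrite (_ : l - x = (l - l') + ((l' - y) + (y - x))); last by ring.
rewrite (le_trans (ler_normD _ _))// (_ : e = e / 3 + (e / 3 + e / 3)); last by field.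
rewrite lerD// (le_trans (ler_normD _ _))// lerD//.
by rewrite distrC.
Qed.

End shot_noise_characteristic.

(** * The shot-noise field *)

Section square_integrable.
Context d (V : measurableType d) (R : realType) (mu : {measure set V -> \bar R}).

Lemma integrable_bounded_mul (f g : V -> R) (M : R) :
  mu.-integrable setT (EFin \o f) -> measurable_fun setT g ->
  (forall x, `|g x| <= M) ->
  mu.-integrable setT (EFin \o (fun x => f x * g x)).
Proof.
move=> fi mg gM; have mf : measurable_fun setT f.
  by apply/measurable_EFinP; exact: measurable_int fi.
apply: (le_integrable measurableT _ _ (integrable_EFinZ M (integrable_norm fi))).
  by apply/measurable_EFinP; exact: measurable_funM.
move=> x _ /=; rewrite lee_fin [leRHS]ger0_norm; last first.
  by rewrite mulr_ge0//; exact: le_trans (gM x).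
by rewrite normrM mulrC ler_wpM2r.
Qed.

End square_integrable.

Section shot_noise_field.
Context d (T : measurableType d) (R : realType) (n : nat).
Variables (P : probability T R) (lam : R) (X : nat -> {RV P >-> 'rV[R]_n})
  (A : nat -> {RV P >-> R}) (FP : probability R R) (ell : 'rV[R]_n -> R).
Hypotheses (lam0 : 0 < lam) (poisX : poisson_process P lam X).
Hypotheses (indA : independent_RVs P A) (indAX : independent_seqs P A X).
Hypothesis lawA : forall k, has_law P (A k) FP.
Hypothesis A0 : forall k w, 0 <= A k w.
Hypothesis iFP : FP.-integrable setT (EFin \o (fun t : R => t)).
Hypothesis mell : measurable_fun setT ell.
Hypothesis ell0 : forall x, 0 <= ell x.
Local Notation mu := (@lebesgue_rV R n).
Hypothesis ell_int : (\int[mu]_x (ell x)%:E < +oo)%E.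
Local Notation p := (mean_amplitude FP).
Local Notation S := (shot_noise A X ell).

Lemma measurable_shifted (z : 'rV[R]_n) :
  measurable_fun setT (fun x : 'rV[R]_n => ell (z - x)).
Proof. by apply: measurableT_comp => //; exact: measurable_reflection. Qed.

Lemma integrable_shifted (z : 'rV[R]_n) :
  mu.-integrable setT (EFin \o (fun x : 'rV[R]_n => ell (z - x))).
Proof.
apply/integrableP; split; first by apply/measurable_EFinP; exact: measurable_shifted.
under eq_integral do rewrite /= ger0_norm//.
rewrite (ge0_integral_reflection z (f := fun x => (ell x)%:E))//.
exact/measurable_EFinP.
Qed.

Lemma integrable_shifted_sum m (z : 'I_m -> 'rV[R]_n) (t : 'I_m -> R) :
  mu.-integrable setT (EFin \o (fun x : 'rV[R]_n => \sum_i t i * ell (z i - x))) /\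
  \int[mu]_x (\sum_i t i * ell (z i - x)) = \sum_i t i * \int[mu]_x ell (z i - x).
Proof.
elim: (index_enum _) => [|i s [IHi IH]].
  rewrite big_nil; under eq_Rintegral do rewrite big_nil.
  rewrite [X in X = _]/Rintegral integral0; split => //.
  rewrite (_ : EFin \o _ = cst 0%E); first exact: integrable0.
  by apply/funext => x /=; rewrite big_nil.
have ic := integrable_EFinZ (t i) (integrable_shifted (z i)).
rewrite big_cons -IH; split.
  under eq_fun do rewrite big_cons.
  by have := integrableD measurableT ic IHi; exact: eq_integrable.
under eq_Rintegral do rewrite big_cons.
rewrite RintegralD// RintegralZl//; exact: integrable_shifted.
Qed.

Let mterm (z : 'rV[R]_n) k : measurable_fun setT (fun w => A k w * ell (z - X k w)).
Proof.
apply: measurable_funM; first exact: measurable_funPT.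
by apply: measurableT_comp (measurable_shifted z) _; exact: measurable_funPT.
Qed.

Let term_ge0 (z : 'rV[R]_n) k w : 0 <= A k w * ell (z - X k w).
Proof. by rewrite mulr_ge0. Qed.

Lemma measurable_shot_noise z : measurable_fun setT (S z).
Proof.
apply: ge0_emeasurable_sum => [k w _ _|k _]; first by rewrite lee_fin.
exact/measurable_EFinP.
Qed.

Lemma shot_noise_ge0 z w : (0 <= S z w)%E.
Proof. by apply: nneseries_ge0 => k _ _; rewrite lee_fin. Qed.

Lemma shot_noise_expectation z :
  (\int[P]_w S z w)%E = (lam * (p * \int[mu]_x ell (z - x)))%:E.
Proof.
rewrite /shot_noise integral_nneseries//; last 2 first.
- by move=> k; exact/measurable_EFinP.
- by move=> k w _; rewrite lee_fin.
transitivity (p%:E * (lam%:E * \int[mu]_x (ell (z - x))%:E))%E.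
  rewrite -(campbell_marked (A := A) lam0 poisX indAX lawA A0 iFP)//.
    by apply/measurable_EFinP; exact: measurable_shifted.
  by move=> x; rewrite lee_fin.
have -> : (\int[mu]_x (ell (z - x))%:E)%E = (\int[mu]_x ell (z - x))%:E.
  by rewrite /Rintegral fineK//; exact: integrable_fin_num (integrable_shifted z).
by rewrite -!EFinM mulrCA.
Qed.

Lemma shot_noise_ae_fin_num z : {ae P, forall w, S z w \is a fin_num}.
Proof.
have : P.-integrable setT (S z).
  apply/integrableP; split; first exact: measurable_shot_noise.
  under eq_integral do rewrite gee0_abs ?shot_noise_ge0//.
  by rewrite shot_noise_expectation ltry.
move=> /(integrable_ae measurableT); apply: filterS => w; exact.
Qed.

Lemma cvg_shot_noise z w : S z w \is a fin_num ->
  \sum_(0 <= k < N) A k w * ell (z - X k w) @[N --> \oo] --> fine (S z w).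
Proof.
move=> Sz; have c : (\sum_(0 <= k < N) (A k w * ell (z - X k w))%:E)%E @[N --> \oo] --> (fine (S z w))%:E.
  by rewrite fineK//; apply: is_cvg_nneseries => k _ _; rewrite lee_fin.
have := fine_cvg c; rewrite (_ : fine \o _ = fun N =>
    \sum_(0 <= k < N) A k w * ell (z - X k w)); first by apply.
by apply/funext => N /=; rewrite sumEFin.
Qed.

(** A combination of values of the field is a single marked sum, whose function is the combination
    of the shifted responses; almost surely all the series involved are finite, so [fine] commutes
    with their limits. *)
Lemma shot_noise_characteristic m (z : 'I_m -> 'rV[R]_n) (t : 'I_m -> R) (a : R) :
  \int[P]_w cos (a + \sum_i t i * fine (S (z i) w)) =
  expR (lam * \int[mu]_x (char_re FP (\sum_i t i * ell (z i - x)) - 1)) *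
  cos (a + lam * \int[mu]_x char_im FP (\sum_i t i * ell (z i - x))).
Proof.
pose f x := \sum_i t i * ell (z i - x).
have fi : mu.-integrable setT (EFin \o f) by exact: (integrable_shifted_sum _ _).1.
have c1 := cvg_characteristic lam0 poisX indA indAX lawA A0 iFP (a := a) fi.
apply: (cvg_unique _ _ c1) => //.
have mX : forall k, measurable_fun setT (fun w => f (X k w)).
  move=> k; have mf : measurable_fun setT f by apply/measurable_EFinP; exact: measurable_int fi.
  by apply: measurableT_comp => //; exact: measurable_funPT.
apply: (@dominated_convergence_Rintegral _ _ _ P _ _ (cst 1) _ _ _ _ _).2.
- move=> N; apply: (bounded_measurable_cos _).1; apply: measurable_funD => //.
  apply: measurable_sum => k; apply: measurable_funM => //; exact: measurable_funPT.
- apply: (bounded_measurable_cos _).1; apply: measurable_funD => //.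
  apply: measurable_sum => i; apply: measurable_funM => //.
  exact: measurableT_comp (measurable_shot_noise _).
- have : {ae P, forall w, forall i, S (z i) w \is a fin_num}.
    by apply: filter_forall => i; exact: shot_noise_ae_fin_num.
  apply: filterS => w hw; apply: continuous_cvg; first exact: continuous_cos.
  apply: cvgD; first exact: cvg_cst.
  rewrite (_ : (fun N => _) = fun N => \sum_i t i * \sum_(0 <= k < N) A k w * ell (z i - X k w)).
    by apply: cvg_sum => i; apply: cvgM; [exact: cvg_cst|exact: cvg_shot_noise].
  apply/funext => N; under [RHS]eq_bigr do rewrite mulr_sumr.
  rewrite exchange_big/=; apply: eq_bigr => k _; rewrite /f mulr_sumr.
  by apply: eq_bigr => i _; ring.
- exact: bounded_measurable_integrable (bounded_measurable_cst _ _).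
- by move=> N w; exact: cos_max.
Qed.

Local Notation Y := (normalized_shot_noise P lam A X ell).

Lemma measurable_normalized_shot_noise z : measurable_fun setT (Y z).
Proof.
apply: measurable_funM => //; apply: measurable_funB => //.
exact: measurableT_comp (measurable_shot_noise _).
Qed.

Lemma normalized_shot_noise_characteristic m (z : 'I_m -> 'rV[R]_n)
    (t : 'I_m -> R) (a : R) :
  \int[P]_w cos (a + \sum_i t i * Y (z i) w) =
  expR (\int[mu]_x (lam * (char_re FP ((\sum_i t i * ell (z i - x)) / Num.sqrt lam) - 1))) *
  cos (a + \int[mu]_x (lam * (char_im FP ((\sum_i t i * ell (z i - x)) / Num.sqrt lam)
            - p * ((\sum_i t i * ell (z i - x)) / Num.sqrt lam)))).
Proof.
pose q := (Num.sqrt lam)^-1; pose f x := \sum_i t i * ell (z i - x).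
have [fi intf] := integrable_shifted_sum z t.
have fqi : mu.-integrable setT (EFin \o (fun x => f x * q)).
  rewrite (_ : EFin \o _ = EFin \o (fun x => q * f x)); first exact: integrable_EFinZ.
  by apply/funext => x /=; rewrite mulrC.
have intfq : \int[mu]_x (f x * q) = \int[mu]_x f x * q by rewrite RintegralZr.
rewrite RintegralZl//; last exact: integrable_char_re.
have pfqi := integrable_EFinZ p fqi.
have ifqi := integrable_char_im iFP fqi.
have -> : \int[mu]_x (lam * (char_im FP (f x * q) - p * (f x * q))) =
    lam * \int[mu]_x char_im FP (f x * q) - lam * (p * (\int[mu]_x f x * q)).
  rewrite RintegralZl//; last first.
    by have := integrableB measurableT ifqi pfqi; apply: eq_integrable.
  by rewrite RintegralB// RintegralZl// intfq mulrBr.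
(* The centring is deterministic and hence goes into the phase; inside the integral it becomes the
   term - p y, which cancels the first order of the sine part. *)
have := shot_noise_characteristic z (fun i => t i * q) (a - lam * (p * (\int[mu]_x f x * q))).
have fE x : \sum_i t i * q * ell (z i - x) = f x * q.
  by rewrite /f mulr_suml; apply: eq_bigr => i _; rewrite mulrAC.
under [in X in _ = X -> _]eq_Rintegral do rewrite fE.
under [X in _ = _ * cos (_ + _ * X) -> _]eq_Rintegral do rewrite fE.
rewrite addrAC -addrA => <-; apply: eq_Rintegral => w _; congr cos.
rewrite -addrA; congr (_ + _); rewrite intf mulr_suml !mulr_sumr -sumrN -big_split/=.
apply: eq_bigr => i _; rewrite /normalized_shot_noise shot_noise_expectation /= -/q; ring.
Qed.

End shot_noise_field.

(** * The high intensity limit of the exponent *)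

Section scaling_limit.
Context d (V : measurableType d) (R : realType) (mu : {measure set V -> \bar R}).
Variables (FP : probability R R) (phi : R -> R) (C c : R).
Hypothesis iFP2 : FP.-integrable setT (EFin \o (fun t : R => t ^+ 2)).
Hypotheses (mphi : measurable_fun setT phi)
  (phi_le : forall y, `|phi y| <= C * y ^+ 2)
  (phi_lim : forall (s : nat -> R) (y : R), (forall n, 0 < s n) ->
     (s n)^-1 @[n --> \oo] --> (0 : R) ->
     (s n) ^+ 2 * phi (y / s n) @[n --> \oo] --> c * y ^+ 2).

(** This treats cos y - 1 and sin y - y together: [phi] is bounded by C y^2 and has quadratic
    coefficient c, namely - 1 / 2 and 0. The averages are the real and imaginary parts of the
    amplitude characteristic function, less 1 and p a. *)
Definition scaled_mean (a : R) : R := \int[FP]_t phi (a * t).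
Hypothesis mscaled_mean : measurable_fun setT scaled_mean.

Local Notation E2 := (\int[FP]_t (t ^+ 2)).

Let C0 : 0 <= C.
Proof. by have := phi_le 1; rewrite expr1n mulr1; exact: le_trans. Qed.

Let E20 : 0 <= E2.
Proof. by apply: Rintegral_ge0 => t _; exact: sqr_ge0. Qed.

Lemma integrable_scaled_mean a : FP.-integrable setT (EFin \o (fun t => phi (a * t))).
Proof.
apply: (le_integrable measurableT _ _ (integrable_EFinZ (C * a ^+ 2) iFP2)).
  by apply/measurable_EFinP; apply: measurableT_comp => //; exact: measurable_funM.
move=> t _ /=; rewrite lee_fin [leRHS]ger0_norm; last first.
  by apply: mulr_ge0; [apply: mulr_ge0 => //|]; exact: sqr_ge0.
by rewrite (le_trans (phi_le _))// exprMn mulrA.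
Qed.

Lemma normr_scaled_mean_le a : `|scaled_mean a| <= C * E2 * a ^+ 2.
Proof.
rewrite (le_trans (le_normr_Rintegral _ (integrable_scaled_mean a)))//.
rewrite mulrAC -RintegralZl//; apply: le_Rintegral => //.
- exact: (integrable_norm (integrable_scaled_mean a)).
- exact: integrable_EFinZ.
- by move=> t _; rewrite (le_trans (phi_le _))// exprMn mulrA.
Qed.

(** The integrand is dominated by C y^2 t^2, integrable by the second moment of the amplitudes. *)
Lemma cvg_scaled_mean (s : nat -> R) (y : R) : (forall n, 0 < s n) ->
  (s n)^-1 @[n --> \oo] --> (0 : R) ->
  (s n) ^+ 2 * scaled_mean (y / s n) @[n --> \oo] --> c * E2 * y ^+ 2.
Proof.
move=> s0 s_lim; rewrite mulrAC.
have -> : c * y ^+ 2 * E2 = \int[FP]_t (c * y ^+ 2 * t ^+ 2) by rewrite RintegralZl.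
rewrite (_ : (fun n => _) = fun n => \int[FP]_t ((s n) ^+ 2 * phi (y / s n * t))); last first.
  by apply/funext => n; rewrite RintegralZl//; exact: integrable_scaled_mean.
apply: (dominated_convergence_Rintegral _ _ _ (integrable_EFinZ (C * y ^+ 2) iFP2) _).2.
- move=> n; apply: measurable_funM => //; apply: measurableT_comp => //.
  exact: measurable_funM.
- apply: aeW => t; rewrite -mulrA -exprMn.
  rewrite (_ : (fun n => _) = fun n => s n ^+ 2 * phi (y * t / s n)).
    exact: phi_lim.
  by apply/funext => n; rewrite (mulrAC y).
- move=> n t; rewrite normrM ger0_norm ?sqr_ge0//.
  apply: (@le_trans _ _ (s n ^+ 2 * (C * (y / s n * t) ^+ 2))).
    by rewrite ler_wpM2l ?sqr_ge0.
  rewrite le_eqVlt; apply/orP; left; apply/eqP; field; rewrite gt_eqF//.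
Qed.

Variable f : V -> R.
Hypotheses (mf : measurable_fun setT f)
  (if2 : mu.-integrable setT (EFin \o (fun x => f x ^+ 2))).

Let scaled_le (s : R) x : 0 < s ->
  `|s ^+ 2 * scaled_mean (f x / s)| <= C * E2 * f x ^+ 2.
Proof.
move=> s0; rewrite normrM ger0_norm ?sqr_ge0//.
apply: (@le_trans _ _ (s ^+ 2 * (C * E2 * (f x / s) ^+ 2))).
  by rewrite ler_wpM2l ?sqr_ge0// normr_scaled_mean_le.
by rewrite le_eqVlt; apply/orP; left; apply/eqP; field; rewrite gt_eqF.
Qed.

Let mscaled (s : R) : measurable_fun setT (fun x => s ^+ 2 * scaled_mean (f x / s)).
Proof.
apply: measurable_funM => //; apply: measurableT_comp => //.
exact: measurable_funM.
Qed.

(** Valid at every scale s and not only in the limit; it leads to second moments bounded uniformly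
    in the intensity. *)
Lemma normr_Rintegral_scaled_mean_le (s : R) : 0 < s ->
  `|\int[mu]_x (s ^+ 2 * scaled_mean (f x / s))| <= C * E2 * \int[mu]_x (f x ^+ 2).
Proof.
move=> s0.
have hi : mu.-integrable setT (EFin \o (fun x => s ^+ 2 * scaled_mean (f x / s))).
  apply: (le_integrable measurableT _ _ (integrable_EFinZ (C * E2) if2)).
    exact/measurable_EFinP.
  move=> x _ /=; rewrite lee_fin (le_trans (scaled_le x s0))// ler_norm//.
rewrite (le_trans (le_normr_Rintegral _ hi))//.
rewrite -RintegralZl//; apply: le_Rintegral => //.
- exact: (integrable_norm hi).
- exact: integrable_EFinZ.
- by move=> x _; exact: scaled_le.
Qed.

Lemma cvg_Rintegral_scaled_mean (s : nat -> R) : (forall n, 0 < s n) ->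
  (s n)^-1 @[n --> \oo] --> (0 : R) ->
  \int[mu]_x ((s n) ^+ 2 * scaled_mean (f x / s n)) @[n --> \oo] -->
  c * E2 * \int[mu]_x (f x ^+ 2).
Proof.
move=> s0 s_lim; rewrite -RintegralZl//.
apply: (dominated_convergence_Rintegral _ _ _ (integrable_EFinZ (C * E2) if2) _).2.
- by move=> n; exact: mscaled.
- by apply: measurable_funM => //; exact: measurable_funX.
- by apply: aeW => x; exact: cvg_scaled_mean.
- by move=> n x; exact: scaled_le.
Qed.

End scaling_limit.

Section characteristic_scaling.
Context d (V : measurableType d) (R : realType) (mu : {measure set V -> \bar R}).
Variables (FP : probability R R).
Hypothesis iFP : FP.-integrable setT (EFin \o (fun t : R => t)).
Hypothesis iFP2 : FP.-integrable setT (EFin \o (fun t : R => t ^+ 2)).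
Hypothesis FP0 : {ae FP, forall t : R, 0 <= t}.
Local Notation p := (mean_amplitude FP).
Local Notation E2 := (\int[FP]_t (t ^+ 2)).

Let mix_cos : scaled_mean FP (fun y => cos y - 1) = fun a => char_re FP a - 1.
Proof.
apply/funext => a; rewrite /scaled_mean bounded_RintegralB.
- by rewrite Rintegral_probability_cst.
- exact: bounded_measurable_cos_scale.
- exact: bounded_measurable_cst.
Qed.

Let mean_id : \int[FP]_t t = p.
Proof.
rewrite /mean_amplitude /Rintegral; congr fine.
apply: ae_eq_integral => //.
- by apply/measurable_EFinP; exact: normr_measurable.
- by apply: filterS FP0 => t t0 _; rewrite ger0_norm.
Qed.

Let mix_sin : scaled_mean FP (fun y => sin y - y) = fun a => char_im FP a - p * a.
Proof.
apply/funext => a; rewrite /scaled_mean RintegralB//.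
- by rewrite RintegralZl// mean_id mulrC.
- exact: bounded_measurable_integrable (bounded_measurable_sin_scale a).
- exact: integrable_EFinZ.
Qed.

Let cos_le (y : R) : `|cos y - 1| <= 2^-1 * y ^+ 2.
Proof.
by rewrite distrC ger0_norm ?one_minus_cos_ge0// mulrC one_minus_cos_le.
Qed.

Let sin_le (y : R) : `|sin y - y| <= 1 * y ^+ 2.
Proof. by rewrite mul1r sin_approx2. Qed.

Let cvg_squeeze (u v : nat -> R) (l : R) : v n @[n --> \oo] --> (0 : R) ->
  (forall n, `|l - u n| <= v n) -> u n @[n --> \oo] --> l.
Proof.
move=> v0 uv; apply/cvgrPdist_le => e e0.
have /cvgrPdist_le/(_ e e0) := v0; apply: filterS => n.
by rewrite sub0r normrN => /(le_trans (ler_norm _)); exact: le_trans.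
Qed.

Let cos_lim (s : nat -> R) (y : R) : (forall n, 0 < s n) ->
  (s n)^-1 @[n --> \oo] --> (0 : R) ->
  (s n) ^+ 2 * (cos (y / s n) - 1) @[n --> \oo] --> - 2^-1 * y ^+ 2.
Proof.
move=> s0 s_lim.
apply: (@cvg_squeeze _ (fun n => y ^+ 4 / 24 * ((s n)^-1 * (s n)^-1))).
  rewrite -(mulr0 (y ^+ 4 / 24)); apply: cvgM; first exact: cvg_cst.
  by rewrite -[X in _ --> X](mulr0 0); exact: cvgM.
move=> n; have := one_minus_cos_approx (y / s n).
rewrite -(ler_pM2l (exprn_gt0 2 (s0 n))) => h.
rewrite -[X in `|X|](_ : - (s n ^+ 2 * ((y / s n) ^+ 2 / 2 - (1 - cos (y / s n)))) = _); last first.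
  by move: (cos _) => u; field; rewrite gt_eqF.
rewrite normrN normrM (ger0_norm (sqr_ge0 _)) (le_trans h)//.
by rewrite le_eqVlt; apply/orP; left; apply/eqP; field; rewrite gt_eqF.
Qed.

Let sin_lim (s : nat -> R) (y : R) : (forall n, 0 < s n) ->
  (s n)^-1 @[n --> \oo] --> (0 : R) ->
  (s n) ^+ 2 * (sin (y / s n) - y / s n) @[n --> \oo] --> 0 * y ^+ 2.
Proof.
move=> s0 s_lim; rewrite mul0r.
apply: (@cvg_squeeze _ (fun n => `|y| ^+ 3 / 6 * (s n)^-1)).
  by rewrite -(mulr0 (`|y| ^+ 3 / 6)); apply: cvgM => //; exact: cvg_cst.
move=> n; have := sin_approx3 (y / s n).
rewrite -(ler_pM2l (exprn_gt0 2 (s0 n))) => h.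
rewrite sub0r normrN normrM (ger0_norm (sqr_ge0 _)) (le_trans h)//.
rewrite normrM normfV (gtr0_norm (s0 n)).
by rewrite le_eqVlt; apply/orP; left; apply/eqP; field; rewrite gt_eqF.
Qed.

Let msin : measurable_fun setT (fun y : R => sin y - y).
Proof.
apply: measurable_funB => //.
exact: (continuous_measurable_fun (@continuous_sin R)).
Qed.

Let mcos : measurable_fun setT (fun y : R => cos y - 1).
Proof.
apply: measurable_funB => //.
exact: (continuous_measurable_fun (@continuous_cos R)).
Qed.

Let mmix_cos : measurable_fun setT (scaled_mean FP (fun y => cos y - 1)).
Proof. by rewrite mix_cos; apply: measurable_funB => //; exact: measurable_char_re. Qed.

Let mmix_sin : measurable_fun setT (scaled_mean FP (fun y => sin y - y)).
Proof.
rewrite mix_sin; apply: measurable_funB; first exact: measurable_char_im.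
exact: measurable_funM.
Qed.

Variable f : V -> R.
Hypotheses (mf : measurable_fun setT f)
  (if2 : mu.-integrable setT (EFin \o (fun x => f x ^+ 2))).

Lemma cvg_Rintegral_char_re (s : nat -> R) : (forall n, 0 < s n) ->
  (s n)^-1 @[n --> \oo] --> (0 : R) ->
  \int[mu]_x ((s n) ^+ 2 * (char_re FP (f x / s n) - 1)) @[n --> \oo] -->
  - (E2 * \int[mu]_x (f x ^+ 2) / 2).
Proof.
move=> s0 s_lim.
have := cvg_Rintegral_scaled_mean iFP2 mcos cos_le cos_lim mmix_cos mf if2 s0 s_lim.
by rewrite mix_cos (_ : - 2^-1 * _ * _ = - (E2 * \int[mu]_x (f x ^+ 2) / 2)); last by ring.
Qed.

Lemma cvg_Rintegral_char_im (s : nat -> R) : (forall n, 0 < s n) ->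
  (s n)^-1 @[n --> \oo] --> (0 : R) ->
  \int[mu]_x ((s n) ^+ 2 * (char_im FP (f x / s n) - p * (f x / s n)))
    @[n --> \oo] --> (0 : R).
Proof.
move=> s0 s_lim.
have := cvg_Rintegral_scaled_mean iFP2 msin sin_le sin_lim mmix_sin mf if2 s0 s_lim.
by rewrite mix_sin !mul0r.
Qed.

Lemma normr_Rintegral_char_re_le (s : R) : 0 < s ->
  `|\int[mu]_x (s ^+ 2 * (char_re FP (f x / s) - 1))| <=
  E2 * \int[mu]_x (f x ^+ 2) / 2.
Proof.
move=> s0; have := normr_Rintegral_scaled_mean_le iFP2 mcos cos_le mmix_cos mf if2 s0.
by rewrite mix_cos (_ : 2^-1 * _ * _ = E2 * \int[mu]_x (f x ^+ 2) / 2); last by ring.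
Qed.

Lemma normr_Rintegral_char_im_le (s : R) : 0 < s ->
  `|\int[mu]_x (s ^+ 2 * (char_im FP (f x / s) - p * (f x / s)))| <=
  E2 * \int[mu]_x (f x ^+ 2).
Proof.
move=> s0; have := normr_Rintegral_scaled_mean_le iFP2 msin sin_le mmix_sin mf if2 s0.
by rewrite mix_sin mul1r.
Qed.

End characteristic_scaling.

(** * Second moments and Gaussian fields *)

Lemma measurable_normr_gt d (T : measurableType d) (R : realType) (Y : T -> R)
    (K : R) : measurable_fun setT Y -> measurable [set w | K < `|Y w|].
Proof.
move=> mY; rewrite -[Z in measurable Z]setCK; apply: measurableC.
rewrite (_ : ~` _ = [set w | `|Y w| <= K]); last first.
  by apply/seteqP; split => w /=; [move=> /negP; rewrite -leNgt|rewrite leNgt => /negP].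
rewrite -[Z in measurable Z]setTI; apply: measurable_fun_le => //.
exact: measurableT_comp.
Qed.

(** Chebyshev's inequality: K^2 times the indicator of the tail is at most Y^2. *)
Lemma second_moment_tail d (T : measurableType d) (R : realType)
    (P : probability T R) (Y : T -> R) (v K : R) :
  measurable_fun setT Y -> (\int[P]_w (Y w ^+ 2)%:E <= v%:E)%E -> 0 < K ->
  (P [set w | (K < `|Y w|)%R] <= (v / K ^+ 2)%:E)%E.
Proof.
move=> mY Yv K0; have K2 : 0 < K ^+ 2 by rewrite exprn_gt0.
have mB : measurable [set w | K < `|Y w|] by exact: measurable_normr_gt.
rewrite EFinM lee_pdivlMr// muleC; apply: le_trans Yv.
rewrite -[X in P X]setIT -integral_indic// -ge0_integralZl//; last 2 first.
- by apply/measurable_EFinP; exact: measurable_indic.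
- by rewrite lee_fin ltW.
apply: ge0_le_integral => //.
- by move=> w _; rewrite -EFinM lee_fin; apply: mulr_ge0; rewrite ?indicE// ltW.
- by apply/measurable_EFinP; apply: measurable_funM => //; exact: measurable_indic.
- by apply/measurable_EFinP; exact: measurable_funX.
- move=> w _; rewrite -EFinM lee_fin indicE.
  case: (boolP (w \in _)) => [/set_mem/= KY|_]; last by rewrite mulr0 sqr_ge0.
  rewrite mulr1 -(real_normK (num_real (Y w))) ler_pXn2r ?nnegrE//; exact: ltW.
Qed.

Section shot_noise_moments.
Context d (T : measurableType d) (R : realType) (n : nat).
Variables (P : probability T R) (lam : R) (X : nat -> {RV P >-> 'rV[R]_n})
  (A : nat -> {RV P >-> R}) (FP : probability R R) (ell : 'rV[R]_n -> R) (M : R).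
Hypotheses (lam0 : 0 < lam) (poisX : poisson_process P lam X).
Hypotheses (indA : independent_RVs P A) (indAX : independent_seqs P A X).
Hypothesis lawA : forall k, has_law P (A k) FP.
Hypothesis A0 : forall k w, 0 <= A k w.
Hypothesis iFP : FP.-integrable setT (EFin \o (fun t : R => t)).
Hypothesis iFP2 : FP.-integrable setT (EFin \o (fun t : R => t ^+ 2)).
Hypothesis FP0 : {ae FP, forall t : R, 0 <= t}.
Hypothesis mell : measurable_fun setT ell.
Hypothesis ell0 : forall x, 0 <= ell x.
Hypothesis ellM : forall x, ell x <= M.
Local Notation mu := (@lebesgue_rV R n).
Hypothesis ell_int : (\int[mu]_x (ell x)%:E < +oo)%E.
Local Notation E2 := (\int[FP]_t (t ^+ 2)).

Lemma integrable_shifted_mul (z z' : 'rV[R]_n) :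
  mu.-integrable setT (EFin \o (fun x : 'rV[R]_n => ell (z - x) * ell (z' - x))).
Proof.
apply: (integrable_bounded_mul (M := M)).
- exact: integrable_shifted.
- exact: measurable_shifted.
- by move=> x; rewrite ger0_norm.
Qed.

Lemma integrable_shifted_sum_sqr m (z : 'I_m -> 'rV[R]_n) (t : 'I_m -> R) :
  mu.-integrable setT
    (EFin \o (fun x : 'rV[R]_n => (\sum_i t i * ell (z i - x)) ^+ 2)).
Proof.
have [fi _] := integrable_shifted_sum mell ell0 ell_int z t.
under eq_fun do rewrite expr2.
apply: (integrable_bounded_mul (M := \sum_i `|t i| * M)) => //.
  by apply/measurable_EFinP; exact: measurable_int fi.
move=> x; rewrite (le_trans (ler_norm_sum _ _ _))//; apply: ler_sum => i _.
by rewrite normrM ler_wpM2l// ger0_norm.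
Qed.

Local Notation Y := (normalized_shot_noise P lam A X ell).

(** At frequency 1 / N the characteristic function is exp(I) cos J with |I| <= y / 2 and |J| <= y,
    where y = v / N^2; so 2 N^2 (1 - exp(I) cos J) is at most v + v^2 / N^2. The bound does not
    depend on lam, as tightness requires. *)
Lemma normalized_shot_noise_second_moment z :
  (\int[P]_w (Y z w ^+ 2)%:E <= (E2 * \int[mu]_x (ell (z - x) ^+ 2))%:E)%E.
Proof.
set v := E2 * _.
have v0 : 0 <= v by rewrite mulr_ge0// Rintegral_ge0// => x _; exact: sqr_ge0.
apply: second_moment_le_of_characteristic.
  exact: measurable_normalized_shot_noise.
move=> e e0; near=> k.
(* The first condition gives y <= 1, hence cos J >= 0; the second makes the remainder N^2 y^2 at
   most e. *)
have vk : v <= k%:R by near: k; exact: nbhs_infty_ger.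
have vek : v ^+ 2 / e <= k%:R by near: k; exact: nbhs_infty_ger.
have kN : k%:R <= k.+1%:R :> R by rewrite ler_nat.
have {vk}vN := le_trans vk kN; have {vek kN}veN := le_trans vek kN.
set N : R := k.+1%:R in vN veN *.
have N1 : 1 <= N by rewrite ler1n.
have N0 : 0 < N by rewrite ltr0n.
pose f (x : 'rV[R]_n) := \sum_(i < 1) N^-1 * ell (z - x).
have fE x : f x = N^-1 * ell (z - x) by rewrite /f big_ord1.
have s0 : 0 < Num.sqrt lam by rewrite sqrtr_gt0.
have s2 : Num.sqrt lam ^+ 2 = lam by rewrite sqr_sqrtr// ltW.
have mf : measurable_fun setT f.
  apply/measurable_EFinP.
  exact: measurable_int (integrable_shifted_sum mell ell0 ell_int (fun=> z) (fun=> N^-1)).1.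
have if2 : mu.-integrable setT (EFin \o (fun x => f x ^+ 2)).
  exact: integrable_shifted_sum_sqr (fun=> z) (fun=> N^-1).
have Ef : E2 * \int[mu]_x (f x ^+ 2) = v / N ^+ 2.
  have -> : \int[mu]_x (f x ^+ 2) = N^-1 ^+ 2 * \int[mu]_x (ell (z - x) ^+ 2).
    rewrite -RintegralZl//; last first.
      by under eq_fun do rewrite expr2; exact: integrable_shifted_mul.
    by apply: eq_Rintegral => x _; rewrite fE exprMn.
  by rewrite /v exprVn mulrCA mulrC.
have h1 := normr_Rintegral_char_re_le iFP iFP2 mf if2 s0.
have h2 := normr_Rintegral_char_im_le iFP iFP2 FP0 mf if2 s0.
rewrite s2 Ef in h1 h2.
have := normalized_shot_noise_characteristic lam0 poisX indA indAX lawA A0 iFP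
  mell ell0 ell_int (fun _ : 'I_1 => z) (fun=> N^-1) 0.
under eq_Rintegral do rewrite add0r big_ord1 mulrC.
rewrite add0r => ->; move: h1 h2; rewrite -/(f _).
move: (\int[mu]_x _) (\int[mu]_x _) => J I h1 h2.
have NN : N <= N ^+ 2 by rewrite expr2 ler_pMl.
have N20 : 0 < N ^+ 2 by rewrite exprn_gt0.
set y := v / N ^+ 2 in h1 h2.
have y0 : 0 <= y by rewrite divr_ge0// ltW.
have y1 : y <= 1 by rewrite ler_pdivrMr// mul1r (le_trans vN).
have vE : v = y * N ^+ 2 by rewrite /y divfK// gt_eqF.
have vy : N ^+ 2 * y ^+ 2 <= e.
  have -> : N ^+ 2 * y ^+ 2 = v ^+ 2 / N ^+ 2 by rewrite /y; field; rewrite gt_eqF.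
  by rewrite ler_pdivrMr// mulrC -ler_pdivrMr// (le_trans veN).
have cJ := one_minus_cos_le J.
have J2 : J ^+ 2 <= y ^+ 2.
  by rewrite -(real_normK (num_real J)) ler_pXn2r ?nnegrE.
have y21 : y ^+ 2 <= y by rewrite expr2 ler_piMl.
have cJ0 : 0 <= cos J by lra.
have eI : 1 - y / 2 <= expR I.
  apply: le_trans (expR_ge1Dx I); move: h1; rewrite ler_norml => /andP[h _]; lra.
have h3 : (1 - y / 2) * cos J <= expR I * cos J by rewrite ler_wpM2r.
have h4 : y / 2 * cos J <= y / 2.
  by rewrite -[leRHS]mulr1 ler_wpM2l ?cos_le1//; lra.
have h5 : 1 - expR I * cos J <= y / 2 + y ^+ 2 / 2 by nra.
have h6 := ler_wpM2l (ltW N20) h5.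
rewrite vE -mulrA; nra.
Unshelve. all: by end_near. Qed.

End shot_noise_moments.

Lemma integrable_sqrD d (V : measurableType d) (R : realType)
    (mu : {measure set V -> \bar R}) (f g : V -> R) :
  mu.-integrable setT (EFin \o (fun x => f x ^+ 2)) ->
  mu.-integrable setT (EFin \o (fun x => g x ^+ 2)) ->
  mu.-integrable setT (EFin \o (fun x => f x * g x)) ->
  mu.-integrable setT (EFin \o (fun x => (f x + g x) ^+ 2)).
Proof.
move=> hf hg hfg.
have h1 := integrableD measurableT hf hg.
have := integrableD measurableT h1 (integrable_EFinZ 2 hfg).
apply: eq_integrable => // x _ /=; rewrite -!EFinD; congr EFin; ring.
Qed.

Lemma integrable_mul_of_sqr d (V : measurableType d) (R : realType)
    (mu : {measure set V -> \bar R}) (f g : V -> R) :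
  mu.-integrable setT (EFin \o (fun x => f x ^+ 2)) ->
  mu.-integrable setT (EFin \o (fun x => g x ^+ 2)) ->
  mu.-integrable setT (EFin \o (fun x => (f x + g x) ^+ 2)) ->
  mu.-integrable setT (EFin \o (fun x => f x * g x)).
Proof.
move=> hf hg hfg.
have h1 := integrableB measurableT (integrableB measurableT hfg hf) hg.
have h2 : mu.-integrable setT (EFin \o (fun x => (f x + g x) ^+ 2 - f x ^+ 2 - g x ^+ 2)).
  by move: h1; apply: eq_integrable.
have := integrable_EFinZ 2^-1 h2.
by apply: eq_integrable => // x _ /=; congr EFin; field.
Qed.

Lemma Rintegral_sqrD d (V : measurableType d) (R : realType)
    (mu : {measure set V -> \bar R}) (f g : V -> R) :
  mu.-integrable setT (EFin \o (fun x => f x ^+ 2)) ->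
  mu.-integrable setT (EFin \o (fun x => g x ^+ 2)) ->
  mu.-integrable setT (EFin \o (fun x => f x * g x)) ->
  \int[mu]_x ((f x + g x) ^+ 2) =
  \int[mu]_x (f x ^+ 2) + \int[mu]_x (g x ^+ 2) + 2 * \int[mu]_x (f x * g x).
Proof.
move=> hf hg hfg.
have hs : mu.-integrable setT (EFin \o (fun x => f x ^+ 2 + g x ^+ 2)).
  by have := integrableD measurableT hf hg; apply: eq_integrable.
rewrite -RintegralD// -RintegralZl// -RintegralD//.
  by apply: eq_Rintegral => x _; ring.
exact: integrable_EFinZ.
Qed.

Section gaussian_limit.
Context d (T : measurableType d) (R : realType) (Q : probability T R).
Variables (I : Type) (N : I -> {RV Q >-> R}).
Variables (d' : measure_display) (V : measurableType d')
  (mu : {measure set V -> \bar R}) (E2 : R) (f : I -> V -> R).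
Hypothesis E20 : 0 <= E2.
Hypothesis f_int : forall i j, mu.-integrable setT (EFin \o (fun x => f i x * f j x)).
Hypothesis comb_int : forall (m : nat) (z : 'I_m -> I) (t : 'I_m -> R),
  mu.-integrable setT (EFin \o (fun x => (\sum_i t i * f (z i) x) ^+ 2)).
Hypothesis char_N : forall (m : nat) (z : 'I_m -> I) (a : R) (t : 'I_m -> R),
  \int[Q]_s cos (a + \sum_i t i * N (z i) s) =
  expR (- (E2 * \int[mu]_x ((\sum_i t i * f (z i) x) ^+ 2) / 2)) * cos a.

Let mN i : measurable_fun setT (N i). Proof. exact: measurable_funPT. Qed.

Let mcomb m (z : 'I_m -> I) (t : 'I_m -> R) :
  measurable_fun setT (fun s => \sum_i t i * N (z i) s).
Proof. by apply: measurable_sum => i; exact: measurable_funM. Qed.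

(** Multiplying all coefficients by s gives the whole characteristic function of one combination,
    and uniqueness identifies its law. *)
Lemma gaussian_field_of_characteristic : gaussian_field Q N.
Proof.
move=> m z t; set Y := fun w => _.
have mY : measurable_fun setT Y by exact: mcomb.
pose v := E2 * \int[mu]_x ((\sum_i t i * f (z i) x) ^+ 2).
have v0 : 0 <= v by rewrite mulr_ge0// Rintegral_ge0// => x _; exact: sqr_ge0.
have char_Y (a s : R) : \int[law Q mY]_y cos (a + s * y) =
    expR (- (s ^+ 2 * v / 2)) * cos a.
  rewrite Rintegral_law; last by apply: bounded_measurable_cos; apply: measurable_funD => //; exact: measurable_funM.
  have := char_N z a (fun i => s * t i).
  have -> : E2 * \int[mu]_x ((\sum_i s * t i * f (z i) x) ^+ 2) = s ^+ 2 * v.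
    rewrite /v mulrCA; congr (_ * _).
    rewrite -RintegralZl//; apply: eq_Rintegral => x _; rewrite -exprMn mulr_sumr.
    by congr (_ ^+ 2); apply: eq_bigr => i _; rewrite mulrA.
  move=> <-; apply: eq_Rintegral => w _; congr (cos (_ + _)).
  by rewrite mulr_sumr; apply: eq_bigr => i _; rewrite mulrA.
(* Variance 0 is the degenerate Gaussian law, a Dirac mass at 0. *)
have [v_eq0|v_neq0] := eqVneq v 0.
  right; exists 0 => B mB.
  rewrite -(lawE Q mY); apply: eq_law_of_characteristic mB => a s.
  rewrite char_Y v_eq0 mulr0 mul0r oppr0 expR0 mul1r.
  rewrite /Rintegral integral_dirac//; last first.
    apply/measurable_EFinP; apply: (bounded_measurable_cos _).1.
    by apply: measurable_funD => //; exact: measurable_funM.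
  by rewrite diracT mul1e mulr0 addr0.
left; exists 0, (Num.sqrt v).
have sv0 : Num.sqrt v != 0 by rewrite sqrtr_eq0 -ltNge lt_def v_neq0.
split => // B mB; rewrite -(lawE Q mY).
(* The identity transports the normal law from [measurableTypeR R] to the measurable type on which
   laws are compared. *)
have mid : measurable_fun [set: measurableTypeR R] (fun x : measurableTypeR R => x : R).
  by move=> _ C mC; rewrite setTI.
have h (a s : R) : \int[law Q mY]_y cos (a + s * y) =
    \int[law (normal_prob 0 (Num.sqrt v)) mid]_y cos (a + s * y).
  rewrite char_Y Rintegral_law; last first.
    by apply: bounded_measurable_cos; apply: measurable_funD => //; exact: measurable_funM.
  by rewrite normal_characteristic// sqr_sqrtr.
exact: (eq_law_of_characteristic h mB).
Qed.

Let char_1 i (a s : R) : \int[Q]_w cos (a + s * N i w) =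
  expR (- (s ^+ 2 * (E2 * \int[mu]_x (f i x ^+ 2)) / 2)) * cos a.
Proof.
have := char_N (fun _ : 'I_1 => i) a (fun=> s).
under eq_Rintegral do rewrite big_ord1.
under [in X in _ = X -> _]eq_Rintegral do rewrite big_ord1 exprMn.
move=> ->; rewrite RintegralZl//; last first.
  by under eq_fun do rewrite expr2.
by congr (expR (- (_ / 2)) * _); ring.
Qed.

Let f2 k : mu.-integrable setT (EFin \o (fun x => f k x ^+ 2)).
Proof. by under eq_fun do rewrite expr2. Qed.

Let char_2 i j (a s : R) : \int[Q]_w cos (a + s * (N i w + N j w)) =
  expR (- (s ^+ 2 * (E2 * \int[mu]_x ((f i x + f j x) ^+ 2)) / 2)) * cos a.
Proof.
have := char_N (fun k : 'I_2 => if k == ord0 then i else j) a (fun=> s).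
under eq_Rintegral do rewrite big_ord_recl big_ord1/= -mulrDr.
under [in X in _ = X -> _]eq_Rintegral do rewrite big_ord_recl big_ord1/= -mulrDr exprMn.
move=> ->; rewrite RintegralZl//; last first.
  exact: integrable_sqrD.
by congr (expR (- (_ / 2)) * _); ring.
Qed.

Let var_ge0 (g : V -> R) : 0 <= E2 * \int[mu]_x (g x ^+ 2).
Proof. by rewrite mulr_ge0// Rintegral_ge0// => x _; exact: sqr_ge0. Qed.

Let moments i := moments_of_normal_characteristic (mN i) (var_ge0 (f i)) (char_1 i).

Lemma limit_expectation i : ('E_Q[N i] = 0)%E.
Proof.
rewrite unlock; have [_ iN _ N0] := moments i.
by rewrite -[RHS]/(0%:E) -N0 /Rintegral fineK//; exact: integrable_fin_num.
Qed.

(** Polarization: the second moments of N i, N j and N i + N j come from one-dimensional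
    characteristic functions, and expanding the square on both sides leaves the mixed terms. *)
Lemma limit_covariance i j :
  (covariance Q (N i) (N j) = E2%:E * \int[mu]_x (f i x * f j x)%:E)%E.
Proof.
have [iNi2 _ vi _] := moments i; have [iNj2 _ vj _] := moments j.
have mS : measurable_fun setT (fun w => N i w + N j w) by exact: measurable_funD.
have [iS2 _ vS _] := moments_of_normal_characteristic mS (var_ge0 (fun x => f i x + f j x)) (char_2 i j).
have iNN : Q.-integrable setT (EFin \o (fun w => N i w * N j w)).
  exact: integrable_mul_of_sqr.
have -> : covariance Q (N i) (N j) = (\int[Q]_w (N i w * N j w)%:E)%E.
  rewrite unlock !limit_expectation/= unlock; apply: eq_integral => w _ /=.
  by rewrite fctE /= !subr0.
rewrite !Rintegral_sqrD// vi vj in vS.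
have -> : (\int[Q]_w (N i w * N j w)%:E)%E = (\int[Q]_w (N i w * N j w))%:E.
  by rewrite /Rintegral fineK//; exact: integrable_fin_num.
have -> : (\int[mu]_x (f i x * f j x)%:E)%E = (\int[mu]_x (f i x * f j x))%:E.
  by rewrite /Rintegral fineK//; exact: integrable_fin_num (f_int i j).
rewrite -EFinM; congr EFin; move: vS.
by move: (\int[mu]_x _) (\int[mu]_x _) (\int[mu]_x _) (\int[Q]_x _) => *; lra.
Qed.

End gaussian_limit.

(** * The limit theorem *)

Section shot_noise_limit.
Context (R : realType) (n : nat) (ell : 'rV[R]_n -> R) (M : R) (FP : probability R R).
Hypothesis mell : measurable_fun setT ell.
Hypothesis ell0 : forall x, 0 <= ell x.
Hypothesis ellM : forall x, ell x <= M.
Local Notation mu := (@lebesgue_rV R n).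
Hypothesis ell_int : (\int[mu]_x (ell x)%:E < +oo)%E.
Hypothesis iFP : FP.-integrable setT (EFin \o (fun t : R => t)).
Hypothesis iFP2 : FP.-integrable setT (EFin \o (fun t : R => t ^+ 2)).
Hypothesis FP0 : {ae FP, forall t : R, 0 <= t}.
Variables (dT : R -> measure_display)
  (T : forall lam, measurableType (dT lam))
  (Pr : forall lam, probability (T lam) R)
  (X : forall lam, nat -> {RV (Pr lam) >-> 'rV[R]_n})
  (A : forall lam, nat -> {RV (Pr lam) >-> R}).
Hypothesis X_poisson : forall lam, 0 < lam -> poisson_process (Pr lam) lam (X lam).
Hypothesis A0 : forall lam, 0 < lam -> forall k w, 0 <= A lam k w.
Hypothesis A_law : forall lam, 0 < lam -> forall k, has_law (Pr lam) (A lam k) FP.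
Hypothesis A_indep : forall lam, 0 < lam -> independent_RVs (Pr lam) (A lam).
Hypothesis AX_indep : forall lam, 0 < lam ->
  independent_seqs (Pr lam) (A lam) (X lam).

Local Notation E2 := (\int[FP]_t (t ^+ 2)).
Local Notation Y lam := (normalized_shot_noise (Pr lam) lam (A lam) (X lam) ell).
Local Notation f z t x := (\sum_i t i * ell (z i - x)).

Let mY lam z : 0 < lam -> measurable_fun setT (Y lam z).
Proof.
by move=> lam0; apply: measurable_normalized_shot_noise => //; exact: A0.
Qed.

(** Along sequences dominated convergence applies. With s the square root of the intensity, the
    factor lam = s^2 matches the quadratic order of the exponent at scale 1 / s. *)
Lemma cvg_normalized_characteristic (u : nat -> R) m (z : 'I_m -> 'rV[R]_n)
    (t : 'I_m -> R) (a : R) :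
  (forall k, 0 < u k) -> u k @[k --> \oo] --> +oo ->
  \int[Pr (u k)]_w cos (a + \sum_i t i * Y (u k) (z i) w) @[k --> \oo] -->
  expR (- (E2 * \int[mu]_x (f z t x ^+ 2) / 2)) * cos a.
Proof.
move=> u0 u_oo; pose s k := Num.sqrt (u k).
have s0 k : 0 < s k by rewrite sqrtr_gt0.
have s2 k : s k ^+ 2 = u k by rewrite sqr_sqrtr// ltW.
have s_lim : (s k)^-1 @[k --> \oo] --> (0 : R).
  apply/cvgrPdist_le => e e0.
  have /cvgryPge/(_ (e^-1 ^+ 2)) := u_oo; apply: filterS => k uk.
  rewrite sub0r normrN normfV gtr0_norm// invf_ple ?posrE//.
  rewrite -(@ler_pXn2r _ 2) ?nnegrE ?s2//; first by rewrite invr_ge0 ltW.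
  exact: ltW.
have mf : measurable_fun setT (fun x : 'rV[R]_n => f z t x).
  apply/measurable_EFinP.
  exact: measurable_int (integrable_shifted_sum mell ell0 ell_int z t).1.
have if2 := integrable_shifted_sum_sqr mell ell0 ellM ell_int z t.
rewrite (_ : (fun k => _) = fun k =>
    expR (\int[mu]_x (s k ^+ 2 * (char_re FP (f z t x / s k) - 1))) *
    cos (a + \int[mu]_x (s k ^+ 2 *
      (char_im FP (f z t x / s k) - mean_amplitude FP * (f z t x / s k))))); last first.
  apply/funext => k; rewrite s2.
  exact: (normalized_shot_noise_characteristic (u0 k) (X_poisson (u0 k))
    (A_indep (u0 k)) (AX_indep (u0 k)) (A_law (u0 k)) (A0 (u0 k)) iFP mell ell0
    ell_int z t a).
have c1 := cvg_Rintegral_char_re iFP iFP2 mf if2 s0 s_lim.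
have c2 := cvg_Rintegral_char_im iFP iFP2 FP0 mf if2 s0 s_lim.
apply: cvgM; first by apply: continuous_cvg => //; exact: continuous_expR.
rewrite -[X in _ --> cos X]addr0; apply: continuous_cvg; first exact: continuous_cos.
by apply: cvgD; [exact: cvg_cst|exact: c2].
Qed.

Let v z := E2 * \int[mu]_x (ell (z - x) ^+ 2).

Let v0 z : 0 <= v z.
Proof.
by rewrite mulr_ge0 ?Rintegral_ge0// => x _; exact: sqr_ge0.
Qed.

Lemma normalized_shot_noise_tail lam z (K : R) : 0 < lam -> 0 < K ->
  (Pr lam [set w | (K < `|Y lam z w|)%R] <= (v z / K ^+ 2)%:E)%E.
Proof.
move=> lam0 K0; apply: second_moment_tail => //; first exact: mY.
exact: normalized_shot_noise_second_moment (X_poisson lam0) (A_indep lam0)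
  (AX_indep lam0) (A_law lam0) (A0 lam0) _ _ _ _ _ _ _ _.
Qed.

Let tail_level (c e : R) : 0 <= c -> 0 < e ->
  exists2 K0 : R, 0 < K0 & forall K, K0 <= K -> c / K ^+ 2 <= e.
Proof.
(* The added 1 makes K >= 1, so that K <= K^2. *)
move=> c0 e0; exists (c / e + 1) => [|K hK]; first by rewrite ltr_wpDl// divr_ge0// ltW.
have K1 : 1 <= K by rewrite (le_trans _ hK)// lerDr divr_ge0// ltW.
have K0 : 0 < K by exact: lt_le_trans K1.
rewrite ler_pdivrMr ?exprn_gt0// mulrC -ler_pdivrMr// (@le_trans _ _ K)//.
  by rewrite (le_trans _ hK)// lerDl.
by rewrite expr2 ler_pMl.
Qed.

Lemma exists_gaussian_limit :
  exists (dS : measure_display) (S : measurableType dS) (Q : probability S R)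
    (N : 'rV[R]_n -> {RV Q >-> R}),
  forall (m : nat) (z : 'I_m -> 'rV[R]_n) (a : R) (t : 'I_m -> R),
    \int[Q]_s cos (a + \sum_i t i * N (z i) s) =
    expR (- (E2 * \int[mu]_x (f z t x ^+ 2) / 2)) * cos a.
Proof.
pose u k : R := k.+1%:R; have u0 k : 0 < u k by rewrite ltr0n.
have u_oo : u k @[k --> \oo] --> +oo.
  apply/cvgryPge => K; near=> k; apply: (@le_trans _ _ k%:R); last by rewrite ler_nat.
  near: k; exact: nbhs_infty_ger.
have [||dS [S [Q [N HN]]]] := @exists_limit_field R (fun k => dT (u k)) (fun k => T (u k))
    (fun k => Pr (u k)) 'rV[R]_n (fun k z => Y (u k) z).
- by move=> k z; exact: mY.
- move=> z e e0; have [K K0 hK] := tail_level (v0 z) e0.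
  exists K; apply: nearW => k; rewrite -lee_fin fineK ?fin_num_measure//.
    by rewrite (le_trans (normalized_shot_noise_tail _ _ _))// lee_fin hK.
  by apply: measurable_normr_gt; exact: mY.
exists dS, S, Q, N => m z a t; apply: HN; exact: cvg_normalized_characteristic.
Unshelve. all: by end_near. Qed.

Lemma cvg_fdd_of_characteristic (dS : measure_display) (S : measurableType dS)
    (Q : probability S R) (N : 'rV[R]_n -> {RV Q >-> R}) :
  (forall (m : nat) (z : 'I_m -> 'rV[R]_n) (a : R) (t : 'I_m -> R),
    \int[Q]_s cos (a + \sum_i t i * N (z i) s) =
    expR (- (E2 * \int[mu]_x (f z t x ^+ 2) / 2)) * cos a) ->
  cvg_fdd Pr (fun lam => Y lam) Q N.
Proof.
move=> char_N m z g cg [M0 gM].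
have bg := continuous_bounded_measurable cg gM.
have mW : measurable_fun setT (fun w => \row_i N (z i) w).
  by apply: measurable_fun_coordP => i; under eq_fun do rewrite mxE; exact: measurable_funPT.
have E d1 (T1 : measurableType d1) (P1 : probability T1 R) (V : T1 -> 'rV[R]_m)
    (mV : measurable_fun setT V) :
    ('E_P1[g \o V] = (\int[law P1 mV]_x g x)%:E)%E.
  rewrite unlock Rintegral_law// -EFin_bounded_Rintegral//.
  exact: bounded_measurable_comp.
apply/cvge_pinftyP => u u_oo; rewrite (E _ _ _ _ mW).
(* The hypotheses hold only at positive intensities; [u'] is positive for all k and agrees with [u]
   from some index on. *)
pose u' k := if 0 < u k then u k else 1.
have u'0 k : 0 < u' k by rewrite /u'; case: ifPn.
have uu' : \forall k \near \oo, u' k = u k.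
  have /cvgryPgt/(_ 0) := u_oo; apply: filterS => k.
  by rewrite /u' => ->.
have u'_oo : u' k @[k --> \oo] --> +oo.
  by move: u_oo; apply: cvg_trans; apply: near_eq_cvg; apply: filterS uu'.
pose V k w := \row_i Y (u' k) (z i) w.
have mV k : measurable_fun setT (V k).
  by apply: measurable_fun_coordP => i; under eq_fun do rewrite mxE; exact: mY.
pose nu k := law (Pr (u' k)) (mV k).
suff c : \int[nu k]_x g x @[k --> \oo] --> \int[law Q mW]_x g x.
  apply: (@cvg_trans _ ((fun k => (\int[nu k]_x g x)%:E) @ \oo)); last first.
    by apply: cvg_EFin => //; exact: nearW.
  apply: near_eq_cvg; apply: filterS uu' => k uk.
  by rewrite -(E _ _ _ _ (mV k)) /V uk.
apply: (cvg_of_characteristic _ _ cg); last by exists M0.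
- move=> a t.
  have bd : bounded_measurable (fun x : 'rV[R]_m => cos (a + dot t x)).
    by apply: bounded_measurable_cos; apply: measurable_funD => //; exact: measurable_dot.
  rewrite Rintegral_law//.
  have -> : \int[Q]_w cos (a + dot t (\row_i N (z i) w)) =
      \int[Q]_w cos (a + \sum_i t i * N (z i) w).
    by apply: eq_Rintegral => w _; rewrite /dot; under eq_bigr do rewrite mxE.
  rewrite char_N; under eq_fun do rewrite Rintegral_law//.
  rewrite (_ : (fun k => _) =
    fun k => \int[Pr (u' k)]_w cos (a + \sum_i t i * Y (u' k) (z i) w)).
    exact: cvg_normalized_characteristic.
  apply/funext => k; apply: eq_Rintegral => w _; rewrite /dot /V.
  by under eq_bigr do rewrite mxE.
- move=> e e0.
  have [K1 K10 tK1] := tight_probability (law Q mW) e0.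
  have sv0 : 0 <= \sum_i v (z i) by rewrite sumr_ge0.
  have [K2 K20 tK2] := tail_level sv0 e0.
  exists (Num.max K1 K2); first by rewrite lt_max K10.
  split; last first.
    apply: le_trans tK1; apply: le_measure; rewrite ?inE;
      do ?[exact: measurableC (measurable_cube _)].
    by apply: subsetC => x xK i; rewrite (le_trans (xK i))// le_max lexx.
  set K := Num.max K1 K2; have K0 : 0 < K by rewrite lt_max K10.
  apply: nearW => k; rewrite /nu lawE.
  pose B i := [set w | K < `|Y (u' k) (z i) w|].
  have mB i : measurable (B i) by apply: measurable_normr_gt; exact: mY.
  (* Union bound over the coordinates, each tail being estimated by Chebyshev's inequality uniformly
     in the intensity. *)
  apply: (@le_trans _ _ (Pr (u' k) (\big[setU/set0]_i B i))).
    apply: le_measure; rewrite ?inE.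
    - rewrite -[Z in measurable Z]setTI.
      exact: (mV k measurableT _ (measurableC (measurable_cube K))).
    - exact: bigsetU_measurable.
    - move=> w /= /existsNP[i hi]; rewrite -bigcup_seq; exists i; first by rewrite /= mem_index_enum.
      by move: hi; rewrite mxE => /negP; rewrite -ltNge.
  apply: (@le_trans _ _ (\sum_i Pr (u' k) (B i))%E).
    elim: (index_enum _) => [|i s IH]; first by rewrite !big_nil measure0.
    have mU : measurable (\big[setU/set0]_(j <- s) B j) by exact: bigsetU_measurable.
    by rewrite !big_cons (le_trans (measureU2 _ (mB i) mU))// leeD2l.
  apply: (@le_trans _ _ (((\sum_i v (z i)) / K ^+ 2)%:E)); last first.
    by rewrite lee_fin tK2// le_max lexx orbT.
  rewrite mulr_suml -sumEFin; apply: lee_sum => i _.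
  exact: normalized_shot_noise_tail.
Qed.

End shot_noise_limit.

Section amplitude_law.
Context d (T : measurableType d) (R : realType) (P : probability T R).
Variables (A : {RV P >-> R}) (FP : probability R R).
Hypotheses (A0 : forall w, 0 <= A w) (lawA : has_law P A FP).

Lemma has_law_ge0 : {ae FP, forall t : R, 0 <= t}.
Proof.
have mB : measurable (`]-oo, 0[%classic : set R) by exact: measurable_itv.
exists `]-oo, 0[%classic; split => //.
  rewrite -lawA// (_ : _ @^-1` _ = set0) ?measure0//.
  apply/seteqP; split => w //=; rewrite in_itv/= => Aw.
  by have := lt_le_trans Aw (A0 w); rewrite ltxx.
by move=> t /= /negP; rewrite -ltNge in_itv.
Qed.

End amplitude_law.

Theorem proposition1 (R : realType) (d : nat) (d_gt0 : (0 < d)%N)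
  (ell : 'rV[R]_d -> R)
  (ell_meas : measurable_fun setT ell)
  (ell_ge0 : forall x, 0 <= ell x)
  (ell_bounded : exists M : R, forall x, ell x <= M)
  (ell_integrable : (\int[lebesgue_rV d]_x (ell x)%:E < +oo)%E)
  (FP : probability R R)
  (FP_mean : ('E_FP[fun t => t] < +oo)%E)
  (FP_second_moment : ('E_FP[fun t => (t ^+ 2)%R] < +oo)%E)
  (dT : R -> measure_display)
  (T : forall lam, measurableType (dT lam))
  (Pr : forall lam, probability (T lam) R)
  (X : forall lam, nat -> {RV (Pr lam) >-> 'rV[R]_d})
  (A : forall lam, nat -> {RV (Pr lam) >-> R})
  (X_poisson : forall lam, 0 < lam -> poisson_process (Pr lam) lam (X lam))
  (A_ge0 : forall lam, 0 < lam -> forall n w, 0 <= A lam n w)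
  (A_law : forall lam, 0 < lam -> forall n, has_law (Pr lam) (A lam n) FP)
  (A_indep : forall lam, 0 < lam -> independent_RVs (Pr lam) (A lam))
  (AX_indep : forall lam, 0 < lam -> independent_seqs (Pr lam) (A lam) (X lam)) :
  exists (dS : measure_display) (S : measurableType dS) (Q : probability S R)
    (N : 'rV[R]_d -> {RV Q >-> R}),
    [/\ gaussian_field Q N,
        (forall z, 'E_Q[N z] = 0)%E,
        (forall z1 z2, covariance Q (N z1) (N z2) =
           ('E_FP[fun t => (t ^+ 2)%R] *
            \int[lebesgue_rV d]_x (ell (z1 - x) * ell (z2 - x))%:E)%E)
      & cvg_fdd Pr
          (fun lam => normalized_shot_noise (Pr lam) lam (A lam) (X lam) ell)
          Q N].
Proof.
have [M ellM] := ell_bounded.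
(* The nonnegativity of [FP] is inherited from the amplitudes at intensity 1. *)
have FP0 := has_law_ge0 (A_ge0 1 ltr01 0%N) (A_law 1 ltr01 0%N).
(* By nonnegativity the means of t and |t| agree, so a finite mean gives integrability. *)
have iFP : FP.-integrable setT (EFin \o (fun t : R => t)).
  apply/integrableP; split; first exact/measurable_EFinP.
  rewrite (_ : (\int[FP]_t `|(EFin \o (fun t : R => t)) t| = 'E_FP[fun t => t])%E)//.
  rewrite unlock; apply: ae_eq_integral => //.
  - by apply/measurable_EFinP; exact: normr_measurable.
  - by apply: filterS FP0 => t t0 _ /=; rewrite ger0_norm.
have iFP2 : FP.-integrable setT (EFin \o (fun t : R => t ^+ 2)).
  apply/integrableP; split; first by apply/measurable_EFinP; exact: measurable_funX.
  move: FP_second_moment; rewrite unlock; apply: le_lt_trans.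
  by under eq_integral do rewrite /= ger0_norm ?sqr_ge0//.
have E2E : ('E_FP[fun t => (t ^+ 2)%R] = (\int[FP]_t (t ^+ 2))%:E)%E.
  by rewrite unlock /Rintegral fineK//; exact: integrable_fin_num iFP2.
have [dS [S [Q [N char_N]]]] := exists_gaussian_limit ell_meas ell_ge0 ellM
  ell_integrable iFP iFP2 FP0 X_poisson A_ge0 A_law A_indep AX_indep.
have E20 : 0 <= \int[FP]_t (t ^+ 2) by apply: Rintegral_ge0 => t _; exact: sqr_ge0.
have f_int z1 z2 := integrable_shifted_mul ell_meas ell_ge0 ellM ell_integrable z1 z2.
have comb_int m (z : 'I_m -> 'rV[R]_d) t :=
  integrable_shifted_sum_sqr ell_meas ell_ge0 ellM ell_integrable z t.
pose g (z x : 'rV[R]_d) := ell (z - x).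
exists dS, S, Q, N; split.
- exact: (gaussian_field_of_characteristic (f := g) E20 comb_int char_N).
- by move=> z; exact: (limit_expectation (f := g) E20 f_int char_N).
- move=> z1 z2; rewrite E2E.
  exact: (limit_covariance (f := g) E20 f_int char_N).
- exact: cvg_fdd_of_characteristic char_N.
Qed.
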